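(* Let $x\ge 0$ be such that $f(x)>0$. Assume that: (1) for all $t\in\mathbb{Z}$, the conditional density $f^{\mathcal{F}_{t-1}}$ of $X_t$ given $\mathcal{F}_{t-1}$ exists, $f^{\mathcal{F}_{t-1}}\in C_0(\mathbb{R})$, and $f\in C_0(\mathbb{R})$; (2) $\left\|\frac1n\sum_{t=1}^n f^{\mathcal{F}_{t-1}}-f\right\|_0\to 0$ almost surely as $n\to+\infty$; (3) $R$ is a continuous and bounded function on $[0,+\infty[$; (4) $E(\Phi(Y_t)\mid\mathcal{G}_{t-1})=E(\Phi(Y_t)\mid X_t)=R(X_t)$ for all $t\in\mathbb{Z}$; (5) $E\left(|\Phi(Y_1)|^{\zeta+2}\right)<+\infty$ for some $\zeta>0$; (6) (i) $E(\Phi(Y_t)^2\mid\mathcal{G}_{t-1})=E(\Phi(Y_t)^2\mid X_t)=W_2(X_t)$ for all $t\in\mathbb{Z}$; (ii) for the same $\zeta$, $W_{\zeta+2}(y)=E\left(|\Phi(Y_1)|^{\zeta+2}\mid X_1=y\right)$, $y\ge0$, is a bounded function; (iii) $\sigma^2(y)=V(\Phi(Y_1)\mid X_1=y)$, $y\ge0$, is a continuous function; (7) the second order derivatives of $f$ and $R$ are continuous and bounded on $[0,+\infty[$; (8) $\sup_{y\ge 0}\left\|\sum_{t=1}^n f^{\mathcal{F}_{t-1}}(y)-nf(y)\right\|_2^2=O(n)$. a) If $x>0$, $\lim_{n\to+\infty}n\sqrt{h_n}=+\infty$ and $\lim_{n\to+\infty}n\sqrt{h_n^5}=0$, then $$\sqrt{n\sqrt{h_n}}\,\left(R_n(x)-R(x)\right)\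 \xrightarrow[n\to+\infty]{\mathcal{D}}\ \mathcal{N}\left(0,\frac{\sigma^2(x)}{2\sqrt{\pi x}\,f(x)}\right).$$ b) If $x=0$, $\lim_{n\to+\infty}n\,h_n=+\infty$ and $\lim_{n\to+\infty}n\,h_n^3=0$, then $$\sqrt{n\,h_n}\,\left(R_n(0)-R(0)\right)\ \xrightarrow[n\to+\infty]{\mathcal{D}}\ \mathcal{N}\left(0,\frac{\sigma^2(0)}{2f(0)}\right).$$
   Context: $\{(X_t,Y_t),\,t\in\mathbb{Z}\}$ is a strictly stationary and ergodic $[0,+\infty[^2$-valued stochastic process on a probability space $(\Omega,\mathcal{A},P)$, with absolutely continuous marginal distributions; $f$ is the density of $X_t$. $\Phi:[0,+\infty[\to\mathbb{R}$ is a known measurable function with $E(|\Phi(Y_1)|)<+\infty$, and $R(x)=E(\Phi(Y_1)\mid X_1=x)$ is the regression function (for $x\ge0$ with $f(x)>0$). $W_2(y)=E(\Phi(Y_1)^2\mid X_1=y)$, and $V(\cdot\mid X_1=y)$ denotes conditional variance. For $t\in\mathbb{Z}$, $\mathcal{F}_t=\sigma\{(X_s,Y_s),\,s\le t\}$ and $\mathcal{G}_t=\sigma\{X_{t+1},(X_s,Y_s),\,s\le t\}$. $C_0(\mathbb{R})$ is the space of continuous functions on $\mathbb{R}$ tending to zero at infinity, with the sup-norm $\|\cdot\|_0$; $\|\cdot\|_2$ is the norm of $L^2(\Omega,\mathcal{A},P)$. $\xrightarrow{\mathcal{D}}$ denotes convergence in distribution and $\mathcal{N}(0,v)$ the normal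 law with mean $0$ and variance $v$. The bandwidth sequence $(h_n)_{n\in\mathbb{N}}$ consists of positive reals with $\lim_{n\to+\infty}h_n=0$. For $x\ge 0$, $K_{\alpha(n,x),\beta(n)}$ is the density of the gamma distribution with shape $\alpha(n,x)=\frac{x}{h_n}+1$ and scale $\beta(n)=h_n$: $$K_{\alpha(n,x),\beta(n)}(y)=\frac{1}{\Gamma(\alpha(n,x))\,\beta(n)^{\alpha(n,x)}}\,y^{\alpha(n,x)-1}e^{-y/\beta(n)}\,\mathbb{1}_{[0,+\infty[}(y),\quad y\in\mathbb{R}.$$ The gamma kernel regression estimator is $$R_n(x)=\frac{\sum_{t=1}^n\Phi(Y_t)K_{\alpha(n,x),\beta(n)}(X_t)}{\sum_{t=1}^nK_{\alpha(n,x),\beta(n)}(X_t)},$$ with the convention $\frac{y}{0}=0$ for all $y\in\mathbb{R}$. *)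

(* Defs.v *)
From HB Require Import structures.
From mathcomp Require Export all_boot all_order all_algebra.
From mathcomp Require Export all_classical all_reals all_analysis.
Export Order.TTheory GRing.Theory Num.Theory.
Export numFieldNormedType.Exports.

Set Implicit Arguments.
Unset Strict Implicit.
Unset Printing Implicit Defensive.

Local Open Scope classical_set_scope.
Local Open Scope ring_scope.

Section functions_on_the_line.
Context {R : realType}.
Implicit Types g : R -> R.

Definition halfline : set R := `[0, +oo[.

Definition C0 g : Prop :=
  [/\ continuous g, g y @[y --> +oo%R] --> 0 & g y @[y --> -oo%R] --> 0].

(* Valued in \bar R, so that an unbounded function has norm +oo. *)
Definition supnorm g : \bar R := ereal_sup [set `|g y|%:E | y in [set: R]].

Definition bounded_on_halfline g : Prop :=
  exists M : R, forall y, 0 <= y -> `|g y| <= M.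

(* Derivative of g as a function on [0, +oo[ : one-sided at 0. *)
Definition derivative_on_halfline g g' : Prop :=
  forall y, 0 <= y ->
    (g z - g y) / (z - y) @[z --> within halfline y^'] --> g' y.

Definition bounded_C2 g : Prop :=
  exists g' g'' : R -> R,
    [/\ derivative_on_halfline g g', derivative_on_halfline g' g'',
        {within halfline, continuous g''} & bounded_on_halfline g''].

End functions_on_the_line.
Arguments halfline {R}.

Section gamma_kernel.
Context {R : realType}.

Definition Gamma (a : R) : R :=
  \int[lebesgue_measure]_(y in `]0, +oo[) (y `^ (a - 1) * expR (- y)).

(* At y = 0 and a = 1, powR 0 0 = 1, so that the value is b^-1. *)
Definition gamma_density (a b y : R) : R :=
  (Gamma a * b `^ a)^-1 * y `^ (a - 1) * expR (- (y / b)) * \1_halfline y.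

Definition gamma_kernel (h : nat -> R) (n : nat) (x : R) : R -> R :=
  gamma_density (x / h n + 1) (h n).

(* Relies on the convention y / 0 = 0. *)
Definition gamma_estimator T (Phi : R -> R) (h : nat -> R)
    (X Y : int -> T -> R) (n : nat) (x : R) (w : T) : R :=
  (\sum_(1 <= t < n.+1) Phi (Y t w) * gamma_kernel h n x (X t w)) /
  (\sum_(1 <= t < n.+1) gamma_kernel h n x (X t w)).

End gamma_kernel.

Section processes.
Context d (T : measurableType d) (R : realType) (P : probability T R).
Implicit Types X Y : int -> T -> R.

Definition strictly_stationary X Y : Prop :=
  forall (n : nat) (s : n.-tuple int) (k : int) (B : set (n.-tuple (R * R))),
    measurable B ->
    P [set w | B [tuple (X (tnth s i + k) w, Y (tnth s i + k) w) | i < n]] =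
    P [set w | B [tuple (X (tnth s i) w, Y (tnth s i) w) | i < n]].

(* The product sigma-algebra on the space of trajectories. *)
Definition path_measurable : set (set (int -> R * R)) :=
  <<s [set C | exists t (B : set (R * R)),
                 measurable B /\ C = [set z | B (z t)]] >>.

Definition path_shift (z : int -> R * R) : int -> R * R := fun t => z (t + 1).

Definition ergodic X Y : Prop :=
  forall E : set (int -> R * R),
    path_measurable E -> path_shift @^-1` E = E ->
    P [set w | E (fun t => (X t w, Y t w))] = 0%E \/
    P [set w | E (fun t => (X t w, Y t w))] = 1%E.

(* Sub-sigma-algebras of T are given by generating families. *)
Definition gen_var (Z : T -> R) : set (set T) :=
  preimage_set_system setT Z measurable.

(* generates F_t *)
Definition gen_F X Y (t : int) : set (set T) :=
  \bigcup_(s in [set s : int | s <= t])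
    preimage_set_system setT (fun w => (X s w, Y s w)) measurable.

(* generates G_t *)
Definition gen_G X Y (t : int) : set (set T) :=
  gen_var (X (t + 1)) `|` gen_F X Y t.

(* W is a version of E(Z | sigma(G)) *)
Definition is_cond_exp (G : set (set T)) (Z W : T -> R) : Prop :=
  [/\ P.-integrable setT (EFin \o Z), P.-integrable setT (EFin \o W),
      measurable_fun setT (W : g_sigma_algebraType G -> R) &
      forall A, <<s G >> A ->
        (\int[P]_(w in A) (W w)%:E = \int[P]_(w in A) (Z w)%:E)%E].

(* g(y) = E(Z | U = y), for U valued in [0, +oo[ *)
Definition is_cond_exp_at (Z U : T -> R) (g : R -> R) : Prop :=
  measurable_fun halfline g /\ is_cond_exp (gen_var U) Z (g \o U).

(* g(y) = V(Z | U = y) *)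
Definition is_cond_var_at (Z U : T -> R) (g : R -> R) : Prop :=
  exists m : R -> R, is_cond_exp_at Z U m /\
    is_cond_exp_at (fun w => (Z w - m (U w)) ^+ 2) U g.

(* Densities are taken with respect to Lebesgue measure on the state space
   [0, +oo[: nothing is required of their values at negative arguments.
   Otherwise a continuous density on R would have to vanish at 0. *)
Definition is_density (U : T -> R) (p : R -> R) : Prop :=
  [/\ measurable_fun halfline p, forall y, 0 <= y -> 0 <= p y &
      forall B, measurable B ->
        P (U @^-1` B) =
        (\int[lebesgue_measure]_(y in B `&` halfline) (p y)%:E)%E].

(* p w is the conditional density of U given sigma(G). *)
Definition is_cond_density (G : set (set T)) (U : T -> R) (p : T -> R -> R) :
    Prop :=
  [/\ measurable_fun (setT `*` halfline)
        ((fun z => p z.1 z.2) : g_sigma_algebraType G * R -> R),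
      forall w y, 0 <= y -> 0 <= p w y &
      forall A B, <<s G >> A -> measurable B ->
        P (A `&` U @^-1` B) =
        (\int[P]_(w in A)
           \int[lebesgue_measure]_(y in B `&` halfline) (p w y)%:E)%E].

Definition cvg_in_distribution (Z : nat -> T -> R)
    (mu : probability (measurableTypeR R) R) : Prop :=
  forall g : R -> R, continuous g -> (exists M, forall y, `|g y| <= M) ->
    ('E_P[g \o Z n] @[n --> \oo] --> \int[mu]_y (g y)%:E)%E.

End processes.

(* N(0, v). The library's normal_prob takes the standard deviation, and it is
   not the Dirac mass for standard deviation 0. *)
Definition centered_normal (R : realType) (v : R) :
    probability (measurableTypeR R) R :=
  if v == 0 as _ return probability (measurableTypeR R) R
  then \d_(0 : measurableTypeR R) else normal_prob 0 (Num.sqrt v).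

(* Main.v *)
(* Let K_n be the gamma kernel at x, c_n its width (sqrt h_n if x > 0, h_n if
   x = 0) and kappa = lim c_n \int K_n^2; Stirling's formula gives kappa =
   1 / (2 sqrt (pi x)), resp. 1/2. With f_n = n^-1 sum_k K_n(X_k),
     sqrt(n c_n) (R_n(x) - R(x)) = (f(x) A_n + B_n) / f_n,
     A_n = sqrt(c_n / n) sum_k (Phi(Y_k) - R(X_k)) K_n(X_k) / f(x),
     B_n = sqrt(c_n / n) sum_k (R(X_k) - R(x)) K_n(X_k).
   An average n^-1 sum_k g_n(X_k) is split into a martingale for F, controlled in
   L^2, and n^-1 sum_k \int g_n f^(F_(k-1)), compared with \int g_n f by (2) or (8).
   Hence f_n -> f(x), B_n -> 0 in probability (the deterministic bias is O(h_n) by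
   Taylor's formula), and the conditional variances of A_n add up to approximately
   s2 = sigma^2(x) kappa / f(x).
   A_n is a sum of martingale differences for G. With S_k its partial sums, V_k the
   accumulated conditional variances and w(t, .) the normal density of variance t,
   E w(b + s2 - V_k, S_k - a) is almost constant in k because w solves the heat
   equation; so the density of A_n smoothed by N(0, b) converges to that of
   N(0, b + s2), and b is arbitrary. *)
From mathcomp Require Import ring lra measurable_realfun.
Require Import Defs.
Set Implicit Arguments.
Unset Strict Implicit.
Unset Printing Implicit Defensive.
Local Open Scope classical_set_scope.
Local Open Scope ring_scope.

(** * Integrals of real-valued functions *)

(** The heat kernel serves twice: its Taylor expansion gives the martingale estimate, and, as a
    probability density in a up to a constant, it identifies the limit law. Two obstacles shape the
    estimate. The remaining time b + s2 - V_k is random and could become negative, so increments are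
    stopped by a predictable rule; and only moments of order 2 + p with p <= 1 are at hand, so the
    Taylor remainder is kept as min(z^2, |z|^3). The two comparisons of conditional densities with f
    play different roles. Where a limit without rate is enough (f_n and the conditional variances),
    uniform closeness is integrated against kernels of bounded L^1 norm. In B_n the error is
    multiplied by sqrt(n c_n): the O(n) bound makes it of order n^(-1/2), and sqrt(c_n) tends to 0.
    Conditional expectations are used only through integrals against bounded test variables, hence
    the clipping and truncation in several arguments. Convergence in probability is measured by E
    min(1, |Z|), which reduces products and quotients to pointwise inequalities. *)

Section integral_toolkit.
Context d (T : measurableType d) (R : realType) (mu : {measure set T -> \bar R}).
Implicit Types f g : T -> R.

Definition L1 f : Prop := mu.-integrable setT (EFin \o f).

Lemma L1_measurable f : L1 f -> measurable_fun setT f.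
Proof. by move=> /measurable_int /measurable_EFinP. Qed.

Lemma L1_le f g : measurable_fun setT f -> (forall x, `|f x| <= g x) ->
  L1 g -> L1 f.
Proof.
move=> mf fg; apply: le_integrable => //; first exact/measurable_EFinP.
by move=> x _ /=; rewrite lee_fin (le_trans (fg x))// ler_norm.
Qed.

Lemma L1_abs f : L1 f -> L1 (fun x => `|f x|).
Proof. exact: integrable_norm. Qed.

Lemma L1D f g : L1 f -> L1 g -> L1 (fun x => f x + g x).
Proof. exact: integrableD. Qed.

Lemma L1Z c f : L1 f -> L1 (fun x => c * f x).
Proof. exact: integrableZl. Qed.

Lemma L1Zr c f : L1 f -> L1 (fun x => f x * c).
Proof. by move=> /(L1Z c); apply: eq_integrable => // x _ /=; rewrite mulrC. Qed.

Lemma L1N f : L1 f -> L1 (fun x => - f x).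
Proof. by move=> /(L1Z (-1)); apply: eq_integrable => // x _ /=; rewrite mulN1r. Qed.

Lemma L1B f g : L1 f -> L1 g -> L1 (fun x => f x - g x).
Proof. by move=> lf /L1N; exact: L1D. Qed.

Lemma L1_0 : L1 (fun=> 0).
Proof. exact: integrable0. Qed.

Lemma L1_sum I (s : seq I) (F : I -> T -> R) : (forall i, L1 (F i)) ->
  L1 (fun x => \sum_(i <- s) F i x).
Proof.
move=> LF; elim: s => [|i s ih].
  by apply: eq_integrable L1_0 => // x _ /=; rewrite big_nil.
by apply: eq_integrable (L1D (LF i) ih) => // x _ /=; rewrite big_cons.
Qed.

Lemma L1_bndM g f M : measurable_fun setT g -> (forall x, `|g x| <= M) ->
  L1 f -> L1 (fun x => g x * f x).
Proof.
move=> mg gM lf; apply: (@L1_le _ (fun x => M * `|f x|)).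
- exact: measurable_funM mg (L1_measurable lf).
- by move=> x; rewrite normrM ler_wpM2r.
- exact/L1Z/L1_abs.
Qed.

Lemma IntE f : L1 f -> (\int[mu]_x f x)%:E = (\int[mu]_x (f x)%:E)%E.
Proof. by move=> lf; rewrite /Rintegral fineK//; exact: integrable_fin_num. Qed.

Lemma eq_Int f g : f =1 g -> \int[mu]_x f x = \int[mu]_x g x.
Proof. by move=> fg; apply: eq_Rintegral => x _; exact: fg. Qed.

Lemma IntD f g : L1 f -> L1 g ->
  \int[mu]_x (f x + g x) = \int[mu]_x f x + \int[mu]_x g x.
Proof. by move=> *; exact: RintegralD. Qed.

Lemma IntB f g : L1 f -> L1 g ->
  \int[mu]_x (f x - g x) = \int[mu]_x f x - \int[mu]_x g x.
Proof. by move=> *; exact: RintegralB. Qed.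

Lemma IntZ c f : L1 f -> \int[mu]_x (c * f x) = c * \int[mu]_x f x.
Proof. by move=> *; exact: RintegralZl. Qed.

Lemma IntZr c f : L1 f -> \int[mu]_x (f x * c) = \int[mu]_x f x * c.
Proof. by move=> *; exact: RintegralZr. Qed.

Lemma Int0 : \int[mu]_(x in [set: T]) (0 : R) = 0.
Proof. by rewrite /Rintegral integral0. Qed.

Lemma Int_sum I (s : seq I) (F : I -> T -> R) : (forall i, L1 (F i)) ->
  \int[mu]_x (\sum_(i <- s) F i x) = \sum_(i <- s) \int[mu]_x F i x.
Proof.
move=> LF; elim: s => [|i s ih].
  by rewrite big_nil -[RHS]Int0; apply: eq_Int => x; rewrite big_nil.
rewrite big_cons -ih -IntD//; last exact: L1_sum.
by apply: eq_Int => x; rewrite big_cons.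
Qed.

Lemma Int_le f g : L1 f -> L1 g -> (forall x, f x <= g x) ->
  \int[mu]_x f x <= \int[mu]_x g x.
Proof. by move=> lf lg fg; apply: le_Rintegral. Qed.

Lemma Int_ge0 f : (forall x, 0 <= f x) -> 0 <= \int[mu]_x f x.
Proof. by move=> f0; apply: Rintegral_ge0. Qed.

Lemma Int_abs f : L1 f -> `|\int[mu]_x f x| <= \int[mu]_x `|f x|.
Proof. by move=> lf; exact: le_normr_Rintegral. Qed.

Lemma Int_abs_le f g : L1 f -> L1 g -> (forall x, `|f x| <= g x) ->
  `|\int[mu]_x f x| <= \int[mu]_x g x.
Proof.
by move=> lf lg fg; apply: le_trans (Int_abs lf) _; apply: Int_le => //; exact: L1_abs.
Qed.

Lemma Int_ae_eq f g : measurable_fun setT f -> measurable_fun setT g ->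
  {ae mu, forall x, f x = g x} -> \int[mu]_x f x = \int[mu]_x g x.
Proof.
move=> mf mg fg; rewrite /Rintegral; congr fine.
apply: ae_eq_integral => //; [exact/measurable_EFinP|exact/measurable_EFinP|].
by apply: filterS fg => x /= -> _.
Qed.

Lemma Int_dct (F : nat -> T -> R) f g :
  (forall n, measurable_fun setT (F n)) -> measurable_fun setT f ->
  {ae mu, forall x, F n x @[n --> \oo] --> f x} ->
  L1 g -> (forall n x, `|F n x| <= g x) ->
  \int[mu]_x F n x @[n --> \oo] --> \int[mu]_x f x.
Proof.
move=> mF mf Ff lg Fg.
have [|||||lf _ h] := @dominated_convergence _ _ _ mu setT measurableT
  (fun n x => (F n x)%:E) (EFin \o f) (EFin \o g).
- by move=> n; exact/measurable_EFinP.
- exact/measurable_EFinP.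
- by apply: filterS Ff => x Fx _; exact/cvg_EFin/Fx/nearW.
- exact: lg.
- by apply: aeW => x n _ /=; rewrite lee_fin.
apply: fine_cvg.
rewrite -/(L1 f) in lf.
rewrite (IntE lf); exact: h.
Qed.

End integral_toolkit.

Section finite_measure.
Context d (T : measurableType d) (R : realType) (P : probability T R).
Implicit Types f g : T -> R.

Lemma L1_bnd f M : measurable_fun setT f -> (forall x, `|f x| <= M) -> L1 P f.
Proof.
move=> mf fM; apply: (@L1_le _ _ _ _ _ (cst M)) => //.
exact: finite_measure_integrable_cst.
Qed.

Lemma L1_cst c : L1 P (fun=> c).
Proof. exact: finite_measure_integrable_cst. Qed.

Lemma Int_cst c : \int[P]_(x in [set: T]) c = c.
Proof. by rewrite Rintegral_cst//= probability_setT/= mulr1. Qed.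

Lemma Int_bnd f M : L1 P f -> (forall x, `|f x| <= M) -> `|\int[P]_x f x| <= M.
Proof.
by move=> lf fM; rewrite -[leRHS]Int_cst; apply: Int_abs_le => //; exact: L1_cst.
Qed.

(** On a probability space constants are integrable, and |u| <= 1 + u^2. *)
Lemma L1_sqr f : measurable_fun setT f -> L1 P (fun x => f x ^+ 2) -> L1 P f.
Proof.
move=> mf lf; apply: (@L1_le _ _ _ _ _ (fun x => 1 + f x ^+ 2)) => //; last first.
  exact/L1D/lf/L1_cst.
move=> x; rewrite -real_normK ?num_real//.
have := sqr_ge0 (`|f x| - 2^-1); set y := `|f x|; nra.
Qed.

(** The variance is nonnegative; expand it. *)
Lemma Int_sqr_le f : measurable_fun setT f -> L1 P (fun x => f x ^+ 2) ->
  (\int[P]_x f x) ^+ 2 <= \int[P]_x (f x ^+ 2).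
Proof.
move=> mf lf; have l1 := L1_sqr mf lf; set m := \int[P]_x f x.
have : 0 <= \int[P]_x ((f x - m) ^+ 2) by apply: Int_ge0 => x; exact: sqr_ge0.
have -> : \int[P]_x ((f x - m) ^+ 2) =
    \int[P]_x (f x ^+ 2 - (2 * m * f x - m ^+ 2)).
  by apply: eq_Int => x; ring.
rewrite IntB//; last exact/L1B/L1_cst/L1Z/l1.
rewrite IntB//; [|exact: L1Z|exact: L1_cst].
by rewrite IntZ// Int_cst -/m; nra.
Qed.

Lemma Int_abs_sqr_le f : measurable_fun setT f -> L1 P (fun x => f x ^+ 2) ->
  (\int[P]_x `|f x|) ^+ 2 <= \int[P]_x (f x ^+ 2).
Proof.
move=> mf lf; rewrite (_ : \int[P]_x (f x ^+ 2) = \int[P]_x (`|f x| ^+ 2)).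
  apply: Int_sqr_le; first exact: measurableT_comp.
  by apply: eq_integrable lf => // x _ /=; rewrite real_normK ?num_real.
by apply: eq_Int => x; rewrite real_normK ?num_real.
Qed.

End finite_measure.

(** The sum counts the levels e, 2e, ..., N e not exceeding u, so e times it is u rounded down to a
    multiple of e. Applied to a bounded measurable function it gives a uniform approximation by a
    combination of indicators. *)
Lemma layer_sum (R : realFieldType) (e u : R) (N : nat) : 0 < e -> 0 <= u ->
  u <= N%:R * e ->
  `|u - e * \sum_(j < N) ((j.+1)%:R * e <= u)%R%:R| <= e.
Proof.
move=> e0 u0 uN.
have full n : n%:R * e <= u -> \sum_(j < n) ((j.+1)%:R * e <= u)%R%:R = n%:R :> R.
  move=> nu; rewrite (eq_bigr (fun=> 1)) ?sumr_const ?card_ord// => i _.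
  by rewrite (le_trans _ nu)// ler_wpM2r ?ler_nat// ltW.
have up n : e * \sum_(j < n) ((j.+1)%:R * e <= u)%R%:R <= u.
  elim: n => [|n ih]; first by rewrite big_ord0 mulr0.
  have [h|h] := boolP (n.+1%:R * e <= u); first by rewrite full// mulrC.
  by rewrite big_ord_recr/= (negbTE h) addr0.
have lo n : u <= n%:R * e -> u - e <= e * \sum_(j < n) ((j.+1)%:R * e <= u)%R%:R.
  elim: n => [|n ih h]; first by rewrite mul0r big_ord0 mulr0 => ?; lra.
  have [h1|/ltW h1] := leP u (n%:R * e).
    apply: le_trans (ih h1) _; rewrite ler_wpM2l ?(ltW e0)// big_ord_recr/= lerDl.
    by rewrite ler0n.
  rewrite big_ord_recr/= full// mulrDr.
  have {}h : u <= n%:R * e + e by move: h; rewrite -natr1 mulrDl mul1r.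
  have : 0 <= e * (n.+1%:R * e <= u)%R%:R :> R by rewrite mulr_ge0// ltW.
  by rewrite [e * n%:R]mulrC; lra.
rewrite ler_norml; apply/andP; split.
  by have := up N => ?; lra.
by have := lo N uN => ?; lra.
Qed.

Section bounded_extension.
Context d (T : measurableType d) (R : realType).
Implicit Types U V : T -> R.

Lemma measurable_bool_set (b : T -> bool) : measurable_fun setT b ->
  measurable [set x | b x].
Proof.
move=> mb; have := mb measurableT [set true] I; rewrite setTI.
by congr measurable; apply/seteqP; split.
Qed.

(* A functional that is linear and sup-norm continuous on bounded measurable
   functions is determined by its values on indicators. *)
Lemma bounded_extension (L : (T -> R) -> R) (C : R) :
  (forall A, measurable A -> L (\1_A) = 0) ->
  (forall (c : R) U V, measurable_fun setT U -> measurable_fun setT V ->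
     (exists M : R, forall x, `|U x| <= M) -> (exists M : R, forall x, `|V x| <= M) ->
     L (fun x => c * U x + V x) = c * L U + L V) ->
  (forall U (e : R), measurable_fun setT U -> (forall x, `|U x| <= e) ->
     `|L U| <= C * e) ->
  forall U (M : R), measurable_fun setT U -> (forall x, `|U x| <= M) -> L U = 0.
Proof.
move=> L1 Llin Lsup U M mU UM.
have M0 : 0 <= M by exact: le_trans (UM point).
have C0 : 0 <= C.
  have := Lsup (cst 1) 1 (measurable_cst _); rewrite mulr1 => h.
  by apply: le_trans (h _) => // x; rewrite normr1.
have L0 : L (fun=> 0) = 0.
  have := Lsup (cst 0) 0 (measurable_cst _); rewrite mulr0 normr_le0 => h.
  by apply/eqP/h => x; rewrite normr0.
have meas (e : R) j : measurable [set x | (j.+1%:R * e <= U x + M)].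
  apply: measurable_bool_set; apply: measurable_fun_ler => //.
  exact: measurable_funD.
apply/eqP; rewrite -normr_le0; apply/ler_addgt0Pr => e e0; rewrite add0r.
(* The mesh: an approximation within [e'] costs at most [C * e'], hence at most e; the [+ 1] covers
   C = 0. *)
pose e' : R := (e : R) / (C + 1).
have e'0 : 0 < e' by rewrite divr_gt0// ltr_wpDl.
have [N hN] : exists N : nat, 2 * M <= N%:R * e'.
  exists (Num.bound (2 * M / e')).
  rewrite -ler_pdivrMr//; apply/ltW/archi_boundP.
  by apply: divr_ge0; [exact: mulr_ge0|exact: ltW].
pose S n x : R := \sum_(j < n) (j.+1%:R * e' <= U x + M)%R%:R.
have indE j : (fun x => (j.+1%:R * e' <= U x + M)%R%:R) =
    \1_[set x | (j.+1%:R * e' <= U x + M)] :> (T -> R).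
  by apply/funext => x; rewrite indicE mem_setE.
have mS n : measurable_fun setT (S n).
  apply: measurable_sum => j; rewrite indE; exact: measurable_indic.
have Sb n x : `|S n x| <= n%:R.
  apply: le_trans (ler_norm_sum _ _ _) _.
  rewrite -[n in leRHS]card_ord -sumr_const ler_sum// => i _.
  by rewrite ger0_norm ?ler0n// lern1 leq_b1.
have LS n : L (S n) = 0.
  elim: n => [|n ih]; first by rewrite -[RHS]L0; congr L; apply/funext => x; rewrite /S big_ord0.
  rewrite (_ : S n.+1 = fun x => 1 * \1_[set x | (n.+1%:R * e' <= U x + M)] x + S n x).
    rewrite Llin//; first by rewrite L1// ih mulr0 addr0.
    - by exists 1 => x; rewrite indicE; case: (_ \in _); rewrite ?normr1 ?normr0.
    - by exists n%:R.
  by apply/funext => x; rewrite /S big_ord_recr/= mul1r -indE addrC.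
(* The layers approximate the nonnegative function [U + M]; the constant M is then taken off as a
   multiple of the indicator of the whole space, so that L still vanishes on [V]. *)
pose V x := e' * S N x + (- M) * \1_setT x.
have mV : measurable_fun setT V.
  by apply: measurable_funD; apply: measurable_funM => //; exact: measurable_indic.
have bE1 : exists M0 : R, forall x, `|- M * (\1_[set: T] x : R)| <= M0.
  by exists M => x; rewrite normrM indicE in_setT normr1 mulr1 normrN ger0_norm.
have LT0 : L (fun x => - M * \1_[set: T] x) = 0.
  transitivity (L (fun x => - M * \1_[set: T] x + (fun=> 0) x)).
    by congr L; apply/funext => x; rewrite addr0.
  rewrite Llin//; first by rewrite L1// L0 mulr0 addr0.
    by exists 1 => x; rewrite indicE; case: (_ \in _); rewrite ?normr1 ?normr0.
  by exists 0 => x; rewrite normr0.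
have LV : L V = 0.
  rewrite /V Llin//; first by rewrite LS LT0 mulr0 addr0.
    by apply: measurable_funM => //; exact: measurable_indic.
  by exists N%:R.
have -> : L U = L (fun x => 1 * (U x - V x) + V x).
  by congr L; apply/funext => x; rewrite mul1r subrK.
rewrite Llin//; last 3 first.
- exact: measurable_funB.
- exists (M + (e' * N%:R + M)) => x; rewrite (le_trans (ler_normB _ _))// lerD//.
  rewrite (le_trans (ler_normD _ _))// lerD//.
    by rewrite normrM gtr0_norm// ler_wpM2l// ltW.
  by rewrite normrM indicE in_setT normr1 mulr1 normrN ger0_norm.
- exists (e' * N%:R + M) => x.
  rewrite (le_trans (ler_normD _ _))// lerD//.
    by rewrite normrM gtr0_norm// ler_wpM2l// ltW.
  by rewrite normrM indicE in_setT normr1 mulr1 normrN ger0_norm.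
rewrite LV mul1r addr0.
have h : `|L (fun x => U x - V x)| <= C * e'.
  apply: Lsup; first exact: measurable_funB.
  move=> x; rewrite /V indicE in_setT mulr1 opprD opprK addrA addrAC.
  apply: layer_sum => //.
    by move: (UM x); rewrite ler_norml => /andP[? _]; lra.
  by move: (UM x); rewrite ler_norml => /andP[_ ?]; lra.
apply: le_trans h _; rewrite /e' mulrA ler_pdivrMr ?ltr_wpDl//.
by rewrite mulrDr mulr1 mulrC lerDl ltW.
Qed.

End bounded_extension.

(** * Derivatives and the heat kernel *)

Section derivation_rules.
Context {R : realType}.
Implicit Types (f g : R -> R) (a b c s x z M : R) (n k : nat).

Lemma is_derive_add f g x a b : is_derive x 1 f a -> is_derive x 1 g b ->
  is_derive x 1 (fun y => f y + g y) (a + b).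
Proof. by move=> df dg; exact: (is_deriveD df dg). Qed.

Lemma is_derive_sub f g x a b : is_derive x 1 f a -> is_derive x 1 g b ->
  is_derive x 1 (fun y => f y - g y) (a - b).
Proof. by move=> df dg; exact: (is_deriveB df dg). Qed.

Lemma is_derive_opp f x a : is_derive x 1 f a ->
  is_derive x 1 (fun y => - f y) (- a).
Proof. by move=> df; exact: (is_deriveN df). Qed.

Lemma is_derive_mul f g x a b : is_derive x 1 f a -> is_derive x 1 g b ->
  is_derive x 1 (fun y => f y * g y) (f x * b + g x * a).
Proof. by move=> df dg; exact: (is_deriveM df dg). Qed.

Lemma is_derive_scale c f x a : is_derive x 1 f a ->
  is_derive x 1 (fun y => c * f y) (c * a).
Proof. by move=> df; exact: (is_deriveZ c df). Qed.

Lemma is_derive_exp f x a : is_derive x 1 f a ->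
  is_derive x 1 (fun y => expR (f y)) (a * expR (f x)).
Proof.
move=> df; have := is_derive1_comp (is_derive_expR (f x)) df.
by rewrite mulrC.
Qed.

Lemma is_derive_pow n x : is_derive x 1 (fun y : R => y ^+ n.+1) (n.+1%:R * x ^+ n).
Proof.
have := @is_deriveX R R id n.+1 x 1 1 (is_derive_id x 1).
rewrite (_ : id ^+ n.+1 = fun y : R => y ^+ n.+1); last first.
  by apply/funext => y; rewrite exprfctE.
by move=> h; apply: is_derive_eq h _; rewrite /= /GRing.scale/= mulr1.
Qed.

Lemma is_derive_inv x : x != 0 -> is_derive x 1 (fun y : R => y^-1) (- x ^- 2).
Proof.
move=> x0; have := @is_deriveV R id x 1 1 x0 (is_derive_id x 1).
by move=> h; apply: is_derive_eq h _; rewrite /GRing.scale/= mulr1.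
Qed.

(** Differentiability is asked only in the open interval: on the half-line this allows a = 0, where
    only a one-sided derivative exists. *)
Lemma mvt_bound_within f (f' : R -> R) a b M : a <= b ->
  (forall s, a < s < b -> is_derive s 1 f (f' s)) ->
  {within `[a, b], continuous f} ->
  (forall s, a < s < b -> `|f' s| <= M) -> `|f b - f a| <= M * (b - a).
Proof.
rewrite le_eqVlt => /predU1P[->|ab] df cf bf; first by rewrite !subrr normr0 mulr0.
have df' s : s \in `]a, b[ -> is_derive s 1 f (f' s) by rewrite in_itv/= => /df.
have [c cab ->] := MVT ab df' cf.
have ba : 0 <= b - a by rewrite subr_ge0 ltW.
by rewrite normrM (ger0_norm ba) ler_wpM2r// bf//; move: cab; rewrite in_itv.
Qed.

Lemma mvt_bound f (f' : R -> R) a b M : a <= b ->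
  (forall s, a <= s <= b -> is_derive s 1 f (f' s)) ->
  (forall s, a <= s <= b -> `|f' s| <= M) -> `|f b - f a| <= M * (b - a).
Proof.
move=> ab df bf; apply: (@mvt_bound_within f f') => //.
- by move=> s /andP[/ltW ? /ltW ?]; apply: df; apply/andP.
- apply: derivable_within_continuous => s; rewrite in_itv/= => /df h.
  exact: (@ex_derive _ _ _ _ _ _ _ h).
- by move=> s /andP[/ltW ? /ltW ?]; apply: bf; apply/andP.
Qed.

(** Mean value inequality between 0 and z, where |s|^k <= |z|^k. The factor 1/(k + 1) is given up so
    that the bound can be iterated with one constant M. *)
Lemma crude_taylor f (f' : R -> R) M k z :
  (forall s, is_derive s 1 f (f' s)) -> (forall s, `|f' s| <= M * `|s| ^+ k) ->
  `|f z - f 0| <= M * `|z| ^+ k.+1.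
Proof.
move=> df bf.
have M0 : 0 <= M by have := bf 1; rewrite normr1 expr1n mulr1; exact: le_trans.
have [z0|/ltW z0] := leP 0 z.
  rewrite exprSr mulrA -{2}(subr0 z) (ger0_norm z0).
  rewrite [`|z - 0|]ger0_norm ?subr0//.
  have := @mvt_bound f f' 0 z (M * z ^+ k) z0 (fun s _ => df s).
  rewrite subr0; apply => s /andP[s0 sz].
  by rewrite (le_trans (bf s))// ler_wpM2l// lerXn2r ?nnegrE// ger0_norm.
rewrite exprSr mulrA distrC [X in _ * _ * X]ler0_norm// -[X in _ * _ * X]add0r.
apply: (@mvt_bound f f' z 0 (M * `|z| ^+ k)) => // s /andP[sz s0].
by rewrite (le_trans (bf s))// ler_wpM2l// lerXn2r ?nnegrE// !ler0_norm// lerN2.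
Qed.

(** The remainder is quadratic because [f2] is bounded and cubic because [f3] is. Keeping the
    smaller of the two is what makes moments of order slightly above 2 sufficient. *)
Lemma crude_taylor3 (f f1 f2 f3 : R -> R) M x z :
  (forall s, is_derive s 1 f (f1 s)) -> (forall s, is_derive s 1 f1 (f2 s)) ->
  (forall s, is_derive s 1 f2 (f3 s)) -> (forall s, `|f2 s| <= M) ->
  (forall s, `|f3 s| <= M) ->
  `|f (x + z) - f x - f1 x * z - 2^-1 * f2 x * z ^+ 2| <=
  2 * M * Num.min (z ^+ 2) (`|z| ^+ 3).
Proof.
move=> d1 d2 d3 b2 b3.
have sh g (dg : R -> R) : (forall s, is_derive s 1 g (dg s)) ->
    forall s, is_derive s 1 (fun s => g (x + s)) (dg (x + s)).
  move=> h s; have hx : is_derive s 1 (fun s : R => x + s) 1.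
    by have := is_derive_add (is_derive_cst x s 1) (is_derive_id s 1); rewrite add0r.
  by have := is_derive1_comp (h (x + s)) hx; rewrite mulr1.
have M0 : 0 <= M by exact: le_trans (b2 0).
(* [F z - F 0] is the remainder, [F] has derivative [G s - G 0], and [G] has derivative
   [f2 (x + s) - f2 x]: two uses of [crude_taylor] leave only the oscillation of [f2]. *)
pose G s := f1 (x + s) - f2 x * s.
pose F s := f (x + s) - f1 x * s - 2^-1 * f2 x * s ^+ 2.
have dG s : is_derive s 1 G (f2 (x + s) - f2 x).
  apply: (is_derive_sub (sh _ _ d2 s)).
  by have := is_derive_scale (f2 x) (is_derive_id s 1); rewrite mulr1.
have dF s : is_derive s 1 F (G s - G 0).
  have h1 : is_derive s 1 (fun s => f1 x * s) (f1 x).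
    by have := is_derive_scale (f1 x) (is_derive_id s 1); rewrite mulr1.
  have h2 : is_derive s 1 (fun s => 2^-1 * f2 x * s ^+ 2) (f2 x * s).
    apply: is_derive_eq (is_derive_scale _ (is_derive_pow 1 s)) _.
    by rewrite expr1; field.
  apply: is_derive_eq (is_derive_sub (is_derive_sub (sh _ _ d1 s) h1) h2) _.
  by rewrite /G addr0; ring.
have -> : f (x + z) - f x - f1 x * z - 2^-1 * f2 x * z ^+ 2 = F z - F 0.
  by rewrite /F addr0; ring.
have bnd k N : 0 <= N -> (forall s, `|f2 (x + s) - f2 x| <= N * `|s| ^+ k) ->
    `|F z - F 0| <= N * `|z| ^+ k.+2.
  move=> N0 h; apply: crude_taylor dF _ => s.
  exact: (crude_taylor s dG h).
have M20 : 0 <= 2 * M by rewrite mulr_ge0.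
rewrite minr_pMr// le_min; apply/andP; split.
  rewrite -(real_normK (num_real z)); apply: bnd => // s.
  by rewrite expr0 mulr1 (le_trans (ler_normB _ _))// (mulr_natl M 2) mulr2n lerD.
apply: (bnd 1) => // s; rewrite expr1.
have -> : f2 x = f2 (x + 0) by rewrite addr0.
apply: le_trans (_ : M * `|s| <= _); last by rewrite ler_wpM2r//; lra.
have := @crude_taylor (fun s => f2 (x + s)) _ M 0 s (sh _ _ d3).
by rewrite expr1; apply => s'; rewrite expr0 mulr1.
Qed.

End derivation_rules.

Section heat.
Context {R : realType}.
Implicit Types t x s z e b C : R.

(** The density of N(0, t) times sqrt(2 pi). With t^(-1/2) written as an exponential, the
    derivatives in t come from the same rule as those in x. *)
Definition heat t x : R := expR (- (2^-1 * x ^+ 2 * t^-1) - 2^-1 * ln t).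
Definition heat_x t x : R := - (x / t) * heat t x.
Definition heat_xx t x : R := (x ^+ 2 / t ^+ 2 - t^-1) * heat t x.
Definition heat_xxx t x : R := (3 * x / t ^+ 2 - x ^+ 3 / t ^+ 3) * heat t x.
Definition heat_xxxx t x : R :=
  (x ^+ 4 / t ^+ 4 - 6 * x ^+ 2 / t ^+ 3 + 3 / t ^+ 2) * heat t x.

Let d_sq x : is_derive x 1 (fun x : R => x ^+ 2) (2 * x).
Proof. by apply: is_derive_eq (is_derive_pow 1 x) _; rewrite expr1. Qed.

Lemma is_derive_heat t x : 0 < t -> is_derive x 1 (heat t) (heat_x t x).
Proof.
move=> t0; have h : is_derive x 1
   (fun x => - (2^-1 * x ^+ 2 * t^-1) - 2^-1 * ln t) (- (2^-1 * (2 * x) * t^-1)).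
  have h1 := is_derive_scale 2^-1 (d_sq x).
  have h2 := is_derive_mul h1 (is_derive_cst t^-1 x 1).
  apply: is_derive_eq (is_derive_sub (is_derive_opp h2) (is_derive_cst _ x 1)) _.
  by rewrite mulr0 add0r subr0 mulrC.
apply: is_derive_eq (is_derive_exp h) _; rewrite /heat_x /heat.
by congr (_ * _); field; rewrite gt_eqF.
Qed.

Lemma is_derive_poly_heat (c c' : R -> R) t x : 0 < t ->
  is_derive x 1 c (c' x) ->
  is_derive x 1 (fun x => c x * heat t x) ((c' x - c x * x / t) * heat t x).
Proof.
move=> t0 dc; apply: is_derive_eq (is_derive_mul dc (is_derive_heat x t0)) _.
by rewrite /heat_x; field; rewrite gt_eqF.
Qed.

Lemma is_derive_heat_x t x : 0 < t -> is_derive x 1 (heat_x t) (heat_xx t x).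
Proof.
move=> t0; have h : is_derive x 1 (fun x : R => - (x / t)) (- t^-1).
  apply: is_derive_eq (is_derive_opp (is_derive_mul (is_derive_id x 1) (is_derive_cst t^-1 x 1))) _.
  by rewrite mulr0 add0r mulr1.
apply: is_derive_eq (is_derive_poly_heat (c' := fun=> - t^-1) t0 h) _.
by rewrite /heat_xx; congr (_ * _); field; rewrite gt_eqF.
Qed.

Lemma is_derive_heat_xx t x : 0 < t -> is_derive x 1 (heat_xx t) (heat_xxx t x).
Proof.
move=> t0; have h : is_derive x 1 (fun x : R => x ^+ 2 / t ^+ 2 - t^-1) (2 * x / t ^+ 2).
  apply: is_derive_eq (is_derive_sub (is_derive_mul (d_sq x) (is_derive_cst (t ^- 2) x 1)) (is_derive_cst t^-1 x 1)) _.
  by rewrite mulr0 add0r subr0 mulrC.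
apply: is_derive_eq (is_derive_poly_heat (c' := fun x => 2 * x / t ^+ 2) t0 h) _.
by rewrite /heat_xxx; congr (_ * _); field; rewrite gt_eqF.
Qed.

Lemma is_derive_heat_t t x : 0 < t ->
  is_derive t 1 (heat^~ x) (2^-1 * heat_xx t x).
Proof.
move=> t0; have tn0 : t != 0 by rewrite gt_eqF.
have h : is_derive t 1 (fun t => - (2^-1 * x ^+ 2 * t^-1) - 2^-1 * ln t)
    (2^-1 * x ^+ 2 * t ^- 2 - 2^-1 * t^-1).
  have h1 := is_derive_opp (is_derive_scale (2^-1 * x ^+ 2) (is_derive_inv tn0)).
  apply: is_derive_eq (is_derive_sub h1 (is_derive_scale 2^-1 (is_derive1_ln t0))) _.
  by rewrite mulrN opprK.
apply: is_derive_eq (is_derive_exp h) _; rewrite /heat_xx /heat.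
by set E := expR _; field.
Qed.

Lemma is_derive_heat_xx_t t x : 0 < t ->
  is_derive t 1 (heat_xx^~ x) (2^-1 * heat_xxxx t x).
Proof.
move=> t0; have tn0 : t != 0 by rewrite gt_eqF.
have h : is_derive t 1 (fun t => x ^+ 2 * (t^-1 * t^-1) - t^-1)
    (- 2 * x ^+ 2 / t ^+ 3 + t ^- 2).
  have di := is_derive_inv tn0.
  apply: is_derive_eq (is_derive_sub (is_derive_scale (x ^+ 2) (is_derive_mul di di)) di) _.
  by field.
have -> : heat_xx^~ x = fun t => (x ^+ 2 * (t^-1 * t^-1) - t^-1) * heat t x.
  by apply/funext => s; rewrite /heat_xx -invfM -expr2.
apply: is_derive_eq (is_derive_mul h (is_derive_heat_t x t0)) _.
by rewrite /heat_xxxx /heat_xx; field.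
Qed.

Lemma heat_ge0 t x : 0 <= heat t x. Proof. exact: expR_ge0. Qed.

(** [heat t x] is e^(-z/2) times [heat t 0], which decreases in t. The constants 2 and 16 come from
    u e^(-u) <= 1 at u = z/2, and from its square at u = z/4. *)
Lemma heat_moments b t x : 0 < b -> b <= t -> let z := x ^+ 2 / t in
  [/\ heat t x <= heat b 0, z * heat t x <= 2 * heat b 0 &
      z ^+ 2 * heat t x <= 16 * heat b 0].
Proof.
move=> b0 bt z; have t0 : 0 < t by exact: lt_le_trans bt.
have z0 : 0 <= z by rewrite divr_ge0 ?sqr_ge0 ?ltW.
have eH : heat t x = expR (- (z / 2)) * heat t 0.
  rewrite /heat -expRD; congr expR; rewrite /z expr0n/= mulr0 mul0r oppr0 add0r.
  by field; rewrite gt_eqF.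
have tb : heat t 0 <= heat b 0.
  rewrite /heat ler_expR expr0n/= !mulr0 !mul0r oppr0 !add0r lerN2.
  by rewrite ler_wpM2l// ler_ln ?posrE.
have key (u : R) : 0 <= u -> u * expR (- u) <= 1.
  move=> u0; rewrite expRN ler_pdivrMr ?expR_gt0// mul1r.
  by apply: le_trans (expR_ge1Dx u); lra.
have fin (c : R) : 0 <= c -> c * expR (- (z / 2)) * heat t 0 <= c * expR (- (z / 2)) * heat b 0.
  by move=> c0; rewrite ler_wpM2l// mulr_ge0// expR_ge0.
rewrite eH; split.
- apply: le_trans tb; rewrite ler_piMl ?heat_ge0//.
  by rewrite -[leRHS]expR0 ler_expR oppr_le0 divr_ge0.
- rewrite mulrA; apply: le_trans (fin _ z0) _; rewrite ler_wpM2r ?heat_ge0//.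
  by have := key _ (divr_ge0 z0 (ler0n R 2)) => /= ?; lra.
- rewrite mulrA; apply: le_trans (fin _ (sqr_ge0 z)) _; rewrite ler_wpM2r ?heat_ge0//.
  have h4 := key _ (divr_ge0 z0 (ler0n R 4)).
  have -> : expR (- (z / 2)) = expR (- (z / 4)) ^+ 2.
    by rewrite expr2 -expRD; congr expR; field.
  have : 0 <= z / 4 * expR (- (z / 4)) by rewrite mulr_ge0 ?expR_ge0// divr_ge0.
  rewrite -exprMn; move: h4.
  have -> : z * expR (- (z / 4)) = 4 * (z / 4 * expR (- (z / 4))) by field.
  by set y := z / 4 * _; nra.
Qed.

(** Each derivative is [heat] times a polynomial in 1/t and z = x^2/t, up to a factor |x|/t, which
    is at most 1/t + z since |x| <= 1 + x^2. So [heat_moments] bounds everything once t >= b. *)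
Lemma heat_bounds b : 0 < b -> exists C, 0 < C /\ forall t x, b <= t ->
  [/\ `|heat t x| <= C, `|heat_x t x| <= C, `|heat_xx t x| <= C,
      `|heat_xxx t x| <= C & `|heat_xxxx t x| <= C].
Proof.
move=> b0; set H := heat b 0.
have H0 : 0 < H by exact: expR_gt0.
pose a := b^-1; have a0 : 0 < a by rewrite invr_gt0.
(* One summand for each of the five functions, obtained by expanding the polynomials below with z,
   z^2 replaced by 2, 16 and 1/t by a. *)
exists (H * (1 + (a + 2) + 3 * a + (5 * a ^+ 2 + 22 * a) + 31 * a ^+ 2)); split.
  by rewrite mulr_gt0//; nra.
move=> t x bt; have t0 : 0 < t by exact: lt_le_trans bt.
have [] := heat_moments x b0 bt; set z := x ^+ 2 / t; set u := heat t x; rewrite -/H.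
move=> h0 h1 h2.
have u0 : 0 <= u by exact: heat_ge0.
have z0 : 0 <= z by rewrite divr_ge0 ?sqr_ge0 ?ltW.
pose i := t^-1; have i0 : 0 < i by rewrite invr_gt0.
have ia : i <= a by rewrite lef_pV2.
have xi : `|x| * i <= i + z.
  have : `|x| <= 1 + x ^+ 2.
    by rewrite -real_normK ?num_real//; have := sqr_ge0 (`|x| - 1); nra.
  by rewrite -(ler_pM2r i0) => /le_trans; apply; rewrite mulrDl mul1r.
have aH : 0 < a * H by rewrite mulr_gt0.
have aaH : 0 < a ^+ 2 * H by rewrite mulr_gt0// exprn_gt0.
have iu : i * u <= a * H by apply: ler_pM => //; exact: ltW.
have ii : i ^+ 2 <= a ^+ 2 by rewrite lerXn2r// nnegrE ltW.
have e1 : `|heat t x| = u by rewrite ger0_norm ?heat_ge0.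
have e2 : `|heat_x t x| = `|x| * i * u.
  by rewrite /heat_x normrM normrN normrM e1 (ger0_norm (ltW i0)).
have e3 : `|heat_xx t x| <= i * (z * u) + i * u.
  rewrite /heat_xx normrM e1.
  have -> : x ^+ 2 / t ^+ 2 - t^-1 = i * z - i by rewrite /i /z; field; rewrite gt_eqF.
  rewrite (mulrA i z u) -mulrDl ler_wpM2r// (le_trans (ler_normB _ _))//.
  by rewrite normrM !ger0_norm// ?ltW.
have e4 : `|heat_xxx t x| <= (i + z) * i * (3 + z) * u.
  rewrite /heat_xxx normrM e1.
  have -> : 3 * x / t ^+ 2 - x ^+ 3 / t ^+ 3 = x * i * i * (3 - z).
    by rewrite /i /z; field; rewrite gt_eqF.
  rewrite ler_wpM2r// !normrM (ger0_norm (ltW i0)).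
  apply: ler_pM => //; first by rewrite !mulr_ge0// ltW.
    by rewrite ler_wpM2r// ltW.
  by rewrite (le_trans (ler_normB _ _))// !ger0_norm.
have e5 : `|heat_xxxx t x| <= i ^+ 2 * (z ^+ 2 + 6 * z + 3) * u.
  rewrite /heat_xxxx normrM e1.
  have -> : x ^+ 4 / t ^+ 4 - 6 * x ^+ 2 / t ^+ 3 + 3 / t ^+ 2 =
     i ^+ 2 * (z ^+ 2 - 6 * z + 3) by rewrite /i /z; field; rewrite gt_eqF.
  rewrite ler_wpM2r// normrM (ger0_norm (sqr_ge0 i)) ler_wpM2l ?sqr_ge0//.
  rewrite (le_trans (ler_normD _ _))// lerD ?(le_trans (ler_normB _ _))//.
    have -> : `|z ^+ 2| = z ^+ 2 by exact/ger0_norm/sqr_ge0.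
    by have -> : `|6 * z| = 6 * z by exact/ger0_norm/mulr_ge0.
  by rewrite ger0_norm.
have zu0 : 0 <= z * u by rewrite mulr_ge0.
have zzu0 : 0 <= z ^+ 2 * u by rewrite mulr_ge0 ?sqr_ge0.
have i1 : i * (z * u) <= a * (2 * H) by apply: ler_pM => //; exact: ltW.
have i2 : i * (z ^+ 2 * u) <= a * (16 * H) by apply: ler_pM => //; exact: ltW.
have ii0 : i ^+ 2 * u <= a ^+ 2 * H by apply: ler_pM => //; exact: sqr_ge0.
have ii1 : i ^+ 2 * (z * u) <= a ^+ 2 * (2 * H) by apply: ler_pM => //; exact: sqr_ge0.
have ii2 : i ^+ 2 * (z ^+ 2 * u) <= a ^+ 2 * (16 * H) by apply: ler_pM => //; exact: sqr_ge0.
rewrite e1 e2; split.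
- by rewrite mulrC; lra.
- by apply: le_trans (_ : (i + z) * u <= _); [rewrite ler_wpM2r|lra].
- by apply: le_trans e3 _; lra.
- by apply: le_trans e4 _; lra.
- by apply: le_trans e5 _; lra.
Qed.

(* The heat equation [heat_t = heat_xx / 2] is what cancels the second order
   terms in time and space. *)
Lemma heat_step b : 0 < b -> exists C, [/\ 0 < C,
  forall t x, b <= t ->
    [/\ `|heat t x| <= C, `|heat_x t x| <= C & `|heat_xx t x| <= C],
  forall t t' x, b <= t -> b <= t' -> `|heat t x - heat t' x| <= C * `|t - t'| &
  forall t x z e, b <= t -> 0 <= e ->
    `|heat t (x + z) - heat (t + e) x -
       (heat_x t x * z + 2^-1 * heat_xx t x * (z ^+ 2 - e))| <=
    C * (Num.min (z ^+ 2) (`|z| ^+ 3) + e ^+ 2)].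
Proof.
move=> b0; have [C [C0 hC]] := heat_bounds b0.
have pos t : b <= t -> 0 < t by exact: lt_le_trans.
(* The factor 2 is the one in [crude_taylor3]. *)
exists (2 * C); split.
- by lra.
- by move=> t x /(hC _ x)[]; split; lra.
- suff h t t' x : b <= t -> t <= t' -> `|heat t' x - heat t x| <= C * (t' - t).
    move=> t t' x bt bt'; have [tt|/ltW tt] := leP t t'.
      rewrite distrC [`|t - t'|]distrC [`|t' - t|]ger0_norm ?subr_ge0//.
      by have := h t t' x bt tt; have : 0 <= C * (t' - t) by [rewrite mulr_ge0 ?subr_ge0// ltW]; lra.
    rewrite [`|t - t'|]ger0_norm ?subr_ge0//.
    by have := h t' t x bt' tt; have : 0 <= C * (t - t') by [rewrite mulr_ge0 ?subr_ge0// ltW]; lra.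
  move=> bt tt; have := @mvt_bound _ (heat^~ x) (fun s => 2^-1 * heat_xx s x) t t' C tt.
  apply.
    by move=> s /andP[ts _]; apply/is_derive_heat_t/pos/(le_trans bt).
  move=> s /andP[ts _]; have [_ _ + _ _] := hC s x (le_trans bt ts).
  by rewrite (normrM 2^-1) (@ger0_norm _ 2^-1)// => ?; lra.
- move=> t x z e bt e0.
  have t0 := pos _ bt.
  have space := @crude_taylor3 R (heat t) (heat_x t) (heat_xx t) (heat_xxx t) C x z
    (fun s => is_derive_heat s t0) (fun s => is_derive_heat_x s t0)
    (fun s => is_derive_heat_xx s t0)
    (fun s => let: And5 _ _ h _ _ := hC t s bt in h)
    (fun s => let: And5 _ _ _ h _ := hC t s bt in h).
  (* First-order remainder in time. By the heat equation its derivative is half of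
     [heat_xx s x - heat_xx t x], hence at most C e on [t, t + e]. *)
  pose F s := heat s x - 2^-1 * heat_xx t x * s.
  have time : `|F (t + e) - F t| <= C * e * (t + e - t).
    have te : t <= t + e by lra.
    have := @mvt_bound _ F (fun s => 2^-1 * heat_xx s x - 2^-1 * heat_xx t x) t (t + e) (C * e) te.
    apply.
      move=> s /andP[ts _]; apply: is_derive_sub; first exact/is_derive_heat_t/pos/(le_trans bt).
      by have := is_derive_scale (2^-1 * heat_xx t x) (is_derive_id s 1); rewrite mulr1.
    move=> s /andP[ts se].
    rewrite -mulrBr (normrM 2^-1) (@ger0_norm _ 2^-1)//.
    have : `|heat_xx s x - heat_xx t x| <= C * (s - t).
      have := @mvt_bound _ (heat_xx^~ x) (fun s => 2^-1 * heat_xxxx s x) t s C ts.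
      apply.
        by move=> s' /andP[ts' _]; apply/is_derive_heat_xx_t/pos/(le_trans bt).
      move=> s' /andP[ts' _]; have [_ _ _ _ +] := hC s' x (le_trans bt ts').
      by rewrite (normrM 2^-1) (@ger0_norm _ 2^-1)// => ?; lra.
    have : C * (s - t) <= C * e by apply: ler_wpM2l; [exact: ltW|lra].
    by have := normr_ge0 (heat_xx s x - heat_xx t x); lra.
  rewrite (_ : t + e - t = e) in time; last by ring.
  set A := heat t (x + z) - _ - _ - _ in space.
  have -> : heat t (x + z) - heat (t + e) x -
       (heat_x t x * z + 2^-1 * heat_xx t x * (z ^+ 2 - e)) = A - (F (t + e) - F t).
    by rewrite /A /F; field.
  apply: le_trans (ler_normB _ _) _.
  have : 0 <= C * e ^+ 2 by rewrite mulr_ge0 ?sqr_ge0// ltW.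
  by rewrite mulrDr; lra.
Qed.

End heat.

(** * Heat flow along a martingale *)

Section measurable_inverse.
Context d (T : measurableType d) (R : realType).
Implicit Types f g : T -> R.

(** Inversion is pieced together from [expR] and [ln] according to the sign; the convention 0^-1 = 0
    gives the third case. *)
Lemma measurable_funV f : measurable_fun setT f ->
  measurable_fun setT (fun x => (f x)^-1).
Proof.
move=> mf; rewrite (_ : (fun x => (f x)^-1) = fun x => if 0 < f x then
  expR (- ln (f x)) else if f x < 0 then - expR (- ln (- f x)) else 0).
  have m0 : measurable_fun setT (fun=> 0 : R) by [].
  apply: measurable_fun_ifT; first exact: measurable_fun_ltr.
    apply: measurableT_comp; first exact: measurable_expR.
    by apply: measurableT_comp => //; apply: measurableT_comp => //; exact: measurable_ln.
  apply: measurable_fun_ifT; [exact: measurable_fun_ltr| |by []].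
  apply: measurableT_comp => //.
  apply: measurableT_comp; first exact: measurable_expR.
  apply: measurableT_comp => //; apply: measurableT_comp; first exact: measurable_ln.
  exact: measurableT_comp.
apply/funext => x; case: ltgtP => h.
- by rewrite expRN lnK.
- by rewrite expRN lnK ?posrE ?oppr_gt0// invrN opprK.
- by rewrite -h invr0.
Qed.

Lemma measurable_fun_div f g : measurable_fun setT f -> measurable_fun setT g ->
  measurable_fun setT (fun x => f x / g x).
Proof. by move=> mf mg; apply: measurable_funM => //; exact: measurable_funV. Qed.

Lemma measurable_bool_nat (c : T -> bool) : measurable_fun setT c ->
  measurable_fun setT (fun x => (c x)%:R : R).
Proof.
move=> mc; rewrite (_ : (fun x => _) = fun x => if c x then 1 else 0).
  exact: measurable_fun_ifT.
by apply/funext => x; case: (c x).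
Qed.

Lemma measurable_min1 f : measurable_fun setT f ->
  measurable_fun setT (fun x => Num.min 1 `|f x|).
Proof. by move=> mf; apply: measurable_minr => //; exact: measurableT_comp. Qed.

Lemma measurable_heat f g : measurable_fun setT f -> measurable_fun setT g ->
  measurable_fun setT (fun x => heat (f x) (g x)).
Proof.
move=> mf mg; apply: measurableT_comp; first exact: measurable_expR.
apply: measurable_funB.
  apply: measurableT_comp => //; apply: measurable_fun_div => //.
  by apply: measurable_funM => //; exact: measurable_funX.
by apply: measurable_funM => //; apply: measurableT_comp => //; exact: measurable_ln.
Qed.

Lemma measurable_heat_x f g : measurable_fun setT f -> measurable_fun setT g ->
  measurable_fun setT (fun x => heat_x (f x) (g x)).
Proof.
move=> mf mg; apply: measurable_funM; last exact: measurable_heat.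
by apply: measurableT_comp => //; exact: measurable_fun_div.
Qed.

Lemma measurable_heat_xx f g : measurable_fun setT f -> measurable_fun setT g ->
  measurable_fun setT (fun x => heat_xx (f x) (g x)).
Proof.
move=> mf mg; apply: measurable_funM; last exact: measurable_heat.
apply: measurable_funB; last exact: measurable_funV.
by apply: measurable_fun_div; exact: measurable_funX.
Qed.

End measurable_inverse.

Section sub_sigma_algebra.
Context d (T : measurableType d) (R : realType).
Implicit Types (G H : set (set T)) (U : T -> R).

(** The cast replaces the sigma-algebra of the domain by the one generated by G and keeps the
    function itself. *)
Definition gmeas G U : Prop :=
  measurable_fun setT (U : g_sigma_algebraType G -> R).

Lemma gmeas_mono G H U : <<s G>> `<=` <<s H>> -> gmeas G U -> gmeas H U.
Proof. by move=> GH mU _ B mB; apply: GH; exact: mU. Qed.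

Lemma gmeas_measurable G U : <<s G>> `<=` measurable -> gmeas G U ->
  measurable_fun setT U.
Proof. by move=> GH mU _ B mB; apply: GH; exact: mU. Qed.

End sub_sigma_algebra.

Lemma ler_distD_le (R : numDomainType) (y x z e1 e2 : R) :
  `|x - y| <= e1 -> `|y - z| <= e2 -> `|x - z| <= e1 + e2.
Proof. by move=> h1 h2; rewrite (le_trans (ler_distD y _ _))// lerD. Qed.

Definition heat_const {R : realType} (b C : R) : Prop := [/\ 0 < C,
  forall t x, b <= t ->
    [/\ `|heat t x| <= C, `|heat_x t x| <= C & `|heat_xx t x| <= C],
  forall t t' x, b <= t -> b <= t' -> `|heat t x - heat t' x| <= C * `|t - t'| &
  forall t x z e, b <= t -> 0 <= e ->
    `|heat t (x + z) - heat (t + e) x -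
       (heat_x t x * z + 2^-1 * heat_xx t x * (z ^+ 2 - e))| <=
    C * (Num.min (z ^+ 2) (`|z| ^+ 3) + e ^+ 2)].

Section martingale_heat.
Context d (T : measurableType d) (R : realType) (P : probability T R).
Variables (G : nat -> set (set T)) (xi W : nat -> T -> R) (b s2 eta a C : R).
Hypothesis subG : forall k, <<s G k>> `<=` measurable.
Hypothesis monoG : forall j k, (j <= k)%N -> <<s G j>> `<=` <<s G k>>.
Hypothesis xi_adapted : forall j k, (j < k)%N -> gmeas (G k) (xi j).
Hypothesis W_predictable : forall k, gmeas (G k) (W k).
Hypothesis W_bnd : forall k w, 0 <= W k w <= eta.
Hypothesis xi2 : forall k, L1 P (fun w => xi k w ^+ 2).
Hypothesis xi_mart : forall k U M, gmeas (G k) U -> (forall w, `|U w| <= M) ->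
  \int[P]_w (U w * xi k w) = 0.
Hypothesis xi_var : forall k U M, gmeas (G k) U -> (forall w, `|U w| <= M) ->
  \int[P]_w (U w * xi k w ^+ 2) = \int[P]_w (U w * W k w).
Hypothesis b0 : 0 < b.
Hypothesis s20 : 0 <= s2.
Hypothesis hC : heat_const (b / 2) C.

Let V k w := \sum_(j < k) W j w.
Let S k w := \sum_(j < k) xi j w.
(* Increments are switched off once the accumulated variance exceeds s2 + b/2,
   so that the remaining time b + s2 - VV k of the heat flow stays above b/2. *)
Let chi k w : R := (V k.+1 w <= s2 + b / 2)%R%:R.
Let VV k w := \sum_(j < k) (chi j w * W j w).
Let SS k w := \sum_(j < k) (chi j w * xi j w).

Let W0 k w : 0 <= W k w. Proof. by case/andP: (W_bnd k w). Qed.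

Let VS k w : V k.+1 w = V k w + W k w. Proof. exact: big_ord_recr. Qed.

Let VVS k w : VV k.+1 w = VV k w + chi k w * W k w. Proof. exact: big_ord_recr. Qed.

Let SSS k w : SS k.+1 w = SS k w + chi k w * xi k w. Proof. exact: big_ord_recr. Qed.

Let chi01 k w : 0 <= chi k w <= 1.
Proof. by rewrite /chi ler0n lern1 leq_b1. Qed.

Let chi2 k w : chi k w * chi k w = chi k w.
Proof. by rewrite /chi; case: (_ <= _); rewrite ?mulr1 ?mulr0. Qed.

Let chiW k w : 0 <= chi k w * W k w <= W k w.
Proof.
have /andP[c0 c1] := chi01 k w.
by rewrite mulr_ge0//= ler_piMl.
Qed.

Let VV_V k w : VV k w <= V k w.
Proof. by apply: ler_sum => j _; case/andP: (chiW j w). Qed.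

Let VV0 k w : 0 <= VV k w.
Proof. by apply: sumr_ge0 => j _; case/andP: (chiW j w). Qed.

(** An increment is counted only while [V] itself is below the threshold, and [VV] never exceeds
    [V]; otherwise [VV] does not move. *)
Let VV_le k w : VV k w <= s2 + b / 2.
Proof.
elim: k => [|k ih]; first by rewrite /VV big_ord0 addr_ge0// divr_ge0// ltW.
have [h|h] := boolP (V k.+1 w <= s2 + b / 2); first exact: le_trans (VV_V _ _) h.
by rewrite VVS /chi (negbTE h) mul0r addr0.
Qed.

Let V_mono j k w : (j <= k)%N -> V j w <= V k w.
Proof.
move=> /subnK <-; elim: (k - j)%N => [|m ih]; first by rewrite add0n.
by rewrite addSn VS (le_trans ih)// lerDl.
Qed.

(** [V] is nondecreasing, so a final value below the threshold means that no increment was switched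
    off. *)
Let unstopped n w : V n w <= s2 + b / 2 -> VV n w = V n w /\ SS n w = S n w.
Proof.
move=> h; have c1 (j : 'I_n) : chi j w = 1.
  by rewrite /chi (le_trans _ h)// V_mono.
by split; apply: eq_bigr => j _; rewrite c1 mul1r.
Qed.

Let mW j k : (j <= k)%N -> gmeas (G k) (W j).
Proof. move=> jk. exact: (gmeas_mono (monoG jk) (@W_predictable j)). Qed.

Let mV j k : (j <= k)%N -> gmeas (G k) (V j.+1).
Proof.
move=> jk; apply: (@measurable_sum _ (g_sigma_algebraType (G k))) => i; apply: mW.
by rewrite (leq_trans _ jk)// -ltnS.
Qed.

(** [V k.+1] involves only predictable variances up to index k, so whether increment k counts is
    known before [xi k]. *)
Let mchi j k : (j <= k)%N -> gmeas (G k) (chi j).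
Proof.
by move=> jk; apply: measurable_bool_nat; apply: measurable_fun_ler => //; exact: mV.
Qed.

Let mVV j k : (j <= k)%N -> gmeas (G k) (VV j.+1).
Proof.
move=> jk; apply: (@measurable_sum _ (g_sigma_algebraType (G k))) => i.
have ik : (i <= k)%N by rewrite (leq_trans _ jk)// -ltnS.
by apply: (@measurable_funM _ (g_sigma_algebraType (G k))); [exact: mchi|exact: mW].
Qed.

Let mSS k : gmeas (G k) (SS k).
Proof.
apply: (@measurable_sum _ (g_sigma_algebraType (G k))) => i.
apply: (@measurable_funM _ (g_sigma_algebraType (G k))); first by apply: mchi; exact: ltnW.
exact: xi_adapted.
Qed.

Let mS k : gmeas (G k) (S k).
Proof.
by apply: (@measurable_sum _ (g_sigma_algebraType (G k))) => i; exact: xi_adapted.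
Qed.

Let mT k (U : T -> R) : gmeas (G k) U -> measurable_fun setT U.
Proof. exact/gmeas_measurable/subG. Qed.

Let mVVT k : measurable_fun setT (VV k).
Proof.
case: k => [|k]; last exact: mT (mVV (leqnn k)).
by rewrite (_ : VV 0 = cst 0)//; apply/funext => w; rewrite /VV big_ord0.
Qed.

Let mVT k : measurable_fun setT (V k).
Proof.
case: k => [|k]; last exact: mT (mV (leqnn k)).
by rewrite (_ : V 0 = cst 0)//; apply/funext => w; rewrite /V big_ord0.
Qed.

Let mxi k : measurable_fun setT (xi k). Proof. exact: mT (xi_adapted (ltnSn k)). Qed.

Let tau k w := b + s2 - VV k w.

Let tau_ge k w : b / 2 <= tau k w.
Proof. by have := VV_le k w; rewrite /tau; lra. Qed.

Let mtau k : measurable_fun setT (tau k).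
Proof. by apply: measurable_funB => //; exact: mVVT. Qed.

(** Would be constant in k if, given [G k], the stopped increment were centred normal with variance
    [chi k * W k]: the heat semigroup would then trade that amount of time for the increment. *)
Let D k := \int[P]_w heat (tau k w) (SS k w - a).

Let L1heat (f g : T -> R) : measurable_fun setT f -> measurable_fun setT g ->
  (forall w, b / 2 <= f w) -> L1 P (fun w => heat (f w) (g w)).
Proof.
move=> mf mg fb; apply: (@L1_bnd _ _ _ _ _ C); first exact: measurable_heat.
by move=> w; case: hC => _ /(_ _ (g w) (fb w))[].
Qed.

Let cubic k w := Num.min (xi k w ^+ 2) (`|xi k w| ^+ 3).

Let mcubic k : measurable_fun setT (cubic k).
Proof.
apply: measurable_minr; first by apply: measurable_funX; exact: mxi.
by apply: measurable_funX; apply: measurableT_comp => //; exact: mxi.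
Qed.

Let cubic0 k w : 0 <= cubic k w.
Proof. by rewrite /cubic le_min sqr_ge0 exprn_ge0. Qed.

Let L1cubic k : L1 P (cubic k).
Proof.
apply: L1_le (mcubic k) _ (xi2 k) => w.
by rewrite ger0_norm ?cubic0// /cubic ge_min lexx.
Qed.

Let L1W k : L1 P (W k).
Proof.
apply: (@L1_bnd _ _ _ _ _ eta); first exact: mT (@W_predictable k).
by move=> w; have /andP[? ?] := W_bnd k w; rewrite ger0_norm.
Qed.

Let L1chiW k : L1 P (fun w => chi k w * W k w).
Proof.
apply: (@L1_bndM _ _ _ _ _ _ 1) (L1W k); first exact: mT (mchi (leqnn k)).
by move=> w; have /andP[? ?] := chi01 k w; rewrite ger0_norm.
Qed.

(** Stopping and remaining time are predictable, so the Taylor coefficients [A] and [B] are bounded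
    and [G k]-measurable: [xi_mart] annihilates the first-order term and [xi_var] the second-order
    one. In the remainder, e^2 with e = [chi k w * W k w] is at most eta e. *)
Lemma heat_increment k : `|D k.+1 - D k| <=
  C * (\int[P]_w cubic k w + eta * \int[P]_w (chi k w * W k w)).
Proof.
have [C0 hb ht hs] := hC.
have eta0 : 0 <= eta by have /andP[/le_trans h /h] := W_bnd 0 point.
pose A w := chi k w * heat_x (tau k.+1 w) (SS k w - a).
pose B w := 2^-1 * chi k w * heat_xx (tau k.+1 w) (SS k w - a).
have mtauG : gmeas (G k) (tau k.+1).
  by apply: (@measurable_funB _ (g_sigma_algebraType (G k))) => //; exact: mVV.
have mSa : gmeas (G k) (fun w => SS k w - a).
  by apply: (@measurable_funB _ (g_sigma_algebraType (G k))) => //; exact: mSS.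
have mA : gmeas (G k) A.
  apply: (@measurable_funM _ (g_sigma_algebraType (G k))); first exact: mchi.
  exact: (@measurable_heat_x _ (g_sigma_algebraType (G k))).
have mB : gmeas (G k) B.
  apply: (@measurable_funM _ (g_sigma_algebraType (G k))).
    by apply: (@measurable_funM _ (g_sigma_algebraType (G k))) => //; exact: mchi.
  exact: (@measurable_heat_xx _ (g_sigma_algebraType (G k))).
have AC w : `|A w| <= C.
  have /andP[? ?] := chi01 k w; have [_ h _] := hb _ (SS k w - a) (tau_ge k.+1 w).
  by rewrite normrM ger0_norm// -[leRHS]mul1r ler_pM.
have BC w : `|B w| <= C.
  have /andP[? ?] := chi01 k w; have [_ _ h] := hb _ (SS k w - a) (tau_ge k.+1 w).
  have c0 : 0 <= 2^-1 * chi k w by lra.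
  have c1 : 2^-1 * chi k w <= 1 by lra.
  by rewrite /B (normrM (2^-1 * chi k w)) (ger0_norm c0) -[leRHS]mul1r ler_pM.
have lA : L1 P (fun w => A w * xi k w).
  by apply: (@L1_bndM _ _ _ _ _ _ C) => //; [exact: mT mA|by apply: L1_sqr => //; exact: mxi].
have lB : L1 P (fun w => B w * xi k w ^+ 2).
  by apply: (@L1_bndM _ _ _ _ _ _ C) => //; exact: mT mB.
have lBW : L1 P (fun w => B w * W k w).
  by apply: (@L1_bndM _ _ _ _ _ _ C) => //; exact: mT mB.
have lBB : L1 P (fun w => B w * xi k w ^+ 2 - B w * W k w) by exact: L1B.
have mSSa j : measurable_fun setT (fun w => SS j w - a).
  have mSSj := mT (mSS (k := j)); exact: measurable_funB.
have lD j : L1 P (fun w => heat (tau j w) (SS j w - a)) by exact: L1heat.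
have lDD : L1 P (fun w => heat (tau k.+1 w) (SS k.+1 w - a) - heat (tau k w) (SS k w - a)).
  exact: L1B.
have -> : D k.+1 - D k = \int[P]_w (heat (tau k.+1 w) (SS k.+1 w - a) -
   heat (tau k w) (SS k w - a) - (A w * xi k w + (B w * xi k w ^+ 2 - B w * W k w))).
  rewrite IntB//; last exact: L1D.
  have -> : \int[P]_w (A w * xi k w + (B w * xi k w ^+ 2 - B w * W k w)) = 0.
    transitivity (\int[P]_w (A w * xi k w) +
      (\int[P]_w (B w * xi k w ^+ 2) - \int[P]_w (B w * W k w))).
      by rewrite -IntB// -IntD.
    by rewrite (xi_mart mA AC) (xi_var mB BC) subrr addr0.
  by rewrite subr0 IntB.
have lR : L1 P (fun w => C * (cubic k w + eta * (chi k w * W k w))).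
  by apply/L1Z/L1D => //; exact/L1Z/L1chiW.
rewrite -IntZ; last exact: L1chiW.
rewrite -IntD//; last exact/L1Z/L1chiW.
rewrite -IntZ; last by apply/L1D => //; exact/L1Z/L1chiW.
apply: Int_abs_le => //; first by apply: L1B => //; exact: L1D.
move=> w; set z := chi k w * xi k w; set e := chi k w * W k w.
have e0 : 0 <= e by case/andP: (chiW k w).
(* The expansion is made at [tau k.+1], the remaining time after the step, which is already
   [G k]-measurable; adding e restores [tau k]. *)
have := hs (tau k.+1 w) (SS k w - a) z e (tau_ge _ _) e0.
have -> : SS k w - a + z = SS k.+1 w - a by rewrite SSS /z; ring.
have -> : tau k.+1 w + e = tau k w by rewrite /tau VVS /e; ring.
have zz : z ^+ 2 = chi k w * xi k w ^+ 2 by rewrite /z exprMn expr2 chi2.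
have -> : heat_x (tau k.+1 w) (SS k w - a) * z + 2^-1 *
   heat_xx (tau k.+1 w) (SS k w - a) * (z ^+ 2 - e) =
   A w * xi k w + (B w * xi k w ^+ 2 - B w * W k w).
  by rewrite zz /A /B /z /e; ring.
move=> /le_trans; apply; rewrite ler_wpM2l ?(ltW C0)// lerD//.
  have /andP[c0 c1] := chi01 k w.
  rewrite /cubic; have z1 : `|z| <= `|xi k w|.
    by rewrite normrM (ger0_norm c0) ler_piMl.
  rewrite le_min !ge_min; apply/andP; split; apply/orP.
    by left; rewrite zz ler_piMl// sqr_ge0.
  by right; rewrite lerXn2r.
have /andP[w0 we] := W_bnd k w; have /andP[c0 c1] := chi01 k w.
rewrite expr2 ler_wpM2r// (le_trans _ we)//; by case/andP: (chiW k w).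
Qed.

(** Increments of [D] are telescoped; the stopped variances add up to at most s2 + b/2, which gives
    the eta term. The last term pays for returning from the stopped sums at time [tau n] to the
    original ones at time b. *)
Lemma martingale_heat n :
  `|\int[P]_w heat b (S n w - a) - heat (b + s2) a| <=
  C * (\sum_(k < n) \int[P]_w cubic k w + eta * (s2 + b / 2) +
       (2 + 4 / b) * \int[P]_w Num.min 1 `|V n w - s2|).
Proof.
have [C0 hb ht hs] := hC.
have eta0 : 0 <= eta by have /andP[/le_trans h /h] := W_bnd 0 point.
have D0 : D 0 = heat (b + s2) a.
  rewrite /D (_ : (fun w => _) = cst (heat (b + s2) a)) ?Int_cst//.
  by apply/funext => w; rewrite /tau /VV /SS !big_ord0 subr0 sub0r /heat/= sqrrN.
have tel : `|D n - D 0| <= C * (\sum_(k < n) \int[P]_w cubic k w + eta * (s2 + b / 2)).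
  apply: le_trans (_ : C * (\sum_(k < n) \int[P]_w cubic k w +
     eta * \int[P]_w VV n w) <= _); last first.
    rewrite ler_wpM2l ?(ltW C0)// lerD// ler_wpM2l//.
    rewrite -[leRHS](Int_cst P); apply: Int_le; [|exact: L1_cst|by []].
    apply: (@L1_bnd _ _ _ _ _ (s2 + b / 2)); first exact: mVVT.
    move=> w.
    by rewrite ger0_norm.
  have -> : \int[P]_w VV n w = \sum_(k < n) \int[P]_w (chi k w * W k w).
    by rewrite /VV Int_sum// => i; exact: L1chiW.
  rewrite mulr_sumr -big_split/= mulr_sumr.
  elim: n => [|m ih]; first by rewrite subrr normr0 big_ord0.
  rewrite big_ord_recr/= addrC.
  exact: (ler_distD_le (heat_increment m) ih).
have mSa (F : nat -> T -> R) : (forall k, gmeas (G k) (F k)) ->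
    measurable_fun setT (fun w => F n w - a).
  by move=> mF; apply: measurable_funB => //; exact: mT (mF n).
have bb : b / 2 <= b by move: b0; lra.
have l1 : L1 P (fun w => heat b (S n w - a)) by apply: L1heat => //; exact: mSa.
have l2 : L1 P (fun w => heat (tau n w) (SS n w - a)) by apply: L1heat => //; exact: mSa.
have lm : L1 P (fun w => Num.min 1 `|V n w - s2|).
  apply: (@L1_bnd _ _ _ _ _ 1); first by apply: measurable_min1; exact: measurable_funB.
  by move=> w; rewrite ger0_norm ?le_min ?ler01//= ge_min lexx.
(* If V_n <= s2 + b/2 nothing was stopped and [heat] is Lipschitz in time. Otherwise |V_n - s2| >
   b/2 and the trivial bound 2 C is covered, since (4/b)(b/2) = 2; the summand 2 covers |V_n - s2|
   >= 1. *)
have end_ : `|\int[P]_w heat b (S n w - a) - D n| <=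
    C * ((2 + 4 / b) * \int[P]_w Num.min 1 `|V n w - s2|).
  rewrite /D -IntB// -IntZ// -IntZ//; last exact: L1Z.
  apply: Int_abs_le; [exact: L1B|by do 2 apply: L1Z|] => w.
  have [h1 _ _] := hb b (S n w - a) bb.
  have [h2 _ _] := hb _ (SS n w - a) (tau_ge n w).
  have triv : `|heat b (S n w - a) - heat (tau n w) (SS n w - a)| <= C * 2.
    by apply: le_trans (ler_normB _ _) _; lra.
  have b4 : 0 < 4 / b by rewrite divr_gt0.
  have m0 : 0 <= Num.min 1 `|V n w - s2| by rewrite le_min ler01/=.
  have big (y : R) : y <= C * 2 -> b / 2 <= `|V n w - s2| ->
      y <= C * ((2 + 4 / b) * Num.min 1 `|V n w - s2|).
    move=> yC bV; apply: le_trans yC _; rewrite ler_wpM2l ?(ltW C0)//.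
    have [_|_] := leP 1 `|V n w - s2|; first by lra.
    have : 4 / b * (b / 2) <= 4 / b * `|V n w - s2| by rewrite ler_wpM2l// ltW.
    have -> : 4 / b * (b / 2) = 2 by field; rewrite gt_eqF.
    by have := normr_ge0 (V n w - s2); lra.
  have [Vle|Vgt] := leP (V n w) (s2 + b / 2); last first.
    by apply: big => //; rewrite ger0_norm; lra.
  have [_ ->] := unstopped Vle; have := ht b (tau n w) (S n w - a) bb (tau_ge n w).
  rewrite /tau; have [-> _] := unstopped Vle.
  have -> : b - (b + s2 - V n w) = V n w - s2 by ring.
  have [V1|V1] := leP 1 `|V n w - s2|.
    move=> _; rewrite mulr1.
    have [h3 _ _] := hb _ (S n w - a) (tau_ge n w).
    move: h3; rewrite /tau; have [-> _] := unstopped Vle => h3.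
    apply: le_trans (ler_normB _ _) _.
    have : 0 < C * (4 / b) by rewrite mulr_gt0.
    by lra.
  move=> /le_trans; apply; rewrite ler_wpM2l ?(ltW C0)// ler_peMl//; lra.
rewrite -D0 mulrDr [leRHS]addrC; exact: (ler_distD_le end_ tel).
Qed.

End martingale_heat.

(** * Gaussian smoothing *)

Section product_integrals.
Context d1 d2 (T1 : measurableType d1) (T2 : measurableType d2) (R : realType).
Variable m1 : {sigma_finite_measure set T1 -> \bar R}.
Variable m2 : {sigma_finite_measure set T2 -> \bar R}.
Implicit Types f : T1 * T2 -> R.

Lemma L1_prod f : measurable_fun setT f ->
  (forall x, L1 m2 (fun y => f (x, y))) ->
  L1 m1 (fun x => \int[m2]_y `|f (x, y)|) -> L1 (m1 \x m2)%E f.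
Proof.
move=> mf lf l1; apply/integrable12ltyP; first exact/measurable_EFinP.
under eq_integral.
  move=> x _.
  rewrite (_ : \int[m2]_y _ = (\int[m2]_y `|f (x, y)|)%:E)%E; last first.
    by rewrite IntE//; exact: L1_abs.
  over.
by rewrite -IntE// ltry.
Qed.

Lemma Int_fubini f : L1 (m1 \x m2)%E f ->
  (forall x, L1 m2 (fun y => f (x, y))) ->
  (forall y, L1 m1 (fun x => f (x, y))) ->
  \int[m1]_x \int[m2]_y f (x, y) = \int[m2]_y \int[m1]_x f (x, y).
Proof.
move=> lf l1 l2; rewrite /Rintegral.
under eq_integral do rewrite -(IntE (l1 _)).
under [in RHS]eq_integral do rewrite -(IntE (l2 _)).
congr fine.
transitivity (\int[m1]_x \int[m2]_y (f (x, y))%:E)%E.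
  by apply: eq_integral => x _; exact: (IntE (l1 x)).
rewrite (Fubini lf).
by apply: eq_integral => y _; rewrite -(IntE (l2 y)).
Qed.

End product_integrals.

Section densities.
Context d d' (T : measurableType d) (E : measurableType d') (R : realType).
Context (P : probability T R) (mu : {measure set E -> \bar R}).

(** The difference of the two sides is a functional to which [bounded_extension] applies; it
    vanishes on indicators by the defining property of p. *)
Lemma density_expectation (Z : T -> E) (p : E -> R) :
  measurable_fun setT Z -> L1 mu p -> (forall y, 0 <= p y) ->
  (forall B, measurable B -> P (Z @^-1` B) = (\int[mu]_(y in B) (p y)%:E)%E) ->
  forall (g : E -> R) (M : R), measurable_fun setT g -> (forall y, `|g y| <= M) ->
  \int[P]_w g (Z w) = \int[mu]_y (g y * p y).
Proof.
move=> mZ lp p0 hp g M mg gM; apply/eqP; rewrite -subr_eq0; apply/eqP.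
have lgZ (U : E -> R) : measurable_fun setT U -> (exists M : R, forall x, `|U x| <= M) ->
    L1 P (fun w => U (Z w)).
  by move=> mU [N UN]; apply: (@L1_bnd _ _ _ _ _ N) => //; exact: measurableT_comp.
have lgp (U : E -> R) : measurable_fun setT U -> (exists M : R, forall x, `|U x| <= M) ->
    L1 mu (fun y => U y * p y).
  by move=> mU [N UN]; apply: (@L1_bndM _ _ _ _ _ _ N).
apply: (@bounded_extension _ E R (fun U => \int[P]_w U (Z w) - \int[mu]_y (U y * p y))
  (1 + \int[mu]_y p y) _ _ _ g M mg gM).
- move=> A mA; apply/eqP; rewrite subr_eq0; apply/eqP; rewrite /Rintegral; congr fine.
  transitivity (\int[P]_w (\1_(Z @^-1` A) w)%:E)%E.
    by apply: eq_integral => w _; rewrite !indicE; congr ((nat_of_bool _)%:R%:E); apply/idP/idP; rewrite !inE.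
  have mZA : measurable (Z @^-1` A) by rewrite -[X in measurable X]setTI; exact: mZ.
  transitivity (P (Z @^-1` A)); first by rewrite integral_indic// setIT.
  rewrite (hp _ mA) integral_mkcond.
  apply: eq_integral => y _; rewrite /patch indicE; case: (y \in A); rewrite ?mul1r ?mul0r//.
- move=> c U V mU mV bU bV.
  transitivity ((c * \int[P]_w U (Z w) + \int[P]_w V (Z w)) -
     (c * \int[mu]_y (U y * p y) + \int[mu]_y (V y * p y))); last by ring.
  rewrite -IntZ; last exact: lgZ.
  rewrite -IntD; [|exact/L1Z/lgZ|exact: lgZ].
  rewrite -IntZ; last exact: lgp.
  rewrite -IntD; [|exact/L1Z/lgp|exact: lgp].
  by congr (_ - _); apply: eq_Int => y; ring.
- move=> U e mU Ue; rewrite mulrDl mul1r (le_trans (ler_normB _ _))// lerD//.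
    by apply: Int_bnd => //; apply: lgZ => //; exists e.
  rewrite mulrC -IntZ//; apply: Int_abs_le; [by apply: lgp => //; exists e|exact: L1Z|].
  by move=> y; rewrite normrM (ger0_norm (p0 y)) ler_wpM2r.
Qed.

End densities.

Section scheffe.
Context d (T : measurableType d) (R : realType) (mu : {measure set T -> \bar R}).

(** The positive part of [q - p n] is dominated by q, so its integral tends to 0; as both masses
    agree, the L^1 distance is twice that integral. *)
Lemma scheffe (p : nat -> T -> R) (q g : T -> R) (M : R) :
  (forall n, L1 mu (p n)) -> L1 mu q -> (forall n x, 0 <= p n x) ->
  (forall x, 0 <= q x) -> (forall x, p n x @[n --> \oo] --> q x) ->
  (forall n, \int[mu]_x p n x = \int[mu]_x q x) ->
  measurable_fun setT g -> (forall x, `|g x| <= M) ->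
  \int[mu]_x (g x * p n x) @[n --> \oo] --> \int[mu]_x (g x * q x).
Proof.
move=> lp lq p0 q0 pq ipq mg gM.
have M0 : 0 <= M by exact: le_trans (gM point).
pose m n x := Num.max 0 (q x - p n x).
have m0 n x : 0 <= m n x by rewrite /m le_max lexx.
have mq n x : `|m n x| <= q x.
  by rewrite ger0_norm// /m ge_max q0/= lerBlDr lerDl.
have mm n : measurable_fun setT (m n).
  apply: measurable_maxr => //; apply: measurable_funB; first exact: L1_measurable lq.
  exact: L1_measurable (lp n).
have lm n : L1 mu (m n) by exact: L1_le (mm n) (mq n) lq.
have cm : \int[mu]_x m n x @[n --> \oo] --> \int[mu]_(x in [set: T]) (0 : R).
  apply: (Int_dct (g := q)) => //; apply: aeW => x.
  have h : q x - p n x @[n --> \oo] --> 0.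
    by rewrite -(subrr (q x)); apply: cvgB => //; exact: cvg_cst.
  apply/cvgr0Pnorm_le => e e0; move/cvgr0Pnorm_le : h => /(_ _ e0).
  apply: filterS => n; rewrite ler_norml => /andP[_ h].
  by rewrite ger0_norm// /m ge_max h ltW.
rewrite Int0 in cm.
apply/cvgrPdist_le => e e0.
move/cvgr0Pnorm_le : cm => /(_ (e / (2 * (M + 1)))) [].
  by rewrite divr_gt0// mulr_gt0//; lra.
move=> N _ hN; exists N => // n /hN {}hN.
have lgq : L1 mu (fun x => g x * q x) by apply: (@L1_bndM _ _ _ _ _ _ M).
have lgp : L1 mu (fun x => g x * p n x) by apply: (@L1_bndM _ _ _ _ _ _ M).
rewrite -IntB//.
have -> : \int[mu]_x (g x * q x - g x * p n x) = \int[mu]_x (g x * (q x - p n x)).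
  by apply: eq_Int => x; rewrite mulrBr.
have lqp : L1 mu (fun x => q x - p n x) by exact: L1B.
apply: le_trans (_ : \int[mu]_x (M * (2 * m n x - (q x - p n x))) <= _).
  apply: Int_abs_le.
  - exact: (@L1_bndM _ _ _ _ _ _ M).
  - by apply/L1Z/L1B => //; exact: L1Z.
  - move=> x; rewrite normrM; apply: ler_pM => //.
    rewrite /m; case: (leP (q x - p n x) 0) => h.
      by rewrite ler0_norm//; lra.
    by rewrite gtr0_norm//; lra.
have -> : \int[mu]_x (M * (2 * m n x - (q x - p n x))) = M * (2 * \int[mu]_x m n x).
  rewrite IntZ; last by apply: L1B => //; exact: L1Z.
  by rewrite IntB//; [rewrite IntZ// IntB// ipq subrr subr0|exact: L1Z].
move: hN; rewrite ger0_norm ?Int_ge0// ler_pdivlMr ?mulr_gt0//; last by lra.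
by have : 0 <= \int[mu]_x m n x by [exact: Int_ge0]; nra.
Qed.

End scheffe.

Section gaussian.
Context {R : realType}.
Notation mu := (@lebesgue_measure R).
Implicit Types a b x y e v M : R.

(** The common mass of all the kernels [heat b]. *)
Definition gcst : R := Num.sqrt (pi *+ 2).

Lemma gcst_gt0 : 0 < gcst.
Proof. by rewrite sqrtr_gt0 pmulrn_lgt0// pi_gt0. Qed.

Lemma normal_pdf_heat b a x : 0 < b ->
  normal_pdf a (Num.sqrt b) x = gcst^-1 * heat b (a - x).
Proof.
move=> b0; have sb : Num.sqrt b != 0 by rewrite gt_eqF// sqrtr_gt0.
rewrite normal_pdfE// /normal_peak /normal_fun /heat sqr_sqrtr ?ltW//.
rewrite expRD mulrA [RHS]mulrAC; congr (_ * expR _); last first.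
  by rewrite -(sqrrN (a - x)) opprB; field; rewrite gt_eqF.
rewrite -mulrnAr sqrtrM ?ltW// invfM mulrC -/gcst; congr (_ * _).
have -> : - (2^-1 * ln b) = - ln (Num.sqrt b).
  have := @lnXn R 2 (Num.sqrt b); rewrite sqr_sqrtr ?ltW// sqrtr_gt0 => /(_ b0) ->.
  by rewrite mulr2n -(mulr_natl _ 2); field.
by rewrite expRN lnK ?posrE ?sqrtr_gt0.
Qed.

Lemma measurable_heat_sub b a : measurable_fun setT (fun x => heat b (a - x)).
Proof. by apply: measurable_heat => //; exact: measurable_funB. Qed.

Lemma heat_pdf b a x : 0 < b ->
  heat b (a - x) = gcst * normal_pdf a (Num.sqrt b) x.
Proof. by move=> b0; rewrite normal_pdf_heat// mulVKf// gt_eqF// gcst_gt0. Qed.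

Lemma L1_heat b a : 0 < b -> L1 mu (fun x => heat b (a - x)).
Proof.
move=> b0; apply: (eq_integrable measurableT _ _ _ (L1Z gcst (integrable_normal_pdf a (Num.sqrt b)))).
by move=> x _; rewrite /= heat_pdf.
Qed.

Lemma Int_heat b a : 0 < b -> \int[mu]_x heat b (a - x) = gcst.
Proof.
move=> b0; under eq_Rintegral do rewrite heat_pdf//.
rewrite IntZ; last exact: integrable_normal_pdf.
by rewrite /Rintegral integral_normal_pdf mulr1.
Qed.

Lemma heatN b x : heat b (- x) = heat b x. Proof. by rewrite /heat sqrrN. Qed.

(** Half of the exponent, v = z^2/(4b), is spent on e^(-v) <= 1/v <= 4b/e^2; the other half is that
    of the kernel at time 2b. The prefactors differ by sqrt 2, bounded by 2. *)
Lemma heat_tail b a x e : 0 < b -> 0 < e -> e <= `|a - x| ->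
  heat b (a - x) <= 8 * b / e ^+ 2 * heat (b + b) (a - x).
Proof.
move=> b0 e0 eax; set z := a - x.
have zz : e ^+ 2 <= z ^+ 2.
  by rewrite -(real_normK (num_real z)) lerXn2r// ?nnegrE// ltW.
pose v := z ^+ 2 / (4 * b).
have z2 : 0 < z ^+ 2 by apply: lt_le_trans zz; rewrite exprn_gt0.
have v0 : 0 < v by apply: divr_gt0 => //; exact: mulr_gt0.
have -> : heat b z = expR (- v) * expR (2^-1 * ln 2) * heat (b + b) z.
  rewrite /heat -!expRD; congr expR.
  have -> : b + b = 2 * b by ring.
  by rewrite lnM ?posrE// /v; field; rewrite gt_eqF.
rewrite ler_wpM2r ?heat_ge0//.
have ev : expR (- v) <= v^-1.
  rewrite expRN lef_pV2 ?posrE ?expR_gt0//.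
  by apply: le_trans (expR_ge1Dx v); lra.
have vi : v^-1 <= 4 * b / e ^+ 2.
  rewrite /v invf_div ler_wpM2l ?mulr_ge0 ?(ltW b0)//.
  by rewrite lef_pV2 ?posrE// exprn_gt0.
have e2 : expR (2^-1 * ln 2) <= 2 :> R.
  rewrite -[leRHS](@lnK R) ?posrE// ler_expR.
  by have : 0 <= ln 2 :> R by [rewrite ln_ge0//; lra]; lra.
have -> : 8 * b / e ^+ 2 = (4 * b / e ^+ 2) * 2 by field; rewrite gt_eqF.
by apply: ler_pM; rewrite ?expR_ge0//; exact: le_trans vi.
Qed.

Definition unif_cont (g : R -> R) : Prop :=
  forall e, 0 < e -> exists2 dl : R, 0 < dl &
    forall x y, `|x - y| <= dl -> `|g x - g y| <= e.

(** The convolution of g with N(0, b). *)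
Definition smooth (b : R) (g : R -> R) x := gcst^-1 * \int[mu]_y (g y * heat b (x - y)).

Section smooth_close.
Variables (g : R -> R) (M : R).
Hypotheses (mg : measurable_fun setT g) (gM : forall x, `|g x| <= M).

Lemma L1_gheat b a : 0 < b -> L1 mu (fun y => g y * heat b (a - y)).
Proof. by move=> b0; apply: (@L1_bndM _ _ _ _ _ _ M) => //; exact: L1_heat. Qed.

(** Within distance [dl] uniform continuity applies, beyond it [heat_tail]; the choice of [b0] is
    uniform in x. *)
Lemma smooth_close : unif_cont g -> forall e, 0 < e ->
  exists2 b0, 0 < b0 & forall b x, 0 < b -> b <= b0 -> `|smooth b g x - g x| <= e.
Proof.
move=> ug e e0; have e2 : 0 < e / 2 by rewrite divr_gt0.
have M0 : 0 <= M by exact: le_trans (gM 0).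
have [dl dl0 hdl] := ug _ e2.
(* The tail contributes 16 M b / dl^2, at most e/2 once b k <= e. *)
pose k := 32 * (M + 1) / dl ^+ 2.
have k0 : 0 < k by rewrite divr_gt0 ?exprn_gt0// mulr_gt0//; lra.
exists (e / k); first by rewrite divr_gt0.
move=> b x b0; rewrite ler_pdivlMr// => bk.
have bb0 : 0 < b + b by lra.
have gx : g x = gcst^-1 * \int[mu]_y (g x * heat b (x - y)).
  rewrite IntZ; last exact: L1_heat.
  by rewrite Int_heat// mulrCA mulVf ?mulr1// gt_eqF// gcst_gt0.
rewrite gx /smooth -mulrBr -IntB; [|exact: L1_gheat|exact/L1Z/L1_heat].
rewrite normrM ger0_norm ?invr_ge0 ?(ltW gcst_gt0)// ler_pdivrMl ?gcst_gt0//.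
apply: le_trans (_ : \int[mu]_y (e / 2 * heat b (x - y) +
   2 * M * (8 * b / dl ^+ 2) * heat (b + b) (x - y)) <= _).
  apply: Int_abs_le.
  - by apply: L1B; [exact: L1_gheat|exact/L1Z/L1_heat].
  - by apply: L1D; apply/L1Z/L1_heat.
  move=> y; rewrite -mulrBl normrM (ger0_norm (heat_ge0 _ _)).
  have c0 : 0 <= 8 * b / dl ^+ 2 by rewrite divr_ge0 ?sqr_ge0 ?mulr_ge0 ?(ltW b0).
  have [h|/ltW h] := leP `|x - y| dl.
    apply: le_trans (_ : e / 2 * heat b (x - y) <= _).
      by rewrite ler_wpM2r ?heat_ge0// distrC hdl.
    rewrite lerDl; apply: mulr_ge0; last exact: heat_ge0.
    by apply: mulr_ge0 => //; exact: mulr_ge0.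
  apply: le_trans (_ : 2 * M * heat b (x - y) <= _).
    rewrite ler_wpM2r ?heat_ge0// (le_trans (ler_normB _ _))//.
    by have := gM x; have := gM y; lra.
  apply: ler_wpDl; first by rewrite mulr_ge0 ?heat_ge0// ltW.
  rewrite -[leRHS]mulrA ler_wpM2l ?mulr_ge0//.
  exact: heat_tail.
rewrite IntD; [|exact/L1Z/L1_heat|exact/L1Z/L1_heat].
rewrite !IntZ; [|exact: L1_heat|exact: L1_heat].
rewrite !Int_heat// -mulrDl mulrC ler_wpM2l ?(ltW gcst_gt0)//.
have -> : 2 * M * (8 * b / dl ^+ 2) = (b * k - 32 * b / dl ^+ 2) / 2.
  by rewrite /k; field; rewrite gt_eqF.
have : 0 <= 32 * b / dl ^+ 2 by rewrite divr_ge0 ?sqr_ge0// mulr_ge0// ltW.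
by lra.
Qed.

End smooth_close.

Lemma Int_centered_normal v (g : R -> R) (M : R) : 0 <= v ->
  measurable_fun setT g -> (forall x, `|g x| <= M) ->
  \int[centered_normal v]_y g y = if v == 0 then g 0 else smooth v g 0.
Proof.
move=> v0 mg gM; rewrite /centered_normal; have [vE|vn0] := eqVneq v 0.
  rewrite /Rintegral integral_dirac//=; last exact/measurable_EFinP.
  by rewrite indicE in_setT mul1r.
have vp : 0 < v by rewrite lt_def vn0.
rewrite (@density_expectation _ _ _ _ R (normal_prob 0 (Num.sqrt v)) mu id (normal_pdf 0 (Num.sqrt v)) _ _ _ _ g M)//.
- rewrite /smooth -IntZ; last exact: L1_gheat.
  by apply: eq_Int => y; rewrite normal_pdf_heat// mulrCA.
- exact: integrable_normal_pdf.
- by move=> y; exact: normal_pdf_ge0.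
Qed.

(** For v = 0 the smoothing is an approximate identity; for v > 0 the kernels at times between v and
    1 + v converge under a common majorant. *)
Lemma cvg_smooth v (g : R -> R) (M : R) : 0 <= v ->
  measurable_fun setT g -> (forall x, `|g x| <= M) -> unif_cont g ->
  smooth (m.+1%:R^-1 + v) g 0 @[m --> \oo] --> \int[centered_normal v]_y g y.
Proof.
move=> v0 mg gM ug; rewrite (Int_centered_normal v0 mg gM).
have q0 (n : nat) : (0 : R) < n.+1%:R^-1 by rewrite invr_gt0.
have [->|vn0] := eqVneq v 0.
  apply/cvgrPdist_le => e e0.
  have [b0 b00 h] := smooth_close mg gM ug e0.
  have : (n.+1%:R^-1 : R) @[n --> \oo] --> 0 by exact: cvg_harmonic.
  move=> /cvgr0Pnorm_le/(_ _ b00); apply: filterS => n.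
  by rewrite ger0_norm ?(ltW (q0 n))// addr0 distrC; exact: h.
have vp : 0 < v by rewrite lt_def vn0.
have M0 : 0 <= M by exact: le_trans (gM 0).
have [C [C0 _ hC _]] := heat_step vp.
have q1 (n : nat) : n.+1%:R^-1 <= 1 :> R by rewrite invf_le1// ler1n.
have vn (n : nat) : 0 < n.+1%:R^-1 + v by rewrite addr_gt0.
(* For v <= t <= 1 + v the exponent is largest at time 1 + v and the prefactor at time v, whence the
   factor sqrt((1 + v)/v). *)
pose D y := M * (expR (2^-1 * (ln (1 + v) - ln v)) * heat (1 + v) (0 - y)).
apply: cvgM; first exact: cvg_cst.
apply: (@Int_dct _ _ _ mu (fun n y => g y * heat (n.+1%:R^-1 + v) (0 - y)) _ D).
- by move=> n; apply: measurable_funM => //; exact: measurable_heat_sub.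
- by apply: measurable_funM => //; exact: measurable_heat_sub.
- apply: aeW => y; apply: cvgM; first exact: cvg_cst.
  apply/cvgrPdist_le => e1 e10.
  have ceps : C * n.+1%:R^-1 @[n --> \oo] --> 0.
    rewrite -[X in _ --> X](mulr0 C); apply: cvgM; first exact: cvg_cst.
    exact: cvg_harmonic.
  move/cvgr0Pnorm_le : ceps => /(_ _ e10); apply: filterS => n.
  rewrite ger0_norm ?mulr_ge0 ?(ltW C0) ?(ltW (q0 _))//; apply: le_trans.
  have vle : v <= n.+1%:R^-1 + v by rewrite lerDr ltW.
  apply: le_trans (hC v (n.+1%:R^-1 + v) (0 - y) (lexx _) vle) _.
  by rewrite opprD addrCA subrr addr0 normrN ger0_norm// ltW.
- by apply/L1Z/L1Z/L1_heat; lra.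
- move=> n y; rewrite normrM; apply: ler_pM => //.
  rewrite ger0_norm ?heat_ge0// /heat -expRD ler_expR.
  have l1 : ln v <= ln (n.+1%:R^-1 + v) by rewrite ler_ln ?posrE// lerDr ltW.
  have l2 : 2^-1 * (0 - y) ^+ 2 / (n.+1%:R^-1 + v) >= 2^-1 * (0 - y) ^+ 2 / (1 + v).
    apply: ler_wpM2l; first by apply: mulr_ge0 => //; exact: sqr_ge0.
    by rewrite lef_pV2 ?posrE ?lerD2r// addr_gt0.
  by lra.
Qed.

End gaussian.

Section weak_convergence.
Context d (T : measurableType d) (R : realType) (P : probability T R).
Variables (S : nat -> T -> R) (v : R).
Hypothesis mS : forall n, measurable_fun setT (S n).
Hypothesis v0 : 0 <= v.
Notation mu := (@lebesgue_measure R).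

(* Convergence of all heat transforms at every positive time b identifies the
   limit of the laws of S n smoothed by N(0, b); Scheffe's lemma makes it
   uniform over bounded test functions. *)
Hypothesis heat_cvg : forall b a, 0 < b ->
  \int[P]_w heat b (S n w - a) @[n --> \oo] --> heat (b + v) a.

Lemma weak_cvg_unif_cont (g : R -> R) (M : R) : measurable_fun setT g ->
  (forall x, `|g x| <= M) -> unif_cont g ->
  \int[P]_w g (S n w) @[n --> \oo] --> \int[centered_normal v]_y g y.
Proof.
move=> mg gM ug.
have M0 : 0 <= M by exact: le_trans (gM 0).
have gc0 := @gcst_gt0 R.
have lgS n : L1 P (fun w => g (S n w)).
  by apply: (@L1_bnd _ _ _ _ _ M) => //; exact: measurableT_comp.
have joint b n : measurable_fun setT (fun z : T * R => heat b (S n z.1 - z.2)).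
  apply: measurable_heat => //; apply: measurable_funB => //.
  exact: measurableT_comp.
have heatC b x y : heat b (x - y) = heat b (y - x) :> R.
  by rewrite -heatN opprB.
have fixed b : 0 < b -> \int[P]_w smooth b g (S n w) @[n --> \oo] --> smooth (b + v) g 0.
  move=> b0; have bv : 0 < b + v by rewrite ltr_wpDr.
  have [C [C0 hC _ _]] := heat_step b0.
  have lH n a : L1 P (fun w => heat b (S n w - a)).
    apply: (@L1_bnd _ _ _ _ _ C); last by move=> w; case: (hC b (S n w - a) (lexx _)).
    by apply: measurable_heat => //; exact: measurable_funB.
  (* Up to [gcst], the density at a of S_n plus an independent N(0, b) variable. *)
  pose p n a := \int[P]_w heat b (S n w - a).
  have mp n : measurable_fun setT (p n).
    apply: measurableT_comp => //.
    apply: (@measurable_fun_fubini_tonelli_G _ _ _ _ R P (fun z : T * R => (heat b (S n z.1 - z.2))%:E)).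
      by apply/measurable_EFinP; exact: joint.
    by move=> z; rewrite lee_fin heat_ge0.
  have lJ n : L1 (P \x mu)%E (fun z : T * R => heat b (S n z.1 - z.2)).
    apply: L1_prod; [exact: joint|by move=> x; exact: (L1_heat (S n x))|].
    rewrite (_ : (fun x => _) = cst gcst); first exact: L1_cst.
    apply/funext => w; rewrite -(Int_heat (S n w) b0); apply: eq_Int => y.
    by rewrite ger0_norm ?heat_ge0.
  have fub n (c : R -> R) N : measurable_fun setT c -> (forall x, `|c x| <= N) ->
      \int[P]_w \int[mu]_a (c a * heat b (S n w - a)) = \int[mu]_a (c a * p n a).
    move=> mc cN.
    have lcJ : L1 (P \x mu)%E (fun z : T * R => c z.2 * heat b (S n z.1 - z.2)).
      by apply: (@L1_bndM _ _ _ _ _ _ N) => //; exact: measurableT_comp.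
    rewrite (Int_fubini lcJ).
    - by apply: eq_Int => a; rewrite /= IntZ.
    - by move=> w; have h := (@L1_bndM _ _ _ mu c _ N mc cN (L1_heat (S n w) b0)); exact: h.
    - by move=> a; have h := L1Z (c a) (lH n a); exact: h.
  have ip n : \int[mu]_a p n a = gcst.
    transitivity (\int[P]_w \int[mu]_a (cst 1 a * heat b (S n w - a))).
      rewrite (@fub n (cst 1) 1)//; first by apply: eq_Int => a; rewrite mul1r.
      by move=> x; rewrite normr1.
    rewrite -[RHS](Int_cst P); apply: eq_Int => w.
    by rewrite -[RHS](Int_heat (S n w) b0); apply: eq_Int => a; rewrite mul1r.
  have p0 n a : 0 <= p n a by apply: Int_ge0 => w; exact: heat_ge0.
  have lp n : L1 mu (p n).
    apply/integrableP; split; first by apply/measurable_EFinP; exact: mp.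
    have -> : (\int[mu]_a `|(EFin \o p n) a| =
        \int[mu]_a \int[P]_w (heat b (S n w - a))%:E)%E.
      by apply: eq_integral => a _; rewrite gee0_abs ?lee_fin// -(IntE (lH n a)).
    have h := integral21_prod_meas1 (lJ n).
    by rewrite [X in (X < _)%E]h -IntE// ltry.
  have -> : (fun n => \int[P]_w smooth b g (S n w)) =
      fun n => gcst^-1 * \int[mu]_a (g a * p n a).
    apply/funext => n; rewrite -(@fub n g M)// /smooth IntZ//.
    have mgJ : measurable_fun setT (fun z : T * R => g z.2 * heat b (S n z.1 - z.2)).
      by apply: measurable_funM => //; exact: measurableT_comp.
    have lcJ : L1 (P \x mu)%E (fun z : T * R => g z.2 * heat b (S n z.1 - z.2)).
      by apply: (@L1_bndM _ _ _ _ _ _ M) => //; exact: measurableT_comp.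
    have := integrable_fubini_F lcJ.
    apply: eq_integrable => // w _.
    by rewrite /fubini_F /= IntE//; apply: L1_gheat b0 => //; exact: gM.
  rewrite /smooth; apply: cvgM; first exact: cvg_cst.
  apply: (@scheffe _ _ _ mu p (fun a => heat (b + v) (0 - a)) g M) => //.
  - exact: L1_heat.
  - by move=> a; exact: heat_ge0.
  - by move=> a; rewrite sub0r heatN; exact: heat_cvg.
  - by move=> n; rewrite ip Int_heat.
apply/cvgrPdist_le => e e0.
have e3 : 0 < e / 3 by rewrite divr_gt0.
have [b0 b00 close] := smooth_close mg gM ug e3.
have h1 := cvg_smooth v0 mg gM ug.
have h2 : (n.+1%:R^-1 : R) @[n --> \oo] --> 0 by exact: cvg_harmonic.
(* One smoothing time serves the limit law and, because [smooth_close] is uniform, the laws of all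
   [S n]. *)
have [m [hm1 hm2]] : exists m : nat, `|\int[centered_normal v]_y g y -
     smooth (m.+1%:R^-1 + v) g 0| <= e / 3 /\ m.+1%:R^-1 <= b0.
  move/cvgrPdist_le : h1 => /(_ _ e3) h1.
  move/cvgr0Pnorm_le : h2 => /(_ _ b00) h2.
  have [N _ hN] := filterI h1 h2; exists N; have [|? ?] := hN N; first exact: leqnn.
  by split => //; apply: le_trans (ler_norm _) _.
set b := m.+1%:R^-1 in hm1 hm2; have bp : 0 < b by rewrite invr_gt0.
move/cvgrPdist_le : (fixed b bp) => /(_ _ e3); apply: filterS => n hn.
have ls : L1 P (fun w => smooth b g (S n w)).
  apply: (@L1_bnd _ _ _ _ _ (M + e / 3)).
    apply: measurable_funM => //; apply: measurableT_comp => //.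
    have mgJ : measurable_fun setT (fun z : T * R => g z.2 * heat b (S n z.1 - z.2)).
      apply: measurable_funM; [exact: measurableT_comp|exact: joint].
    have lcJ : L1 (P \x mu)%E (fun z : T * R => g z.2 * heat b (S n z.1 - z.2)).
      apply: (@L1_bndM _ _ _ _ _ _ M) => //; first exact: measurableT_comp.
      apply: L1_prod; [exact: joint|by move=> x; exact: (L1_heat (S n x))|].
      rewrite (_ : (fun x => _) = cst gcst); first exact: L1_cst.
      apply/funext => w; rewrite -(Int_heat (S n w) bp); apply: eq_Int => y.
      by rewrite ger0_norm ?heat_ge0.
    exact: measurable_int (integrable_fubini_F lcJ).
  move=> w; have := close b (S n w) bp hm2; have := gM (S n w) => h3 h4.
  rewrite -(subrK (g (S n w)) (smooth b g _)) (le_trans (ler_normD _ _))//.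
  by rewrite addrC lerD.
have h3 : `|\int[P]_w smooth b g (S n w) - \int[P]_w g (S n w)| <= e / 3.
  by rewrite -IntB//; apply: Int_bnd; [exact: L1B|move=> w; exact: close].
have -> : e = e / 3 + (e / 3 + e / 3) by field.
by apply: ler_distD_le hm1 (ler_distD_le hn h3).
Qed.

End weak_convergence.

(** * Convergence in distribution *)

Section weak_convergence_criterion.
Context {R : realType}.
Implicit Types (g : R -> R) (e L M x y : R).

(** Compactness of [-L, L] as a near-covering property, with the radius as second variable. The
    point y may leave the interval, which the cutoff argument uses. *)
Lemma heine g L e : continuous g -> 0 < e ->
  exists2 dl : R, 0 < dl & forall x y, `|x| <= L -> `|x - y| <= dl -> `|g x - g y| <= e.
Proof.
move=> cg e0; have e2 : 0 < e / 2 by rewrite divr_gt0.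
have /compact_near_coveringP cov := @segment_compact R (- L) L.
have [] := cov R (0^'+) (fun dl x => forall y, `|x - y| <= dl -> `|g x - g y| <= e) _.
  move=> x _; have /cvgrPdist_le/(_ _ e2) := cg x.
  case=> rho /= rho0 hrho.
  exists (ball x (rho / 2), [set dl : R | dl < rho / 2]) => /=.
    split; first by apply: nbhsx_ballx; rewrite divr_gt0.
    by apply: nbhs_right_lt; rewrite divr_gt0.
  move=> [x' dl] /= [xx' dlr] y x'y.
  have h1 : `|g x - g x'| <= e / 2.
    by apply: hrho => /=; apply: lt_trans xx' _; lra.
  have h2 : `|g x - g y| <= e / 2.
    apply: hrho => /=; rewrite -(subrKA x') (le_lt_trans (ler_normD _ _))//.
    have : `|x - x'| < rho / 2 by exact: xx'.
    by move: x'y dlr; lra.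
  rewrite distrC in h1; have -> : e = e / 2 + e / 2 by field.
  exact: ler_distD_le h1 h2.
move=> rho /= rho0 h; exists (rho / 2); first by rewrite divr_gt0.
move=> x y xL xy; apply: (h (rho / 2)) => //=.
- by rewrite sub0r normrN gtr0_norm ?divr_gt0//; lra.
- by rewrite divr_gt0.
- by rewrite in_itv/= -ler_norml.
Qed.

Definition trapezoid L x : R := Num.max 0 (Num.min 1 (L + 1 - `|x|)).

Lemma trapezoid01 L x : 0 <= trapezoid L x <= 1.
Proof. by rewrite /trapezoid le_max lexx/= ge_max ler01 ge_min lexx. Qed.

Lemma trapezoid_lip L x y : `|trapezoid L x - trapezoid L y| <= `|x - y|.
Proof.
have h := ler_dist_dist x y; move: h (normr_ge0 (x - y)).
rewrite /trapezoid; set a := `|x|; set b := `|y|; set c := `|x - y|.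
rewrite !ler_norml => /andP[h1 h2] c0.
by apply/andP; split; rewrite /Num.max /Num.min; repeat case: ifPn;
  rewrite -?leNgt => *; lra.
Qed.

Lemma trapezoid_cont L : continuous (trapezoid L).
Proof.
move=> x; apply/cvgrPdist_le => e e0; near=> y.
apply: le_trans (trapezoid_lip _ _ _) _.
by near: y; apply: cvgr_dist_le.
Unshelve. all: by end_near. Qed.

Lemma trapezoid_out L x : L + 1 <= `|x| -> trapezoid L x = 0.
Proof.
by move=> h; apply/max_idPl; rewrite ge_min; apply/orP; right; lra.
Qed.

Lemma trapezoid_in L x : `|x| <= L -> trapezoid L x = 1.
Proof.
by move=> h; rewrite /trapezoid; have -> : Num.min 1 (L + 1 - `|x|) = 1;
  [apply/min_idPl; lra|apply/max_idPr].
Qed.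

Lemma trapezoid_unif_cont L : unif_cont (trapezoid L).
Proof. by move=> e e0; exists e => // x y; exact/le_trans/trapezoid_lip. Qed.

(** If x or y lies in the support of the cutoff, [heine] applies around it; if neither does, both
    values vanish. *)
Lemma unif_cont_compact g L : continuous g ->
  unif_cont (fun x => trapezoid L x * g x).
Proof.
move=> cg e e0.
have cF : continuous (fun x => trapezoid L x * g x).
  by move=> x; apply: cvgM; [exact: trapezoid_cont|exact: cg].
have [dl dl0 h] := heine (L + 1) cF e0.
exists dl => // x y xy.
have [xL|/ltW xL] := leP `|x| (L + 1); first exact: h.
have [yL|/ltW yL] := leP `|y| (L + 1).
  by rewrite distrC; apply: h => //; rewrite distrC.
by rewrite !trapezoid_out// !mul0r subrr normr0 ltW.
Qed.

Context d (T : measurableType d) (P : probability T R).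

(** Multiplying g by a trapezoid t makes it uniformly continuous at a cost of at most M(1 - t). The
    trapezoid is itself an admissible test function, so its mean under [Z n] converges to that under
    m, and this provides the tightness. *)
Lemma cvg_in_distribution_unif_cont (Z : nat -> T -> R)
    (m : probability (measurableTypeR R) R) :
  (forall n, measurable_fun setT (Z n)) ->
  (forall g M, continuous g -> (forall x, `|g x| <= M) -> unif_cont g ->
     \int[P]_w g (Z n w) @[n --> \oo] --> \int[m]_y g y) ->
  cvg_in_distribution P Z m.
Proof.
move=> mZ hZ g cg [M gM].
have mcont (u : R -> R) : continuous u -> measurable_fun setT u.
  exact: continuous_measurable_fun.
have lP n (u : R -> R) N : continuous u -> (forall x, `|u x| <= N) ->
    L1 P (fun w => u (Z n w)).
  by move=> cu uN; apply: (@L1_bnd _ _ _ _ _ N) => //; apply: measurableT_comp => //; exact: mcont.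
have lm (u : R -> R) N : continuous u -> (forall x, `|u x| <= N) -> L1 m u.
  by move=> cu uN; apply: (@L1_bnd _ _ _ _ _ N) => //; exact: mcont.
have tM L x : `|trapezoid L x| <= 1.
  by have /andP[h1 h2] := trapezoid01 L x; rewrite ger0_norm.
have M0 : 0 <= M by exact: le_trans (gM 0).
rewrite -(IntE (lm g M cg gM)).
rewrite (_ : (fun n => _) = fun n => (\int[P]_w g (Z n w))%:E); last first.
  by apply/funext => n; rewrite unlock (IntE (lP n g M cg gM)).
apply: cvg_EFin; first exact: nearW.
apply/cvgrPdist_le => e e0.
(* Four fifths of e are spent: one on the tail of m, one on the cut-off function, two on the tail of
   [Z n]; [M + 1] covers M = 0. *)
have e5 : 0 < e / (5 * (M + 1)) by rewrite divr_gt0// mulr_gt0//; lra.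
have [L hL] : exists L : R, 1 - \int[m]_y trapezoid L y <= e / (5 * (M + 1)).
  have : \int[m]_y trapezoid n%:R y @[n --> \oo] --> \int[m]_y (cst 1 y).
    apply: (Int_dct (g := cst 1)).
    - by move=> n; apply: mcont; exact: trapezoid_cont.
    - by [].
    - apply: aeW => x; apply: cvg_near_cst.
      near=> n; apply: trapezoid_in; near: n.
      exact: nbhs_infty_ger.
    - exact: L1_cst.
    - by move=> n x; exact: tM.
  move=> /cvgrPdist_le/(_ _ e5)[N _ /(_ N (leqnn _))].
  rewrite Int_cst => h; exists N%:R; exact: le_trans (ler_norm _) h.
pose t := trapezoid L; pose gt x := t x * g x.
have ct : continuous t by exact: trapezoid_cont.
have cgt : continuous gt by move=> x; apply: cvgM; [exact: ct|exact: cg].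
have gtM x : `|gt x| <= M.
  by rewrite /gt normrM -[leRHS]mul1r; apply: ler_pM => //; exact: tM.
have h1 := hZ gt M cgt gtM (@unif_cont_compact g L cg).
have h2 := hZ t 1 ct (tM L) (@trapezoid_unif_cont L).
have e5' : 0 < e / 5 by rewrite divr_gt0.
move/cvgrPdist_le : h1 => /(_ _ e5'); move/cvgrPdist_le : h2 => /(_ _ e5).
apply: filterS2 => n h2 h1.
have gd x : `|g x - gt x| <= M * (1 - t x).
  have /andP[t0 t1] := trapezoid01 L x.
  rewrite /gt -{1}(mul1r (g x)) -mulrBl normrM (@ger0_norm _ (1 - t x)) ?subr_ge0// mulrC.
  by rewrite ler_wpM2r// subr_ge0.
have i1 : `|\int[m]_y g y - \int[m]_y gt y| <= M * (1 - \int[m]_y t y).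
  rewrite -IntB; [|exact: lm gM|exact: lm gtM].
  have -> : M * (1 - \int[m]_y t y) = \int[m]_y (M * (1 - t y)).
    rewrite IntZ; last by apply: L1B; [exact: L1_cst|exact: lm (tM L)].
    by rewrite IntB ?Int_cst//; [exact: L1_cst|exact: lm (tM L)].
  apply: Int_abs_le => //; first by apply: L1B; [exact: lm gM|exact: lm gtM].
  by apply: L1Z; apply: L1B; [exact: L1_cst|exact: lm (tM L)].
have i2 : `|\int[P]_w gt (Z n w) - \int[P]_w g (Z n w)| <= M * (1 - \int[P]_w t (Z n w)).
  rewrite -IntB; [|exact: lP gtM|exact: lP gM].
  have -> : M * (1 - \int[P]_w t (Z n w)) = \int[P]_w (M * (1 - t (Z n w))).
    rewrite IntZ; last by apply: L1B; [exact: L1_cst|exact: lP (tM L)].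
    by rewrite IntB ?Int_cst//; [exact: L1_cst|exact: lP (tM L)].
  apply: Int_abs_le => //; first by apply: L1B; [exact: lP gtM|exact: lP gM].
    by apply: L1Z; apply: L1B; [exact: L1_cst|exact: lP (tM L)].
  by move=> w; rewrite distrC.
have Mn0 : M + 1 != 0 by rewrite gt_eqF//; lra.
have Me : M * (e / (5 * (M + 1))) = e / 5 - e / (5 * (M + 1)) by field.
have b1 : M * (1 - \int[m]_y t y) <= e / 5.
  apply: le_trans (_ : M * (e / (5 * (M + 1))) <= _); first by rewrite ler_wpM2l.
  by rewrite Me; lra.
have b2 : M * (1 - \int[P]_w t (Z n w)) <= 2 * (e / 5).
  apply: le_trans (_ : M * (2 * (e / (5 * (M + 1)))) <= _).
    rewrite ler_wpM2l//; move: h2; rewrite ler_norml => /andP[_ h2].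
    by move: hL; rewrite -/t; lra.
  by rewrite mulrCA Me; lra.
have -> : e = e / 5 + (e / 5 + (2 * (e / 5) + e / 5)) by field.
have i1' := le_trans i1 b1; have i2' := le_trans i2 b2.
apply: le_trans (ler_distD_le i1' (ler_distD_le h1 i2')) _; lra.
Unshelve. all: by end_near. Qed.

End weak_convergence_criterion.

Section convergence_in_probability.
Context d (T : measurableType d) (R : realType) (P : probability T R).
Implicit Types X Y Z : T -> R.

(* Convergence in probability to 0 of Z n is expressed as d0 (Z n) --> 0. *)
Definition d0 Z : R := \int[P]_w Num.min 1 `|Z w|.

Lemma min1_ge0 (x : R) : 0 <= Num.min 1 `|x|.
Proof. by rewrite le_min ler01/=. Qed.

Lemma L1_min1 Z : measurable_fun setT Z -> L1 P (fun w => Num.min 1 `|Z w|).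
Proof.
move=> mZ; apply: (@L1_bnd _ _ _ _ _ 1); first exact: measurable_min1.
by move=> w; rewrite ger0_norm ?min1_ge0// ge_min lexx.
Qed.

Lemma d0_ge0 Z : 0 <= d0 Z.
Proof. by apply: Int_ge0 => w; exact: min1_ge0. Qed.

Lemma d0_ae Z Y : measurable_fun setT Z -> measurable_fun setT Y ->
  {ae P, forall w, Z w = Y w} -> d0 Z = d0 Y.
Proof.
move=> mZ mY ZY; apply: Int_ae_eq; [exact: measurable_min1|exact: measurable_min1|].
by apply: filterS ZY => w ->.
Qed.

Lemma d0D Z Y : measurable_fun setT Z -> measurable_fun setT Y ->
  d0 (fun w => Z w + Y w) <= d0 Z + d0 Y.
Proof.
move=> mZ mY; have lZ := L1_min1 mZ; have lY := L1_min1 mY.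
rewrite /d0 -IntD//; apply: Int_le; [exact/L1_min1/measurable_funD|exact: L1D|].
move=> w; have := ler_normD (Z w) (Y w).
have := normr_ge0 (Z w); have := normr_ge0 (Y w).
by rewrite /Num.min; repeat case: ifPn; rewrite -?leNgt => *; lra.
Qed.

Lemma d0_le_Int Z : L1 P Z -> d0 Z <= \int[P]_w `|Z w|.
Proof.
move=> lZ; apply: Int_le; [exact/L1_min1/L1_measurable/lZ|exact: L1_abs|].
by move=> w; rewrite ge_min lexx orbT.
Qed.

Lemma d0_sqr Z : measurable_fun setT Z -> L1 P (fun w => Z w ^+ 2) ->
  d0 Z ^+ 2 <= \int[P]_w (Z w ^+ 2).
Proof.
move=> mZ lZ; apply: le_trans (Int_abs_sqr_le mZ lZ).
by rewrite lerXn2r ?nnegrE ?d0_ge0 ?Int_ge0//; exact/d0_le_Int/L1_sqr.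
Qed.

(** Where |Z| <= L the factor Z costs at most L; the rest is Chebyshev's inequality. *)
Lemma d0_prod Z Y L : 1 <= L -> measurable_fun setT Z -> measurable_fun setT Y ->
  L1 P (fun w => Z w ^+ 2) ->
  d0 (fun w => Z w * Y w) <= L * d0 Y + (\int[P]_w (Z w ^+ 2)) / L ^+ 2.
Proof.
move=> L1' mZ mY lZ; have L0 : 0 < L by lra.
rewrite -IntZ; last exact: L1_min1.
rewrite -IntZr// -IntD; [|exact/L1Z/L1_min1|exact: L1Zr].
apply: Int_le; first exact/L1_min1/measurable_funM.
  by apply: L1D; [exact/L1Z/L1_min1|exact: L1Zr].
move=> w; have [ZL|ZL] := leP `|Z w| L.
  apply: (@le_trans _ _ (L * Num.min 1 `|Y w|)).
    rewrite normrM minr_pMr ?(ltW L0)// mulr1 le_min !ge_min L1'/=.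
    by rewrite ler_wpM2r ?orbT.
  by rewrite lerDl divr_ge0 ?sqr_ge0.
apply: (@le_trans _ _ 1); first by rewrite ge_min lexx.
apply: ler_wpDl; first by rewrite mulr_ge0 ?min1_ge0// ltW.
rewrite ler_pdivlMr ?exprn_gt0// mul1r -(real_normK (num_real (Z w))).
by rewrite lerXn2r ?nnegrE ?(ltW ZL)// ltW.
Qed.

Lemma cvg0_le (u v : nat -> R) : (forall n, 0 <= u n) ->
  (\forall n \near \oo, u n <= v n) -> v n @[n --> \oo] --> 0 ->
  u n @[n --> \oo] --> 0.
Proof.
move=> u0 uv v0; apply: squeeze_cvgr (cvg_cst 0) v0.
by apply: filterS uv => n uvn; rewrite u0.
Qed.

Lemma cvg0_abs_le (u v : nat -> R) :
  (\forall n \near \oo, `|u n| <= v n) -> v n @[n --> \oo] --> 0 ->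
  u n @[n --> \oo] --> 0.
Proof.
move=> uv /cvgr0Pnorm_le v0; apply/cvgr0Pnorm_le => e e0.
apply: filterS2 uv (v0 _ e0) => n h1 h2.
exact: le_trans (le_trans h1 (ler_norm _)) h2.
Qed.

(** Boundedness in L^2 gives tightness of [Z n]. The level L below is chosen with e L = e + 2 K,
    which makes K / L^2 at most e/2. *)
Lemma cvg_d0_prod (Z Y : nat -> T -> R) (K : R) :
  (forall n, measurable_fun setT (Z n)) -> (forall n, measurable_fun setT (Y n)) ->
  (forall n, L1 P (fun w => Z n w ^+ 2)) ->
  (\forall n \near \oo, \int[P]_w (Z n w ^+ 2) <= K) -> d0 (Y n) @[n --> \oo] --> 0 ->
  d0 (fun w => Z n w * Y n w) @[n --> \oo] --> 0.
Proof.
move=> mZ mY lZ ZK Y0.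
have K0 : 0 <= K.
  by have [N _ /(_ N (leqnn _))] := ZK; apply: le_trans; apply: Int_ge0 => w; exact: sqr_ge0.
apply/cvgr0Pnorm_le => e e0.
pose L := 1 + 2 * K / e.
have Ke : 0 <= 2 * K / e by rewrite divr_ge0 ?mulr_ge0 ?(ltW e0).
have L1' : 1 <= L by rewrite /L; lra.
have L0 : 0 < L by lra.
have eL : 0 < e / (2 * L) by rewrite divr_gt0// mulr_gt0.
move/cvgr0Pnorm_le : Y0 => /(_ _ eL); apply: filterS2 ZK => n ZK.
rewrite !ger0_norm ?d0_ge0// => hY.
apply: le_trans (d0_prod L1' (mZ n) (mY n) (lZ n)) _.
have h1 : L * d0 (Y n) <= e / 2.
  by move: hY; rewrite ler_pdivlMr ?mulr_gt0//; lra.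
have h2 : (\int[P]_w (Z n w ^+ 2)) / L ^+ 2 <= e / 2.
  rewrite ler_pdivrMr ?exprn_gt0//; apply: le_trans ZK _.
  have eLK : e * L = e + 2 * K by rewrite /L; field; rewrite gt_eqF.
  have : e / 2 * L <= e / 2 * L ^+ 2 by rewrite ler_pM2l ?divr_gt0// expr2 ler_peMl// ltW.
  by lra.
lra.
Qed.

(** Pointwise, |g(Z) - g(Y)| <= e/2 + c min(1, |Z - Y|), with c = 2 M / min(1, dl) covering the case
    of a large difference. *)
Lemma cvg_unif_cont_d0 (Z Y : nat -> T -> R) (g : R -> R) (M : R) :
  (forall n, measurable_fun setT (Z n)) -> (forall n, measurable_fun setT (Y n)) ->
  measurable_fun setT g -> (forall x, `|g x| <= M) -> unif_cont g ->
  d0 (fun w => Z n w - Y n w) @[n --> \oo] --> 0 ->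
  \int[P]_w g (Z n w) - \int[P]_w g (Y n w) @[n --> \oo] --> 0.
Proof.
move=> mZ mY mg gM ug ZY.
have M0 : 0 <= M by exact: le_trans (gM 0).
have lg (X : nat -> T -> R) n : (forall n, measurable_fun setT (X n)) -> L1 P (fun w => g (X n w)).
  by move=> mX; apply: (@L1_bnd _ _ _ _ _ M) => //; exact: measurableT_comp.
apply/cvgr0Pnorm_le => e e0; have e2 : 0 < e / 2 by rewrite divr_gt0.
have [dl dl0 hdl] := ug _ e2.
pose r := Num.min 1 dl; have r0 : 0 < r by rewrite lt_min ltr01.
pose c := 2 * M / r; have c0 : 0 <= c by rewrite divr_ge0 ?mulr_ge0 ?(ltW r0).
have ec : 0 < e / 2 / (c + 1) by rewrite divr_gt0//; lra.
move/cvgr0Pnorm_le : ZY => /(_ _ ec); apply: filterS => n.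
rewrite ger0_norm ?d0_ge0// ler_pdivlMr; last by lra.
move=> hn; rewrite -IntB//; [|exact: lg|exact: lg].
have mZY := measurable_funB (mZ n) (mY n).
apply: le_trans (_ : \int[P]_w (e / 2 + c * Num.min 1 `|Z n w - Y n w|) <= _).
  apply: Int_abs_le.
  - by apply: L1B; exact: lg.
  - by apply: L1D; [exact: L1_cst|exact/L1Z/L1_min1].
  move=> w; have [h|/ltW h] := leP `|Z n w - Y n w| dl.
    by apply: le_trans (hdl _ _ h) _; rewrite lerDl mulr_ge0// min1_ge0.
  apply: ler_wpDl; first exact: ltW.
  apply: le_trans (_ : 2 * M <= _).
    by apply: le_trans (ler_normB _ _) _; have := gM (Z n w); have := gM (Y n w); lra.
  have -> : 2 * M = c * r by rewrite /c; field; rewrite gt_eqF.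
  by rewrite ler_wpM2l// /r le_min !ge_min lexx/= h orbT.
rewrite IntD; [|exact: L1_cst|exact/L1Z/L1_min1].
rewrite Int_cst IntZ; last exact: L1_min1.
have := d0_ge0 (fun w => Z n w - Y n w); rewrite /d0 in hn *.
by lra.
Qed.

End convergence_in_probability.

(** * A central limit theorem for martingale difference arrays *)

Section martingale_clt.
Context d (T : measurableType d) (R : realType) (P : probability T R).
Variables (G : nat -> set (set T)) (xi W : nat -> nat -> T -> R) (s2 : R) (eta : nat -> R).
Hypothesis subG : forall k, <<s G k>> `<=` measurable.
Hypothesis monoG : forall j k, (j <= k)%N -> <<s G j>> `<=` <<s G k>>.
Hypothesis xi_adapted : forall n j k, (j < k)%N -> gmeas (G k) (xi n j).
Hypothesis W_predictable : forall n k, gmeas (G k) (W n k).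
Hypothesis W_bnd : forall n k w, 0 <= W n k w <= eta n.
Hypothesis xi2 : forall n k, L1 P (fun w => xi n k w ^+ 2).
Hypothesis xi_mart : forall n k U M, gmeas (G k) U -> (forall w, `|U w| <= M) ->
  \int[P]_w (U w * xi n k w) = 0.
Hypothesis xi_var : forall n k U M, gmeas (G k) U -> (forall w, `|U w| <= M) ->
  \int[P]_w (U w * xi n k w ^+ 2) = \int[P]_w (U w * W n k w).
Hypothesis s20 : 0 <= s2.
Hypothesis eta0 : eta n @[n --> \oo] --> 0.
Hypothesis lindeberg :
  \sum_(k < n) \int[P]_w Num.min (xi n k w ^+ 2) (`|xi n k w| ^+ 3)
    @[n --> \oo] --> 0.
Hypothesis variance :
  d0 P (fun w => \sum_(k < n) W n k w - s2) @[n --> \oo] --> 0.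

(** For fixed b and a the constants of [martingale_heat] do not depend on n, so the hypotheses on
    eta, on the truncated cubes and on the variances give convergence of every heat transform. *)
Lemma martingale_clt (g : R -> R) (M : R) : measurable_fun setT g ->
  (forall x, `|g x| <= M) -> unif_cont g ->
  \int[P]_w g (\sum_(k < n) xi n k w) @[n --> \oo] --> \int[centered_normal s2]_y g y.
Proof.
have mS n : measurable_fun setT (fun w => \sum_(k < n) xi n k w).
  apply: measurable_sum => k.
  by have h := @xi_adapted n _ _ (ltnSn k); exact: gmeas_measurable (@subG _) h.
move=> mg gM ug; apply: (weak_cvg_unif_cont mS s20 _ mg gM ug).
move=> b a b0; have b20 : 0 < b / 2 by rewrite divr_gt0.
have [C hC] := heat_step b20.
apply/subr_cvg0; apply: (@cvg0_abs_le _ _ (fun n => C * (\sum_(k < n) \int[P]_w Num.min (xi n k w ^+ 2) (`|xi n k w| ^+ 3) +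
  eta n * (s2 + b / 2) + (2 + 4 / b) * d0 P (fun w => \sum_(k < n) W n k w - s2)))).
  apply: nearW => n.
  exact: (martingale_heat a subG monoG (@xi_adapted n) (@W_predictable n)
    (@W_bnd n) (@xi2 n) (@xi_mart n) (@xi_var n) b0 s20 hC n).
have z0 : C * (0 + 0 * (s2 + b / 2) + (2 + 4 / b) * 0) = 0 by ring.
rewrite -[X in _ --> X]z0.
apply: cvgM; first exact: cvg_cst.
apply: cvgD; first by apply: cvgD; [exact: lindeberg|apply: cvgM; [exact: eta0|exact: cvg_cst]].
by apply: cvgM; [exact: cvg_cst|exact: variance].
Qed.

End martingale_clt.

(** * Conditional expectations and densities *)

Lemma indic_bnd {T : Type} {R : realType} (A : set T) w : `|\1_A w : R| <= 1.
Proof. by rewrite indicE; case: (_ \in _); rewrite ?normr1 ?normr0. Qed.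

Section lebesgue_joint.
Context d (T : measurableType d) (R : realType) (P : probability T R).
Notation mu := (@lebesgue_measure R).

Lemma L1_bndM_leb (g f : R -> R) (M : R) : measurable_fun setT g ->
  (forall y, `|g y| <= M) -> L1 mu f -> L1 mu (fun y => g y * f y).
Proof. by move=> mg gM lf; apply: (@L1_bndM _ _ _ _ _ _ M). Qed.

Lemma L1_bndM_joint (u f : T * R -> R) (M : R) : measurable_fun setT u ->
  (forall z, `|u z| <= M) -> L1 (P \x mu)%E f ->
  L1 (P \x mu)%E (fun z => u z * f z).
Proof. by move=> mg gM lf; apply: (@L1_bndM _ _ _ _ _ _ M). Qed.

Lemma tonelli_joint (u : T * R -> \bar R) : measurable_fun setT u ->
  (forall z, (0 <= u z)%E) ->
  (\int[(P \x mu)%E]_z u z = \int[P]_w \int[mu]_y u (w, y))%E.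
Proof. by move=> mu_ u0; rewrite (@fubini_tonelli1 _ _ _ _ R P mu u). Qed.

End lebesgue_joint.

Section conditional.
Context d (T : measurableType d) (R : realType) (P : probability T R).
Notation mu := (@lebesgue_measure R).
Implicit Types (Z W U : T -> R).

Lemma Int_eq0_ae Z : L1 P Z -> (forall w, 0 <= Z w) -> \int[P]_w Z w <= 0 ->
  {ae P, forall w, Z w = 0}.
Proof.
move=> lZ Z0 iZ.
have h : (\int[P]_(w in setT) `|(Z w)%:E| = 0)%E.
  under eq_integral do rewrite gee0_abs ?lee_fin//.
  rewrite -(IntE lZ); congr EFin; apply/eqP; rewrite eq_le iZ/=.
  exact: Int_ge0.
have mZ : measurable_fun setT (EFin \o Z) by exact/measurable_EFinP/L1_measurable/lZ.
have := (@ae_eq_integral_abs _ _ _ P setT measurableT _ mZ).1 h.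
by apply: filterS => w /(_ I)[].
Qed.

Lemma Int_indic A Z : \int[P]_w (\1_A w * Z w) = \int[P]_(w in A) Z w.
Proof.
rewrite [RHS]Rintegral_mkcond; apply: eq_Int => w.
by rewrite /patch indicE; case: (w \in A); rewrite ?mul1r ?mul0r.
Qed.

(** Test on the set where W < Z, which lies in the sub-sigma-algebra: there Z - W is positive, yet
    its integral is at most 0. *)
Lemma cond_le (G : set (set T)) Z W : <<s G>> `<=` measurable ->
  gmeas G Z -> gmeas G W -> L1 P Z -> L1 P W ->
  (forall A, <<s G>> A -> \int[P]_w (\1_A w * Z w) <= \int[P]_w (\1_A w * W w)) ->
  {ae P, forall w, Z w <= W w}.
Proof.
move=> subG gZ gW lZ lW h.
pose A := [set w | W w < Z w].
have gA : <<s G>> A.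
  apply: (@measurable_bool_set _ (g_sigma_algebraType G) (fun w => W w < Z w)).
  exact: measurable_fun_ltr.
have mA := subG _ gA.
have mI : measurable_fun setT (\1_A : T -> R) by exact: measurable_indic.
have lAZ : L1 P (fun w => \1_A w * Z w) by exact: (L1_bndM mI (indic_bnd A) lZ).
have lAW : L1 P (fun w => \1_A w * W w) by exact: (L1_bndM mI (indic_bnd A) lW).
have := @Int_eq0_ae (fun w => \1_A w * Z w - \1_A w * W w).
case.
- exact: L1B.
- move=> w; rewrite -mulrBr indicE; have [|_] := boolP (w \in A).
    by rewrite inE /A/= => ?; rewrite mul1r; lra.
  by rewrite mul0r.
- by rewrite IntB// subr_le0; exact: h.
move=> N [mN PN hN]; exists N; split => // w /= hw; apply: hN => /=.
rewrite -mulrBr indicE => /eqP; move/negP: hw; rewrite -ltNge => hw.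
by rewrite mem_set// mul1r subr_eq0 gt_eqF.
Qed.

(** [bounded_extension] on the space carrying the sub-sigma-algebra; its sup-norm constant is the
    sum of the two L^1 norms. *)
Lemma cond_exp_bounded (G : set (set T)) Z W : <<s G>> `<=` measurable ->
  is_cond_exp P G Z W ->
  forall U M, gmeas G U -> (forall w, `|U w| <= M) ->
  \int[P]_w (U w * Z w) = \int[P]_w (U w * W w).
Proof.
move=> subG [lZ lW _ hA] U M gU UM; apply/eqP; rewrite -subr_eq0; apply/eqP.
have lb Y V : L1 P Y -> gmeas G V -> (exists N : R, forall w, `|V w| <= N) ->
    L1 P (fun w => V w * Y w).
  by move=> lY gV [N VN]; exact: (L1_bndM (gmeas_measurable subG gV) VN lY).
apply: (@bounded_extension _ (g_sigma_algebraType G) R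
  (fun U : T -> R => \int[P]_w (U w * Z w) - \int[P]_w (U w * W w))
  (\int[P]_w `|Z w| + \int[P]_w `|W w|) _ _ _ U M gU UM).
- move=> A mA; rewrite !Int_indic.
  by rewrite /Rintegral hA// subrr.
- move=> c V V' gV gV' bV bV'.
  transitivity ((c * \int[P]_w (V w * Z w) + \int[P]_w (V' w * Z w)) -
    (c * \int[P]_w (V w * W w) + \int[P]_w (V' w * W w))); last by ring.
  rewrite -!IntZ; [|exact: lb|exact: lb].
  rewrite -!IntD; [|exact/L1Z/lb|exact: lb|exact/L1Z/lb|exact: lb].
  by congr (_ - _); apply: eq_Int => w; ring.
- move=> V e gV Ve; rewrite mulrDl (le_trans (ler_normB _ _))//.
  have bV : exists N : R, forall w, `|V w| <= N by exists e.
  rewrite lerD// mulrC -IntZ; try exact: L1_abs.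
    apply: Int_abs_le; [exact: lb|exact/L1Z/L1_abs|move=> w].
    by rewrite normrM ler_wpM2r.
  apply: Int_abs_le; [exact: lb|exact/L1Z/L1_abs|move=> w].
  by rewrite normrM ler_wpM2r.
Qed.

End conditional.

Section conditional_density.
Context d (T : measurableType d) (R : realType) (P : probability T R).
Notation mu := (@lebesgue_measure R).
Variables (G : set (set T)) (X : T -> R) (q : T -> R -> R).
Hypothesis subG : <<s G>> `<=` measurable.
Hypothesis mX : measurable_fun setT X.
Hypothesis mq : measurable_fun setT
  ((fun z => q z.1 z.2) : g_sigma_algebraType G * R -> R).
Hypothesis q0 : forall w y, 0 <= q w y.
Hypothesis hq : forall A B, <<s G>> A -> measurable B ->
  P (A `&` X @^-1` B) = (\int[P]_(w in A) \int[mu]_(y in B) (q w y)%:E)%E.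

Let mid : measurable_fun setT (id : T -> g_sigma_algebraType G).
Proof. by move=> _ B mB; rewrite setTI; exact: subG. Qed.

(** The identity from T to T with the smaller sigma-algebra is measurable. *)
Lemma cd_measurable : measurable_fun setT (fun z : T * R => q z.1 z.2).
Proof.
have mp : measurable_fun setT (fun z : T * R => (id z.1 : g_sigma_algebraType G, z.2)).
  apply: measurable_fun_pair; last exact: measurable_snd.
  have h : measurable_fun setT (fun z : T * R => id z.1 : g_sigma_algebraType G).
    exact: (measurableT_comp mid).
  exact: h.
exact: (measurableT_comp mq mp).
Qed.

Let mqE : measurable_fun setT (fun z : T * R => (q z.1 z.2)%:E).
Proof. by apply/measurable_EFinP; exact: cd_measurable. Qed.

Let qE0 (z : T * R) : (0 <= (q z.1 z.2)%:E)%E. Proof. by rewrite lee_fin. Qed.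

(** By Tonelli the integral is the total mass of P, the case of [hq] where A and B are the whole
    spaces. *)
Lemma cd_L1 : L1 (P \x mu)%E (fun z : T * R => q z.1 z.2).
Proof.
apply/integrableP; split => //.
under eq_integral do rewrite gee0_abs ?lee_fin//.
rewrite (tonelli_joint P mqE qE0).
have := @hq setT setT.
rewrite preimage_setT setTI probability_setT => <- //; first by rewrite ltry.
exact: (@measurableT _ (g_sigma_algebraType G)).
Qed.

Let lprod (u : T * R -> R) : measurable_fun setT u -> (exists M : R, forall z, `|u z| <= M) ->
  L1 (P \x mu)%E (fun z => u z * q z.1 z.2).
Proof. by move=> mu_ [M uM]; exact: (L1_bndM_joint mu_ uM cd_L1). Qed.

Let mfst U : measurable_fun setT U -> measurable_fun setT (fun z : T * R => U z.1 : R).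
Proof. by move=> mU; exact: measurableT_comp. Qed.

Let msnd (g : R -> R) : measurable_fun setT g -> measurable_fun setT (fun z : T * R => g z.2).
Proof. by move=> mg; exact: measurableT_comp. Qed.

Let base A B : <<s G>> A -> measurable B ->
  \int[P]_w (\1_A w * \1_B (X w)) =
  \int[(P \x mu)%E]_z (\1_A z.1 * \1_B z.2 * q z.1 z.2).
Proof.
move=> gA mB; have mA := subG gA; rewrite /Rintegral; congr fine.
have mXB : measurable (X @^-1` B) by rewrite -[X in measurable X]setTI; exact: mX.
transitivity (P (A `&` X @^-1` B)).
  rewrite -[A `&` X @^-1` B](setIT _) -integral_indic//; last exact: measurableI.
  apply: eq_integral => w _; congr EFin.
  by rewrite !indicE -natrM mulnb in_setI; congr ((_ && _)%:R); apply/idP/idP; rewrite !inE.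
rewrite (hq gA mB).
have mfull : measurable_fun setT (fun z : T * R => (\1_A z.1 * \1_B z.2 * q z.1 z.2)%:E).
  apply/measurable_EFinP; apply: measurable_funM; last exact: cd_measurable.
  by apply: measurable_funM; [apply: mfst; exact: measurable_indic|apply: msnd; exact: measurable_indic].
rewrite (tonelli_joint P mfull); last first.
  by move=> z; rewrite lee_fin mulr_ge0// mulr_ge0.
rewrite integral_mkcond; apply: eq_integral => w _; rewrite /patch/=.
have [wA|wA] := boolP (w \in A).
  rewrite integral_mkcond; apply: eq_integral => y _; rewrite /patch [\1_A w]indicE wA mul1r indicE.
  by case: (y \in B); rewrite ?mul1r ?mul0r.
by rewrite integral0_eq// => y _; rewrite [\1_A w]indicE (negbTE wA) !mul0r.
Qed.

Let q_int := \int[(P \x mu)%E]_z q z.1 z.2.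

Let prod_bnd (u : T * R -> R) e : measurable_fun setT u -> (forall z, `|u z| <= e) ->
  `|\int[(P \x mu)%E]_z (u z * q z.1 z.2)| <= e * q_int.
Proof.
move=> mu_ ue; rewrite -IntZ; last exact: cd_L1.
apply: Int_abs_le; [by apply: lprod => //; exists e|exact/L1Z/cd_L1|].
by move=> z; rewrite normrM (ger0_norm (q0 _ _)) ler_wpM2r.
Qed.

Let expect_indic A (g : R -> R) M : <<s G>> A -> measurable_fun setT g ->
  (forall y, `|g y| <= M) ->
  \int[P]_w (\1_A w * g (X w)) = \int[(P \x mu)%E]_z (\1_A z.1 * g z.2 * q z.1 z.2).
Proof.
move=> gA mg gM; have mA := subG gA; apply/eqP; rewrite -subr_eq0; apply/eqP.
have mI : measurable_fun setT (\1_A : T -> R) by exact: measurable_indic.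
have lX (u : R -> R) : measurable_fun setT u -> (exists M : R, forall x, `|u x| <= M) ->
    L1 P (fun w => \1_A w * u (X w)).
  move=> mu_ [N uN]; apply: (L1_bndM mI (indic_bnd A)).
  by apply: (@L1_bnd _ _ _ _ _ N) => //; exact: measurableT_comp.
have b1 (u : R -> R) N w : (forall x, `|u x| <= N) -> `|\1_A w * u (X w)| <= N.
  by move=> uN; rewrite normrM -[leRHS]mul1r ler_pM// indic_bnd.
have b2 (u : R -> R) N (z : T * R) : (forall x, `|u x| <= N) -> `|\1_A z.1 * u z.2| <= N.
  by move=> uN; rewrite normrM -[leRHS]mul1r ler_pM// indic_bnd.
have mZ (u : R -> R) : measurable_fun setT u -> measurable_fun setT (fun z : T * R => \1_A z.1 * u z.2).
  by move=> mu_; apply: measurable_funM; [exact: mfst|exact: msnd].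
have lZ (u : R -> R) : measurable_fun setT u -> (exists M : R, forall x, `|u x| <= M) ->
    L1 (P \x mu)%E (fun z : T * R => \1_A z.1 * u z.2 * q z.1 z.2).
  move=> mu_ [N uN]; apply: (lprod (mZ _ mu_)); exists N => z; exact: b2.
apply: (@bounded_extension _ R R (fun u : R -> R => \int[P]_w (\1_A w * u (X w)) -
   \int[(P \x mu)%E]_z (\1_A z.1 * u z.2 * q z.1 z.2)) (1 + q_int) _ _ _ g M mg gM).
- by move=> B mB; rewrite base// subrr.
- move=> c U V mU mV bU bV.
  transitivity ((c * \int[P]_w (\1_A w * U (X w)) + \int[P]_w (\1_A w * V (X w))) -
     (c * \int[(P \x mu)%E]_z (\1_A z.1 * U z.2 * q z.1 z.2) +
      \int[(P \x mu)%E]_z (\1_A z.1 * V z.2 * q z.1 z.2))); last by ring.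
  rewrite -IntZ; last exact: lX.
  rewrite -IntD; [|exact/L1Z/lX|exact: lX].
  rewrite -IntZ; last exact: lZ.
  rewrite -IntD; [|exact/L1Z/lZ|exact: lZ].
  by congr (_ - _); apply: eq_Int => w; ring.
- move=> U e mU Ue; rewrite mulrDl mul1r (le_trans (ler_normB _ _))// lerD//.
    by apply: Int_bnd; [apply: lX => //; exists e|move=> w; exact: b1].
  by rewrite mulrC; apply: prod_bnd; [exact: mZ|move=> z; exact: b2].
Qed.

(** [bounded_extension] a second time: [expect_indic] passes from indicators of B to bounded g with
    A fixed, and here A gives way to a bounded U. *)
Lemma cd_expect U M (g : R -> R) N : gmeas G U -> (forall w, `|U w| <= M) ->
  measurable_fun setT g -> (forall y, `|g y| <= N) ->
  \int[P]_w (U w * g (X w)) = \int[(P \x mu)%E]_z (U z.1 * g z.2 * q z.1 z.2).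
Proof.
move=> gU UM mg gN; apply/eqP; rewrite -subr_eq0; apply/eqP.
have N0 : 0 <= N by exact: le_trans (gN 0).
have mgX : measurable_fun setT (fun w => g (X w)) by exact: measurableT_comp.
have mT_ (V : T -> R) : gmeas G V -> measurable_fun setT V by exact: gmeas_measurable.
have lgX : L1 P (fun w => g (X w)) by exact: (L1_bnd P mgX (fun w => gN (X w))).
have lX V : gmeas G V -> (exists M : R, forall x, `|V x| <= M) ->
    L1 P (fun w => V w * g (X w)).
  by move=> gV [K VK]; exact: (L1_bndM (mT_ _ gV) VK lgX).
have mZ V : gmeas G V -> measurable_fun setT (fun z : T * R => V z.1 * g z.2).
  by move=> gV; apply: measurable_funM; [apply: mfst; exact: mT_|exact: msnd].
have b2 V K (z : T * R) : (forall w, `|V w| <= K) -> `|V z.1 * g z.2| <= K * N.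
  by move=> VK; rewrite normrM ler_pM.
have lZ V : gmeas G V -> (exists M : R, forall x, `|V x| <= M) ->
    L1 (P \x mu)%E (fun z : T * R => V z.1 * g z.2 * q z.1 z.2).
  by move=> gV [K VK]; apply: (lprod (mZ _ gV)); exists (K * N) => z; exact: b2.
apply: (@bounded_extension _ (g_sigma_algebraType G) R (fun V : T -> R => \int[P]_w (V w * g (X w)) -
   \int[(P \x mu)%E]_z (V z.1 * g z.2 * q z.1 z.2)) (N + N * q_int) _ _ _ U M gU UM).
- by move=> A mA; rewrite (@expect_indic A g N)// subrr.
- move=> c V V' gV gV' bV bV'.
  transitivity ((c * \int[P]_w (V w * g (X w)) + \int[P]_w (V' w * g (X w))) -
     (c * \int[(P \x mu)%E]_z (V z.1 * g z.2 * q z.1 z.2) +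
      \int[(P \x mu)%E]_z (V' z.1 * g z.2 * q z.1 z.2))); last by ring.
  rewrite -IntZ; last exact: lX.
  rewrite -IntD; [|exact/L1Z/lX|exact: lX].
  rewrite -IntZ; last exact: lZ.
  rewrite -IntD; [|exact/L1Z/lZ|exact: lZ].
  by congr (_ - _); apply: eq_Int => w; ring.
- move=> V e gV Ve.
  have -> : (N + N * q_int) * e = N * e + e * N * q_int by ring.
  rewrite (le_trans (ler_normB _ _))// lerD//.
    apply: Int_bnd; first by apply: lX => //; exists e.
    by move=> w; rewrite normrM mulrC ler_pM.
  by apply: prod_bnd; [exact: mZ|move=> z; exact: b2].
Qed.

(** A version of E(g(X) | G) for bounded g. *)
Definition cmean (g : R -> R) (w : T) : R := \int[mu]_y (g y * q w y).

Lemma cd_slice_L1 : {ae P, forall w, L1 mu (q w)}.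
Proof. exact: (ae_integrable1 cd_L1). Qed.

(** Tonelli's measurability, for the sub-sigma-algebra, of the integrals of the positive and
    negative parts. *)
Lemma gmeas_cmean (g : R -> R) : measurable_fun setT g -> gmeas G (cmean g).
Proof.
move=> mg; pose h := fun z : g_sigma_algebraType G * R => (g z.2 * q z.1 z.2)%:E.
have mh : measurable_fun setT h.
  apply/measurable_EFinP; apply: measurable_funM => //.
  exact: (@measurableT_comp _ _ _ _ _ _ g).
rewrite /gmeas /cmean /Rintegral; apply: measurableT_comp => //.
have -> : (fun w : g_sigma_algebraType G => \int[mu]_y (g y * q w y)%:E)%E =
    (fun w => \int[mu]_y (h^\+%E (w, y)) - \int[mu]_y (h^\-%E (w, y)))%E.
  apply/funext => w; rewrite [LHS]integralE. congr (_ - _)%E; apply: eq_integral => y _. by rewrite ?funeposE. by rewrite ?funenegE.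
apply: emeasurable_funB.
  by apply: (@measurable_fun_fubini_tonelli_F _ _ _ _ R mu (h^\+)%E) => //; exact: measurable_funepos.
by apply: (@measurable_fun_fubini_tonelli_F _ _ _ _ R mu (h^\-)%E) => //; exact: measurable_funeneg.
Qed.

(** Fubini for [cd_expect]. A slice [q w] is known to be integrable only for almost every w, so U is
    moved across the inner integral off a null set. *)
Lemma cd_cmean U M (g : R -> R) N : gmeas G U -> (forall w, `|U w| <= M) ->
  measurable_fun setT g -> (forall y, `|g y| <= N) ->
  L1 P (fun w => U w * cmean g w) /\
  \int[P]_w (U w * g (X w)) = \int[P]_w (U w * cmean g w).
Proof.
move=> gU UM mg gN; rewrite (cd_expect gU UM mg gN).
have mU := gmeas_measurable subG gU.
have l : L1 (P \x mu)%E (fun z : T * R => U z.1 * g z.2 * q z.1 z.2).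
  apply: lprod; first by apply: measurable_funM; [exact: mfst|exact: msnd].
  by exists (M * N) => z; rewrite normrM ler_pM.
have mcm : measurable_fun setT (fun w => U w * cmean g w).
  by apply: measurable_funM => //; apply: (gmeas_measurable subG); exact: gmeas_cmean.
have ae_in : {ae P, forall w, (U w * cmean g w)%:E =
    (\int[mu]_y (U w * g y * q w y)%:E)%E}.
  apply: filterS cd_slice_L1 => w lq.
  have lgq : L1 mu (fun y => g y * q w y) by exact: (L1_bndM_leb mg gN lq).
  rewrite /cmean -IntZ// (IntE (L1Z (U w) lgq)).
  by apply: eq_integral => y _; rewrite mulrA.
have mF : P.-integrable setT (fun w => (\int[mu]_y (U w * g y * q w y)%:E)%E).
  exact: (integrable_fubini_F l).
split.
  apply/integrableP; split; first exact/measurable_EFinP.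
  case/integrableP : mF => mF; apply: le_lt_trans.
  rewrite le_eqVlt; apply/orP; left; apply/eqP; apply: ae_eq_integral => //.
  - by apply: measurableT_comp => //; exact/measurable_EFinP.
  - exact: measurableT_comp.
  - by apply: filterS ae_in => w /= <-.
rewrite /Rintegral -(integral12_prod_meas1 l); congr fine.
apply: ae_eq_integral => //; [exact: measurable_int mF|exact/measurable_EFinP|].
by apply: filterS ae_in => w /= ->.
Qed.

(** [cond_le] against the constants N and - N. *)
Lemma cmean_bnd (g : R -> R) N : measurable_fun setT g -> (forall y, `|g y| <= N) ->
  {ae P, forall w, `|cmean g w| <= N}.
Proof.
move=> mg gN; have gc := gmeas_cmean mg.
have g1 : gmeas G (cst 1 : T -> R) by exact: (@measurable_cst _ _ (g_sigma_algebraType G)).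
have b1 (w : T) : `|cst 1 w : R| <= 1 by rewrite normr1.
have [lc _] := cd_cmean g1 b1 mg gN.
have {}lc : L1 P (cmean g) by apply: eq_integrable lc => // w _ /=; rewrite mul1r.
have mgX : measurable_fun setT (fun w => g (X w)) by exact: measurableT_comp.
have lgX : L1 P (fun w => g (X w)) by exact: (L1_bnd P mgX (fun w => gN (X w))).
have gcst_ c : gmeas G (cst c : T -> R) by exact: (@measurable_cst _ _ (g_sigma_algebraType G)).
have ind A : <<s G>> A -> gmeas G (\1_A : T -> R).
  move=> gA; exact: (@measurable_indic _ (g_sigma_algebraType G)).
have mind A : <<s G>> A -> measurable_fun setT (\1_A : T -> R).
  by move=> gA; exact: (gmeas_measurable subG (ind _ gA)).
have up : {ae P, forall w, cmean g w <= N}.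
  apply: (cond_le subG gc (gcst_ N) lc (L1_cst _ _)) => A gA.
  have [_ <-] := cd_cmean (ind _ gA) (indic_bnd A) mg gN.
  apply: Int_le; [exact: (L1_bndM (mind _ gA) (indic_bnd A) lgX)|exact: (L1_bndM (mind _ gA) (indic_bnd A) (L1_cst _ _))|].
  by move=> w; rewrite ler_wpM2l// (le_trans (ler_norm _)).
have lo : {ae P, forall w, - N <= cmean g w}.
  apply: (cond_le subG (gcst_ (- N)) gc (L1_cst _ _) lc) => A gA.
  have [_ <-] := cd_cmean (ind _ gA) (indic_bnd A) mg gN.
  apply: Int_le; [exact: (L1_bndM (mind _ gA) (indic_bnd A) (L1_cst _ _))|exact: (L1_bndM (mind _ gA) (indic_bnd A) lgX)|].
  by move=> w; rewrite ler_wpM2l// lerNl (le_trans (ler_norm _))// normrN.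
by apply: filterS2 up lo => w h1 h2; rewrite ler_norml h2.
Qed.

End conditional_density.

(** * Averages of functions of the process *)

Section average_of_densities.
Context d (T : measurableType d) (R : realType) (P : probability T R).
Notation mu := (@lebesgue_measure R).
Variables (F : nat -> set (set T)) (X : nat -> T -> R) (q : nat -> T -> R -> R).
Variable (f : R -> R).
Hypothesis subF : forall k, <<s F k>> `<=` measurable.
Hypothesis monoF : forall j k, (j <= k)%N -> <<s F j>> `<=` <<s F k>>.
Hypothesis X_adapted : forall j k, (j < k)%N -> gmeas (F k) (X j).
Hypothesis mq : forall k, measurable_fun setT
  ((fun z => q k z.1 z.2) : g_sigma_algebraType (F k) * R -> R).
Hypothesis q0 : forall k w y, 0 <= q k w y.
Hypothesis hq : forall k A B, <<s F k>> A -> measurable B ->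
  P (A `&` X k @^-1` B) = (\int[P]_(w in A) \int[mu]_(y in B) (q k w y)%:E)%E.
Hypothesis f0 : forall y, 0 <= f y.
Hypothesis lf : L1 mu f.
Hypothesis hf : forall k B, measurable B ->
  P (X k @^-1` B) = (\int[mu]_(y in B) (f y)%:E)%E.

Let cm k g := cmean (q k) g.

Let mX k : measurable_fun setT (X k).
Proof. by have h := @X_adapted _ _ (ltnSn k); exact: gmeas_measurable (@subF _) h. Qed.

Lemma expect_X k (g : R -> R) M : measurable_fun setT g -> (forall y, `|g y| <= M) ->
  \int[P]_w g (X k w) = \int[mu]_y (g y * f y).
Proof.
move=> mg gM.
exact: (@density_expectation _ _ T (measurableTypeR R) R P mu (X k) f (@mX k) lf f0 (@hf k) g M mg gM).
Qed.

Section fixed_kernel.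
Variables (g : R -> R) (N : R).
Hypothesis mg : measurable_fun setT g.
Hypothesis gN : forall y, `|g y| <= N.

Let N0 : 0 <= N. Proof. exact: le_trans (gN 0). Qed.

(** [cm k g] is bounded only off a null set, whereas test variables must be bounded everywhere;
    clipping gives a version that qualifies. *)
Let clip k w := Num.max (- N) (Num.min N (cm k g w)).

Let clip_bnd k w : `|clip k w| <= N.
Proof.
rewrite ler_norml /clip le_max lexx/= ge_max ge_min lexx/= andbT.
by have := N0; lra.
Qed.

Let clip_ae k : {ae P, forall w, clip k w = cm k g w}.
Proof.
have := cmean_bnd (@subF k) (@mX k) (@mq k) (@q0 k) (@hq k) mg gN.
apply: filterS => w; rewrite ler_norml => /andP[h1 h2].
by rewrite /clip (min_idPr h2) (max_idPr h1).
Qed.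

Let gcm k : gmeas (F k) (cm k g). Proof. exact: gmeas_cmean (@mq k) _ mg. Qed.

Let gclip k : gmeas (F k) (clip k).
Proof.
apply: (@measurable_maxr _ (g_sigma_algebraType (F k))) => //.
by apply: (@measurable_minr _ (g_sigma_algebraType (F k))) => //; exact: gcm.
Qed.

Let mclip k : measurable_fun setT (clip k).
Proof. exact: gmeas_measurable (@subF k) (@gclip k). Qed.

Let mcm k : measurable_fun setT (cm k g).
Proof. exact: gmeas_measurable (@subF k) (@gcm k). Qed.

Let mgX k : measurable_fun setT (fun w => g (X k w)).
Proof. exact: measurableT_comp. Qed.

Let clip_mart k U M : gmeas (F k) U -> (forall w, `|U w| <= M) ->
  \int[P]_w (U w * g (X k w)) = \int[P]_w (U w * clip k w).
Proof.
move=> gU UM; have mU := gmeas_measurable (@subF k) gU.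
have [_ ->] := cd_cmean (@subF k) (@mX k) (@mq k) (@q0 k) (@hq k) gU UM mg gN.
apply: Int_ae_eq; [apply: measurable_funM => //; exact: mcm|apply: measurable_funM => //; exact: mclip|].
by apply: filterS (clip_ae k) => w ->.
Qed.

Let S n w := \sum_(k < n) (g (X k w) - clip k w).

Let gS n : gmeas (F n) (S n).
Proof.
apply: (@measurable_sum _ (g_sigma_algebraType (F n))) => k.
apply: (@measurable_funB _ (g_sigma_algebraType (F n))).
  by apply: (measurableT_comp mg); exact: X_adapted.
exact: (gmeas_mono (monoF (ltnW (ltn_ord k))) (@gclip k)).
Qed.

Let mS n : measurable_fun setT (S n).
Proof. exact: gmeas_measurable (@subF n) (@gS n). Qed.

Let U_bnd k w : `|g (X k w) - clip k w| <= 2 * N.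
Proof. by rewrite (le_trans (ler_normB _ _))// mulr_natl mulr2n lerD. Qed.

Let S_bnd n w : `|S n w| <= n%:R * (2 * N).
Proof.
apply: le_trans (ler_norm_sum _ _ _) _.
rewrite -[n in leRHS]card_ord mulr_natl -sumr_const.
by apply: ler_sum => k _; exact: U_bnd.
Qed.

Let L1bb (U V : T -> R) M M' : measurable_fun setT U -> measurable_fun setT V ->
  (forall w, `|U w| <= M) -> (forall w, `|V w| <= M') -> L1 P (fun w => U w * V w).
Proof.
move=> mU mV UM VM; apply: (@L1_bnd _ _ _ _ _ (M * M')); first exact: measurable_funM.
by move=> w; rewrite normrM ler_pM.
Qed.

(** [S n] is bounded and F_n-measurable, so cross terms vanish; and centring by the conditional mean
    can only lower the second moment of [g (X n)]. *)
Lemma mart_sum_sqr n : \int[P]_w (S n w ^+ 2) <= n%:R * \int[mu]_y (g y ^+ 2 * f y).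
Proof.
elim: n => [|n ih].
  rewrite mul0r (_ : (fun w => _) = cst 0) ?Int_cst//.
  by apply/funext => w; rewrite /S big_ord0 expr0n.
pose U w := g (X n w) - clip n w.
have mU : measurable_fun setT U by apply: measurable_funB; [exact: mgX|exact: mclip].
have lSU : L1 P (fun w => S n w * U w) by apply: (L1bb (@mS n) mU (S_bnd n) (U_bnd n)).
have lSS : L1 P (fun w => S n w ^+ 2).
  exact: (L1bb (@mS n) (@mS n) (S_bnd n) (S_bnd n)).
have lUU : L1 P (fun w => U w ^+ 2) by exact: (L1bb mU mU (U_bnd n) (U_bnd n)).
have lSg : L1 P (fun w => S n w * g (X n w)).
  by apply: (L1bb (@mS n) (@mgX n) (S_bnd n)) => w; exact: gN.
have lSc : L1 P (fun w => S n w * clip n w).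
  exact: (L1bb (@mS n) (@mclip n) (S_bnd n) (clip_bnd n)).
have SU0 : \int[P]_w (S n w * U w) = 0.
  rewrite (_ : (fun w => S n w * U w) = fun w => S n w * g (X n w) - S n w * clip n w).
    by rewrite IntB// (clip_mart (@gS n) (S_bnd n)) subrr.
  by apply/funext => w; rewrite mulrBr.
have lgg : L1 P (fun w => g (X n w) ^+ 2).
  by apply: (L1bb (@mgX n) (@mgX n)) => w; exact: gN.
have lcg : L1 P (fun w => clip n w * g (X n w)).
  by apply: (L1bb (@mclip n) (@mgX n) (clip_bnd n)) => w; exact: gN.
have lcc : L1 P (fun w => clip n w * clip n w).
  exact: (L1bb (@mclip n) (@mclip n) (clip_bnd n) (clip_bnd n)).
have UU : \int[P]_w (U w ^+ 2) <= \int[mu]_y (g y ^+ 2 * f y).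
  rewrite -(@expect_X n (fun y => g y ^+ 2) (N * N)).
  - rewrite (_ : (fun w => U w ^+ 2) = fun w => g (X n w) ^+ 2 - (2 * (clip n w * g (X n w)) - clip n w * clip n w)).
      rewrite IntB//; last by apply: L1B => //; exact: L1Z.
      rewrite IntB//; last exact: L1Z.
      rewrite IntZ// (clip_mart (@gclip n) (clip_bnd n)).
      have : 0 <= \int[P]_w (clip n w * clip n w).
        by apply: Int_ge0 => w; rewrite -expr2 sqr_ge0.
      by lra.
    by apply/funext => w; rewrite /U; ring.
  - exact: measurable_funX.
  - by move=> y; rewrite expr2 normrM ler_pM.
rewrite (_ : (fun w => S n.+1 w ^+ 2) = fun w => S n w ^+ 2 + (2 * (S n w * U w) + U w ^+ 2)).
  rewrite IntD//; last by apply: L1D => //; exact: L1Z.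
  rewrite IntD//; last exact: L1Z.
  by rewrite IntZ// SU0 mulr0 add0r -natr1 mulrDl mul1r lerD.
by apply/funext => w; rewrite /S big_ord_recr/= -/(S n w) /U; ring.
Qed.

(** The clipped sums agree with the original ones almost surely; then n^-2 times n is n^-1. *)
Lemma d0_mart_average n :
  d0 P (fun w => n%:R^-1 * \sum_(k < n) (g (X k w) - cm k g w)) ^+ 2 <=
  n%:R^-1 * \int[mu]_y (g y ^+ 2 * f y).
Proof.
have mA : measurable_fun setT (fun w => n%:R^-1 * \sum_(k < n) (g (X k w) - cm k g w)).
  apply: measurable_funM => //; apply: measurable_sum => k.
  by apply: measurable_funB; [exact: mgX|exact: mcm].
have mSn : measurable_fun setT (fun w => n%:R^-1 * S n w).
  by apply: measurable_funM => //; exact: mS.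
have lSS : L1 P (fun w => S n w ^+ 2).
  exact: (L1bb (@mS n) (@mS n) (S_bnd n) (S_bnd n)).
rewrite (d0_ae mA mSn).
  have e w : (n%:R^-1 * S n w) ^+ 2 = n%:R^-2 * S n w ^+ 2 by rewrite exprMn exprVn.
  apply: le_trans (d0_sqr mSn _) _.
    rewrite (_ : (fun w => (n%:R^-1 * S n w) ^+ 2) = fun w => n%:R^-2 * S n w ^+ 2).
      exact: L1Z.
    exact/funext.
  under eq_Rintegral do rewrite e.
  rewrite IntZ//; have := mart_sum_sqr n.
  (* For n = 0 both sides vanish, since 0^-1 = 0. *)
  case: n {mA mSn lSS e} => [|n]; first by rewrite !invr0 expr0n/= invr0 !mul0r.
  have n0 : (0 : R) < n.+1%:R by [].
  move=> h; rewrite -exprVn expr2 -mulrA ler_pM2l ?invr_gt0//.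
  by rewrite ler_pdivrMl.
have all_ae : {ae P, forall w, forall k, clip k w = cm k g w}.
  by apply/ae_foralln => k; exact: clip_ae.
by apply: filterS all_ae => w h; congr (_ * _); apply: eq_bigr => k _; rewrite h.
Qed.

End fixed_kernel.

Let slices : {ae P, forall w, forall k, L1 mu (q k w)}.
Proof.
apply/ae_foralln => k.
exact: (cd_slice_L1 (@subF k) (@mq k) (@q0 k) (@hq k)).
Qed.

Let avg_diff n w (g : R -> R) N : measurable_fun setT g -> (forall y, `|g y| <= N) ->
  (forall k, L1 mu (q k w)) ->
  L1 mu (fun y => g y * (n%:R^-1 * (\sum_(k < n) q k w y) - f y)) /\
  n%:R^-1 * (\sum_(k < n) cm k g w) - \int[mu]_y (g y * f y) =
  \int[mu]_y (g y * (n%:R^-1 * (\sum_(k < n) q k w y) - f y)).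
Proof.
move=> mg gN lq.
have lgq k : L1 mu (fun y => g y * q k w y) by exact: (L1_bndM_leb mg gN).
have lgf : L1 mu (fun y => g y * f y) by exact: (L1_bndM_leb mg gN).
have e y : g y * (n%:R^-1 * (\sum_(k < n) q k w y) - f y) =
    n%:R^-1 * (\sum_(k < n) g y * q k w y) - g y * f y.
  by rewrite -mulr_sumr; ring.
have ls : L1 mu (fun y => n%:R^-1 * (\sum_(k < n) g y * q k w y)).
  by apply/L1Z/L1_sum.
split.
  by apply: eq_integrable (L1B ls lgf) => // y _ /=; rewrite e.
under [RHS]eq_Rintegral do rewrite e.
rewrite IntB// IntZ; last exact: L1_sum.
by rewrite Int_sum.
Qed.

Section uniform.
Variable (D : nat -> T -> \bar R).
Hypothesis D_bound : forall n w y,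
  (`|n%:R^-1 * (\sum_(k < n) q k w y) - f y|%:E <= D n w)%E.
Hypothesis D_cvg : {ae P, forall w, D n w @[n --> \oo] --> 0%E}.

(** For almost every w the difference is at most [D n w] times the L^1 norm of [g n], which is at
    most K; dominated convergence in w finishes. *)
Lemma d0_predictable_average (g : nat -> R -> R) (N : nat -> R) (K : R) :
  (forall n, measurable_fun setT (g n)) -> (forall n y, `|g n y| <= N n) ->
  (forall n, L1 mu (g n)) -> (forall n, \int[mu]_y `|g n y| <= K) ->
  d0 P (fun w => n%:R^-1 * (\sum_(k < n) cm k (g n) w) - \int[mu]_y (g n y * f y))
    @[n --> \oo] --> 0.
Proof.
move=> mg gN lg gK.
have K0 : 0 <= K by apply: le_trans (gK 0%N); exact: Int_ge0.
have mA n : measurable_fun setT (fun w => n%:R^-1 * (\sum_(k < n) cm k (g n) w) - \int[mu]_y (g n y * f y)).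
  apply: measurable_funB => //; apply: measurable_funM => //; apply: measurable_sum => k.
  have h := gmeas_cmean (@mq k) (mg n).
  exact: gmeas_measurable (@subF k) h.
rewrite -[X in _ --> X](@Int0 _ _ _ P).
apply: (Int_dct (g := cst 1)) => //.
- by move=> n; exact: measurable_min1.
- have := slices; apply: filterS2 D_cvg => w Dw lq.
  apply/cvgr0Pnorm_le => e e0.
  have K1 : 0 < K + 1 by lra.
  have eK : 0 < e / (K + 1) by rewrite divr_gt0.
  have : \forall n \near \oo, (D n w < (e / (K + 1))%:E)%E.
    apply: (Dw (fun z : \bar R => (z < (e / (K + 1))%:E)%E)).
    apply: open_nbhs_nbhs; split; first exact: open_ereal_lt_ereal.
    by rewrite /= lte_fin.
  apply: filterS => n Dn.
  rewrite ger0_norm ?min1_ge0//.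
  have [la ->] := avg_diff n (mg n) (gN n) lq.
  apply: le_trans (_ : `|\int[mu]_y (g n y * (n%:R^-1 * (\sum_(k < n) q k w y) - f y))| <= _).
    by rewrite ge_min lexx orbT.
  apply: le_trans (_ : \int[mu]_y (e / (K + 1) * `|g n y|) <= _).
    apply: Int_abs_le => //; first exact/L1Z/L1_abs.
    move=> y; rewrite normrM mulrC ler_wpM2r// -lee_fin.
    exact: le_trans (D_bound n w y) (ltW Dn).
  rewrite IntZ; last exact: L1_abs.
  rewrite mulrAC ler_pdivrMr// ler_pM2l//.
  by have := gK n; lra.
- exact: L1_cst.
- by move=> n w; rewrite ger0_norm ?min1_ge0// ge_min lexx.
Qed.

End uniform.

(** Here a rate is needed: Tonelli moves the expectation under the integral in y, where the bound r
    applies at each point. *)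
Lemma d0_predictable_average_L1 (g : R -> R) (N r : R) n :
  (0 < n)%N -> measurable_fun setT g -> (forall y, `|g y| <= N) -> L1 mu g ->
  (forall y, (\int[P]_w `|\sum_(k < n) q k w y - n%:R * f y|%:E <= r%:E)%E) ->
  d0 P (fun w => n%:R^-1 * (\sum_(k < n) cm k g w) - \int[mu]_y (g y * f y)) <=
  n%:R^-1 * r * \int[mu]_y `|g y|.
Proof.
case: n => // n _ mg gN lg hr.
have n0 : (0 : R) < n.+1%:R by [].
pose v (z : T * R) : R := `|g z.2| * (n.+1%:R^-1 * `|\sum_(k < n.+1) q k z.1 z.2 - n.+1%:R * f z.2|).
have mdiff : measurable_fun setT (fun z : T * R => `|\sum_(k < n.+1) q k z.1 z.2 - n.+1%:R * f z.2|).
  apply: measurableT_comp => //; apply: measurable_funB.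
    by apply: measurable_sum => k; exact: (cd_measurable (@subF k) (@mq k)).
  apply: measurable_funM => //; have h := L1_measurable lf; exact: measurableT_comp.
have mv : measurable_fun setT (fun z => (v z)%:E).
  apply/measurable_EFinP; apply: measurable_funM; last exact: measurable_funM.
  by apply: measurableT_comp => //; exact: measurableT_comp.
have v0 z : (0 <= (v z)%:E)%E by rewrite lee_fin !mulr_ge0// invr_ge0.
have mZ : measurable_fun setT (fun w => n.+1%:R^-1 * (\sum_(k < n.+1) cm k g w) - \int[mu]_y (g y * f y)).
  apply: measurable_funB => //; apply: measurable_funM => //; apply: measurable_sum => k.
  have h := gmeas_cmean (@mq k) mg.
  exact: gmeas_measurable (@subF k) h.
rewrite -lee_fin /d0 IntE; last exact: L1_min1.
apply: (@le_trans _ _ (\int[P]_w \int[mu]_y (v (w, y))%:E)%E).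
  apply: ae_ge0_le_integral => //.
  - by apply/measurable_EFinP; exact: measurable_min1.
  - by move=> w _; apply: integral_ge0 => y _; exact: v0.
  - exact: (@measurable_fun_fubini_tonelli_F _ _ _ _ R mu (fun z : T * R => (v z)%:E)).
  have := slices; apply: filterS => w lq _.
  have [la ->] := avg_diff n.+1 mg gN lq.
  apply: le_trans (_ : (\int[mu]_y `|g y * (n.+1%:R^-1 * (\sum_(k < n.+1) q k w y) - f y)|)%:E <= _)%E.
    by rewrite lee_fin ge_min Int_abs// orbT.
  rewrite IntE; last exact: L1_abs.
  rewrite le_eqVlt; apply/orP; left; apply/eqP; apply: eq_integral => y _.
  rewrite /v normrM/=; congr ((_ * _)%:E).
  have i0 : 0 <= n.+1%:R^-1 :> R by rewrite invr_ge0.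
  rewrite -[X in _ = X * _](ger0_norm i0) -normrM; congr `|_|.
  by rewrite mulrBr mulKf// gt_eqF.
rewrite -(tonelli_joint P mv v0) (@fubini_tonelli2 _ _ _ _ R P mu _ mv v0).
apply: (@le_trans _ _ (\int[mu]_y (n.+1%:R^-1 * r * `|g y|)%:E)%E).
  apply: ge0_le_integral => //.
  - by move=> y _; apply: integral_ge0 => w _; exact: v0.
  - exact: (@measurable_fun_fubini_tonelli_G _ _ _ _ R P (fun z : T * R => (v z)%:E)).
  - apply/measurable_EFinP; apply: measurable_funM => //.
    by have h := L1_measurable lg; apply: measurableT_comp.
  move=> y _; rewrite /fubini_G /v/=.
  under eq_integral do rewrite mulrA EFinM.
  rewrite ge0_integralZl_EFin//.
  - have -> : n.+1%:R^-1 * r * `|g y| = `|g y| * n.+1%:R^-1 * r by ring.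
    by rewrite [leRHS]EFinM lee_wpmul2l ?lee_fin ?mulr_ge0 ?invr_ge0//; exact: hr.
  - apply/measurable_EFinP.
    have h := measurableT_comp mdiff (@pair2_measurable _ _ T R y); exact: h.
rewrite -IntE; last exact/L1Z/L1_abs.
by rewrite IntZ//; exact: L1_abs.
Qed.

End average_of_densities.

(** * The gamma function *)

Section affine_change.
Context {R : realType}.
Notation mu := (@lebesgue_measure R).

(** The image of Lebesgue measure under the affine map, times a, agrees with Lebesgue measure on
    intervals, hence everywhere. *)
Lemma ge0_integral_affine (a b : R) (g : R -> \bar R) : 0 < a ->
  measurable_fun setT g -> (forall y, (0 <= g y)%E) ->
  (\int[mu]_u g (a * u + b)%R = a^-1%:E * \int[mu]_y g y)%E.
Proof.
move=> a0 mg g0.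
pose phi (u : measurableTypeR R) : measurableTypeR R := a * u + b.
have mphi : measurable_fun setT phi.
  by apply: measurable_funD => //; exact: measurable_funM.
have a0' : 0 <= a by exact: ltW.
have [nu [nuA nuI]] : exists nu : {measure set (measurableTypeR R) -> \bar R},
    (forall A, nu A = (a%:E * mu (phi @^-1` A))%E) /\
    (\int[nu]_y g y = a%:E * \int[mu]_u g (phi u))%E.
  unshelve eexists (mscale (NngNum a0') (pushforward mu phi) : {measure set _ -> \bar R});
    first exact: mphi.
  split=> //; rewrite ge0_integral_mscale//=.
  by rewrite ge0_integral_pushforward// => y _; exact: g0.
have nuE : forall A, measurable A -> mu A = nu A.
  apply: lebesgue_measure_unique => _ [[c e] _ <-].
  rewrite nuA.
  have -> : phi @^-1` `]c, e] = `](c - b) / a, (e - b) / a]%classic.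
    apply/seteqP; split => u /=; rewrite !in_itv/= /phi => /andP[h1 h2]; apply/andP; split.
    - by rewrite ltr_pdivrMr// mulrC; lra.
    - by rewrite ler_pdivlMr// mulrC; lra.
    - by move: h1; rewrite ltr_pdivrMr// mulrC; lra.
    - by move: h2; rewrite ler_pdivlMr// mulrC; lra.
  have -> : (fun A => mu A) `](c - b) / a, (e - b) / a]%classic =
      (if (c < e)%R then ((e - c) / a)%:E else 0)%E.
    rewrite /= lebesgue_measure_itv/= lte_fin ltr_pM2r ?invr_gt0// ltrBlDr subrK.
    by case: ifP => // _; rewrite -EFinB -mulrBl; congr ((_ * _)%:E); ring.
  rewrite lebesgue_measure_itv/= lte_fin; case: ifP => _; last by rewrite mule0.
  by rewrite -EFinB -EFinM mulrCA mulfV ?gt_eqF// mulr1.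
have -> : (\int[mu]_y g y = \int[nu]_y g y)%E.
  by apply: eq_measure_integral => A mA _; exact: nuE.
by rewrite nuI muleA -EFinM mulVf ?gt_eqF// mul1e.
Qed.

Lemma L1_affine (a b : R) (g : R -> R) : 0 < a -> L1 mu g -> L1 mu (fun u => g (a * u + b)).
Proof.
move=> a0 /integrableP[mg ig]; apply/integrableP; split.
  apply/measurable_EFinP; have mg' := (measurable_EFinP _ _).1 mg.
  by apply: (measurableT_comp mg'); apply: measurable_funD => //; exact: measurable_funM.
rewrite (@ge0_integral_affine a b (fun y => `|(g y)%:E|%E))//; last exact: measurableT_comp.
by rewrite lte_mul_pinfty// ?lee_fin ?invr_ge0 ?ltW.
Qed.

Lemma Int_affine (a b : R) (g : R -> R) : 0 < a -> measurable_fun setT g ->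
  (forall y, 0 <= g y) -> \int[mu]_u g (a * u + b) = a^-1 * \int[mu]_y g y.
Proof.
move=> a0 mg g0; rewrite /Rintegral (@ge0_integral_affine a b (fun y => (g y)%:E))//.
(* If the integral is infinite, both sides are 0 because [fine +oo] is 0. *)
- have [lg|] := boolP (\int[mu]_y (g y)%:E \is a fin_num)%E; first by rewrite fineM.
  rewrite ge0_fin_numE ?integral_ge0//; last by move=> y _; rewrite lee_fin.
  rewrite -leNgt leye_eq => /eqP ->.
  by rewrite mulry gtr0_sg ?invr_gt0// mul1e/= mulr0.
- exact/measurable_EFinP.
Qed.

End affine_change.

Section lebesgue_specializations.
Context {R : realType}.
Notation mu := (@lebesgue_measure R).
Implicit Types f g : R -> R.

Lemma L1_le_leb f g : measurable_fun setT f -> (forall y, `|f y| <= g y) ->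
  L1 mu g -> L1 mu f.
Proof. exact: (@L1_le _ _ _ mu f g). Qed.

Lemma Int_dct_leb (F : nat -> R -> R) f g :
  (forall n, measurable_fun setT (F n)) -> measurable_fun setT f ->
  (forall y, F n y @[n --> \oo] --> f y) ->
  L1 mu g -> (forall n y, `|F n y| <= g y) ->
  \int[mu]_y F n y @[n --> \oo] --> \int[mu]_y f y.
Proof.
by move=> mF mf Ff; apply: (@Int_dct _ _ _ mu F f g) => //; exact: aeW.
Qed.

End lebesgue_specializations.

Section gamma_function.
Context {R : realType}.
Notation mu := (@lebesgue_measure R).
Implicit Types p s y z h : R.

(** An unnormalised gamma density of shape p + 1 and rate s, with the value 1 at y = 0 when p =
    0. *)
Definition gfun p s y : R := y `^ p * expR (- (s * y)) * \1_halfline y.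

Lemma halflineE y : (y \in @halfline R) = (0 <= y).
Proof. by rewrite mem_setE /halfline in_itv/= andbT. Qed.

Lemma gfun_pos p s y : 0 <= y -> gfun p s y = y `^ p * expR (- (s * y)).
Proof. by move=> y0; rewrite /gfun indicE halflineE y0 mulr1. Qed.

Lemma gfun_neg p s y : y < 0 -> gfun p s y = 0.
Proof. by move=> y0; rewrite /gfun indicE halflineE leNgt y0 mulr0. Qed.

Lemma measurable_halfline : measurable (@halfline R).
Proof. exact: measurable_itv. Qed.

Lemma measurable_gfun p s : measurable_fun setT (gfun p s).
Proof.
apply: measurable_funM; last by apply: measurable_indic; exact: measurable_halfline.
apply: measurable_funM; first exact: measurable_powR.
apply: measurableT_comp; first exact: measurable_expR.
by apply: measurableT_comp => //; exact: measurable_funM.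
Qed.

Lemma gfun_ge0 p s y : 0 <= gfun p s y.
Proof. by rewrite /gfun !mulr_ge0// ?powR_ge0 ?expR_ge0. Qed.


Lemma L1_gfun0 s : 0 < s -> L1 mu (gfun 0 s) /\ \int[mu]_y gfun 0 s y = s^-1.
Proof.
move=> s0.
have e y : gfun 0 s y = s^-1 * exponential_pdf s y.
  have [y0|y0] := leP 0 y.
    rewrite gfun_pos// exponential_pdfE// powRr0 mul1r mulKf ?gt_eqF//.
    by rewrite mulNr.
  by rewrite gfun_neg// lt0_exponential_pdf// mulr0.
have le : L1 mu (exponential_pdf s) by exact: integrable_exponential_pdf.
split; first by apply: eq_integrable (L1Z s^-1 le) => // y _ /=; rewrite e.
under eq_Rintegral do rewrite e.
by rewrite IntZ// /Rintegral integral_exponential_pdf// mulr1.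
Qed.

(** Write y^p = (2p)^p (y/(2p))^p and use ln t <= t at t = y/(2p); y = 0 and p = 0 are separate
    cases. *)
Lemma powR_exp_bound p : 0 <= p -> exists2 C : R, 0 < C & forall y, 0 <= y ->
  y `^ p <= C * expR (y / 2).
Proof.
move=> p0; exists ((2 * p) `^ p + 1); first by rewrite ltr_pwDr// powR_ge0.
move=> y y0; have e1 : 1 <= expR (y / 2) by rewrite -[leLHS]expR0 ler_expR divr_ge0.
have [->|yn0] := eqVneq y 0.
  rewrite mul0r expR0 mulr1; apply: ler_wpDl; first exact: powR_ge0.
  by have [->|pn0] := eqVneq p 0; rewrite ?powRr0// powR0.
have yp : 0 < y by rewrite lt_def yn0.
have [->|pn0] := eqVneq p 0.
  by rewrite powRr0; apply: le_trans e1 _; rewrite ler_peMl ?expR_ge0// powRr0; lra.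
have pp : 0 < p by rewrite lt_def pn0.
have p2 : 0 < 2 * p by rewrite mulr_gt0.
have -> : y `^ p = (2 * p) `^ p * (y / (2 * p)) `^ p.
  rewrite -powRM ?divr_ge0 ?(ltW p2)//; congr (_ `^ _); field; rewrite gt_eqF//.
have h : (y / (2 * p)) `^ p <= expR (y / 2).
  rewrite /powR gt_eqF ?divr_gt0// ler_expR.
  apply: le_trans (_ : p * (y / (2 * p)) <= _).
    rewrite ler_wpM2l//; have := @ln_sublinear R (y / (2 * p)) (divr_gt0 yp p2).
    exact: ltW.
  by rewrite le_eqVlt; apply/orP; left; apply/eqP; field; rewrite gt_eqF.
rewrite [leRHS]mulrDl mul1r; apply: (@le_trans _ _ ((2 * p) `^ p * expR (y / 2))); last by rewrite lerDl expR_ge0.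
by rewrite ler_wpM2l// powR_ge0.
Qed.

Lemma L1_gfun1 p : 0 <= p -> L1 mu (gfun p 1).
Proof.
move=> p0; have [C C0 hC] := powR_exp_bound p0.
have i2 : 0 < (2 : R)^-1 by rewrite invr_gt0.
have [l _] := L1_gfun0 i2.
have lC := L1Z C l.
apply: L1_le_leb (measurable_gfun p 1) _ lC.
  move=> y; rewrite ger0_norm ?gfun_ge0//.
  have [y0|y0] := leP 0 y; last by rewrite !gfun_neg// mulr0.
  rewrite !gfun_pos// powRr0 mul1r mul1r.
  apply: le_trans (_ : C * expR (y / 2) * expR (- y) <= _).
    by rewrite ler_wpM2r ?expR_ge0// hC.
  rewrite -mulrA -expRD ler_wpM2l ?(ltW C0)// ler_expR; lra.
Qed.

(** The [+ 0] puts the argument in the form of the affine change of variables. *)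
Lemma gfun_scale p s y : 0 < s -> gfun p s y = s `^ (- p) * gfun p 1 (s * y + 0).
Proof.
move=> s0; rewrite addr0; have [y0|y0] := leP 0 y; last first.
  by rewrite !gfun_neg ?mulr0// pmulr_rlt0.
have sy0 : 0 <= s * y by rewrite mulr_ge0// ltW.
rewrite !gfun_pos// mul1r mulrA; congr (_ * _).
rewrite powRM ?(ltW s0)// mulrA powRN mulVf ?mul1r//.
by rewrite gt_eqF// powR_gt0.
Qed.

Lemma L1_gfun p s : 0 <= p -> 0 < s -> L1 mu (gfun p s).
Proof.
move=> p0 s0; have l := L1_affine 0 s0 (L1_gfun1 p0).
rewrite (_ : gfun p s = fun y => s `^ (- p) * gfun p 1 (s * y + 0)); last first.
  by apply/funext => y; exact: gfun_scale.
exact: L1Z.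
Qed.

Lemma Int_gfun p s : 0 <= p -> 0 < s ->
  \int[mu]_y gfun p s y = s `^ (- (p + 1)) * \int[mu]_y gfun p 1 y.
Proof.
move=> p0 s0; under eq_Rintegral do rewrite (gfun_scale _ _ s0).
rewrite IntZ; last by have l := L1_affine 0 s0 (L1_gfun1 p0); exact: l.
rewrite (Int_affine 0 s0 (measurable_gfun p 1)); last exact: gfun_ge0.
rewrite mulrA; congr (_ * _); rewrite opprD powRD ?(gt_eqF s0) ?implybT//.
by rewrite powR_inv1// ltW.
Qed.

(** Including the null point 0 turns the integral over the open half-line into one of [gfun]. *)
Lemma GammaE p : 0 <= p -> Gamma (p + 1) = \int[mu]_y gfun p 1 y.
Proof.
move=> p0; rewrite /Gamma addrK.
rewrite Rintegral_itv_obnd_cbnd; last first.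
  have l : mu.-integrable `]0, +oo[%classic (EFin \o gfun p 1).
    by apply: integrableS (L1_gfun1 p0).
  by apply: eq_integrable l => // y; rewrite inE/= in_itv/= andbT => /ltW y0;
    rewrite gfun_pos// mul1r.
rewrite Rintegral_mkcond; apply: eq_Int => y.
rewrite /patch /gfun indicE /halfline mul1r.
by case: (y \in _); rewrite ?mulr1 ?mulr0.
Qed.

(* Both sides are computed from the difference quotient at s = 1 of
   s |-> \int y^p e^{-sy} dy = s^{-(p+1)} Gamma(p+1). *)
Lemma GammaS p : 0 <= p -> Gamma (p + 1 + 1) = (p + 1) * Gamma (p + 1).
Proof.
move=> p0; have p10 : 0 <= p + 1 by rewrite addr_ge0.
pose dl (n : nat) : R := n.+1%:R^-1.
have dl0 n : 0 < dl n by rewrite invr_gt0.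
have cdl : dl n @[n --> \oo] --> 0 by exact: cvg_harmonic.
have s0 n : 0 < 1 + dl n by rewrite addr_gt0.
pose Q n y := (dl n)^-1 * (gfun p 1 y - gfun p (1 + dl n) y).
have key (u : R) : 0 <= u -> u / (1 + u) <= 1 - expR (- u) <= u.
  move=> u0; have h := expR_ge1Dx u; have h' := expR_ge1Dx (- u).
  have u1 : 0 < 1 + u by lra.
  apply/andP; split; last by lra.
  have -> : u / (1 + u) = 1 - (1 + u)^-1 by field; rewrite gt_eqF.
  by rewrite expRN lerB// lef_pV2// posrE expR_gt0.
have gS y : 0 <= y -> gfun (p + 1) 1 y = y * gfun p 1 y.
  move=> y0; rewrite !gfun_pos// mulrA; congr (_ * _).
  have [->|yn0] := eqVneq y 0; first by rewrite mul0r powR0// gt_eqF//; lra.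
  by rewrite powRD ?yn0 ?implybT// powRr1// mulrC.
have QE n y : 0 <= y -> Q n y = gfun p 1 y * ((1 - expR (- (dl n * y))) / dl n).
  move=> y0; rewrite /Q !gfun_pos//.
  have -> : expR (- ((1 + dl n) * y)) = expR (- (1 * y)) * expR (- (dl n * y)).
    by rewrite -expRD; congr expR; ring.
  by ring.
have Qb n y : 0 <= y -> gfun p 1 y * (y / (1 + dl n * y)) <= Q n y <= gfun (p + 1) 1 y.
  move=> y0; have dy : 0 <= dl n * y by rewrite mulr_ge0// ltW.
  have /andP[h1 h2] := key _ dy.
  rewrite QE// gS// (mulrC y (gfun p 1 y)); apply/andP; split; apply: ler_wpM2l; rewrite ?gfun_ge0//.
    by rewrite ler_pdivlMr// mulrAC [y * _]mulrC.
  by rewrite ler_pdivrMr// [y * _]mulrC.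
have c1 : \int[mu]_y Q n y @[n --> \oo] --> \int[mu]_y gfun (p + 1) 1 y.
  apply: (Int_dct_leb (g := gfun (p + 1) 1)).
  - by move=> n; apply: measurable_funM => //; apply: measurable_funB; exact: measurable_gfun.
  - exact: measurable_gfun.
  - move=> y; have [y0|y0] := leP 0 y; last first.
      rewrite gfun_neg//; apply: cvg_near_cst; apply: nearW => n.
      by rewrite /Q !gfun_neg// subrr mulr0.
    have lim : gfun p 1 y * (y / (1 + dl n * y)) @[n --> \oo] --> gfun (p + 1) 1 y.
      rewrite gS// [y * _]mulrC; apply: cvgM; first exact: cvg_cst.
      rewrite -[X in _ --> X]mulr1 -[in X in _ --> X]invr1.
      apply: cvgM; first exact: cvg_cst.
      apply: cvgV => //; rewrite -[X in _ --> X]addr0 -[X in _ --> _ + X](mul0r y).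
      by apply: cvgD; [exact: cvg_cst|apply: cvgM => //; exact: cvg_cst].
    apply: squeeze_cvgr lim (cvg_cst _); apply: nearW => n; exact: Qb.
  - exact: L1_gfun1.
  - move=> n y; have [y0|y0] := leP 0 y; last first.
      by rewrite /Q !gfun_neg// subrr mulr0 normr0.
    have /andP[h1 h2] := Qb n y y0; rewrite ger0_norm//.
    apply: le_trans h1; apply: mulr_ge0; first exact: gfun_ge0.
    have : 0 <= dl n * y by rewrite mulr_ge0// (ltW (dl0 n)).
    by move=> dy; apply: divr_ge0 => //; lra.
pose r n := (dl n)^-1 * (1 - (1 + dl n) `^ (- (p + 1))).
have IQ n : \int[mu]_y Q n y = r n * Gamma (p + 1).
  rewrite IntZ; last by apply: L1B; apply: L1_gfun.
  rewrite IntB; [|exact: L1_gfun|exact: L1_gfun].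
  by rewrite (Int_gfun p0 (s0 n)) -GammaE// /r; ring.
have c2 : r n @[n --> \oo] --> p + 1.
  (* With u = (p + 1) ln(1 + dl), [r n] is (1 - e^(-u)) / dl. The bounds follow from [key] and from
     d/(1 + d) <= ln(1 + d) <= d. *)
  have b n : (p + 1) / ((1 + dl n) * (1 + (p + 1) * dl n)) <= r n <= p + 1.
    have s1 : 0 < 1 + dl n := s0 n.
    pose l := ln (1 + dl n); pose u := (p + 1) * l.
    have lle : l <= dl n by apply: le_ln1Dx; have := dl0 n; lra.
    have lge : dl n / (1 + dl n) <= l.
      have := @le_ln1Dx R (- (dl n / (1 + dl n))).
      have -> : 1 + - (dl n / (1 + dl n)) = (1 + dl n)^-1 by field; rewrite gt_eqF.
      rewrite lnV ?posrE// -/l lerN2; apply.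
      by rewrite ltrN2 ltr_pdivrMr// mul1r; lra.
    have l0 : 0 <= l by apply: le_trans lge; rewrite divr_ge0 ?(ltW (dl0 n))// (ltW s1).
    have u0 : 0 <= u by rewrite mulr_ge0.
    have /andP[k1 k2] := key u u0.
    have -> : r n = (1 - expR (- u)) / dl n.
      by rewrite /r /powR gt_eqF// mulNr mulrC.
    apply/andP; split; last first.
      rewrite ler_pdivrMr//; apply: le_trans k2 _; exact: ler_wpM2l.
    rewrite ler_pdivlMr//; apply: le_trans k1.
    have w1 : 0 < 1 + (p + 1) * dl n by rewrite ltr_wpDr// mulr_ge0// ltW.
    have w2 : 0 < 1 + u by rewrite ltr_wpDr.
    have -> : (p + 1) / ((1 + dl n) * (1 + (p + 1) * dl n)) * dl n =
        (p + 1) * (dl n / (1 + dl n)) * (1 + (p + 1) * dl n)^-1.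
      by field; rewrite !gt_eqF.
    apply: ler_pM.
    - by rewrite mulr_ge0// divr_ge0 ?(ltW (dl0 n))// (ltW s1).
    - by rewrite invr_ge0 ltW.
    - by rewrite ler_wpM2l.
    - by rewrite lef_pV2 ?posrE// lerD2l ler_wpM2l.
  have lim : (p + 1) / ((1 + dl n) * (1 + (p + 1) * dl n)) @[n --> \oo] --> p + 1.
    suff : (p + 1) / ((1 + dl n) * (1 + (p + 1) * dl n)) @[n --> \oo] --> (p + 1) * (1 : R)^-1.
      by rewrite invr1 mulr1.
    apply: cvgM; first exact: cvg_cst.
    apply: cvgV => //; rewrite -[X in _ --> X]mulr1; apply: cvgM.
      by rewrite -[X in _ --> X]addr0; apply: cvgD => //; exact: cvg_cst.
    rewrite -[X in _ --> X]addr0 -[in X in _ --> X](mulr0 (p + 1)).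
    by apply: cvgD; [exact: cvg_cst|apply: cvgM => //; exact: cvg_cst].
  by apply: squeeze_cvgr lim (cvg_cst _); apply: nearW => n; exact: b.
have c3 : \int[mu]_y Q n y @[n --> \oo] --> (p + 1) * Gamma (p + 1).
  under eq_cvg do rewrite IQ.
  by apply: cvgM => //; exact: cvg_cst.
by rewrite GammaE//; exact: cvg_unique c1 c3.
Qed.

End gamma_function.

(** * Stirling's formula *)

Lemma cvg_sqrt0 (R : realType) (u : nat -> R) : u n @[n --> \oo] --> 0 ->
  Num.sqrt (u n) @[n --> \oo] --> 0.
Proof.
have := @sqrt_continuous R 0; rewrite /continuous_at sqrtr0 => c0 cu.
exact: cvg_comp cu c0.
Qed.

Lemma cvg_near_dist (R : realType) (u : nat -> R) (l e : R) : 0 < e ->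
  u n @[n --> \oo] --> l -> \forall n \near \oo, `|u n - l| <= e.
Proof.
move=> e0 /cvgrPdist_le /(_ e e0) c; near=> n.
by rewrite distrC; near: n.
Unshelve. all: by end_near.
Qed.

Section stirling.
Context {R : realType}.
Notation mu := (@lebesgue_measure R).
Implicit Types s u z : R.

(** The remainder has derivative t^2/(1 + t), at most 2 t^2 when |t| <= 1/2; [mvt_bound] is used on
    either side of 0. *)
Lemma ln_taylor2 s : `|s| <= 2^-1 -> `|ln (1 + s) - s + 2^-1 * s ^+ 2| <= 2 * `|s| ^+ 3.
Proof.
pose g (t : R) := ln (1 + t) - t + 2^-1 * t ^+ 2.
have dg (t : R) : `|t| <= 2^-1 -> is_derive t 1 g (t ^+ 2 / (1 + t)).
  move=> ht; have t1 : 0 < 1 + t by move: ht; rewrite ler_norml => /andP[]; lra.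
  have h1 : is_derive t 1 (fun t : R => ln (1 + t)) (1 + t)^-1.
    have d1 := is_derive_add (is_derive_cst (1 : R) t 1) (is_derive_id t 1).
    have := is_derive1_comp (is_derive1_ln t1) d1.
    by move=> h; apply: is_derive_eq h _; rewrite add0r mulr1.
  have h2 := is_derive_add (is_derive_sub h1 (is_derive_id t 1))
    (is_derive_scale 2^-1 (is_derive_pow 1 t)).
  by apply: is_derive_eq h2 _; field; rewrite gt_eqF.
have bg (t : R) : `|t| <= 2^-1 -> `|t ^+ 2 / (1 + t)| <= 2 * t ^+ 2.
  move=> ht; have t1 : 2^-1 <= 1 + t by move: ht; rewrite ler_norml => /andP[]; lra.
  have t10 : 0 < 1 + t by apply: lt_le_trans t1; rewrite invr_gt0.
  rewrite ger0_norm; last by rewrite divr_ge0 ?sqr_ge0// ltW.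
  rewrite mulrC ler_wpM2r ?sqr_ge0// -[leRHS]invrK lef_pV2 ?posrE ?invr_gt0//.
have g0 : g 0 = 0 by rewrite /g addr0 ln1; ring.
move=> hs; suff : `|g s - g 0| <= 2 * `|s| ^+ 3 by rewrite g0 subr0.
have mono (t : R) : `|t| <= `|s| -> `|t ^+ 2 / (1 + t)| <= 2 * s ^+ 2.
  move=> ts; apply: le_trans (bg t (le_trans ts hs)) _.
  by rewrite ler_wpM2l// -(real_normK (num_real t)) -(real_normK (num_real s)) lerXn2r ?nnegrE.
have [s0|s0] := leP 0 s.
  have b t : 0 <= t <= s -> `|t| <= `|s|.
    by move=> /andP[t0 ts]; rewrite !ger0_norm.
  have := @mvt_bound R g (fun t : R => t ^+ 2 / (1 + t)) 0 s (2 * s ^+ 2) s0.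
  move=> /(_ (fun t ht => dg t (le_trans (b t ht) hs)) (fun t ht => mono t (b t ht))).
  by rewrite (ger0_norm s0) subr0 -mulrA -exprSr.
have b t : s <= t <= 0 -> `|t| <= `|s|.
  by move=> /andP[t0 ts]; rewrite !ler0_norm ?(ltW s0)// lerN2.
have := @mvt_bound R g (fun t : R => t ^+ 2 / (1 + t)) s 0 (2 * s ^+ 2) (ltW s0).
move=> /(_ (fun t ht => dg t (le_trans (b t ht) hs)) (fun t ht => mono t (b t ht))).
rewrite distrC sub0r; move=> h; apply: le_trans h _.
rewrite (ltr0_norm s0) le_eqVlt; apply/orP; left; apply/eqP; ring.
Qed.

(** Gamma(z + 1) divided by z^z e^(-z) sqrt z; Stirling's formula is its convergence to sqrt(2
    pi). *)
Definition stirling_ratio z : R := Gamma (z + 1) * expR (z - z * ln z) / Num.sqrt z.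

(** The integrand y^z e^(-y) seen from its mode: y = z + u sqrt z, normalised to 1 at u = 0. *)
Let J z u : R := expR (z - z * ln z) * gfun z 1 (Num.sqrt z * u + z).

Lemma stirling_ratioE z : 0 < z -> stirling_ratio z = \int[mu]_u J z u.
Proof.
move=> z0; have sz0 : 0 < Num.sqrt z by rewrite sqrtr_gt0.
have l := L1_affine z sz0 (L1_gfun1 (ltW z0)).
rewrite /J IntZ; last exact: l.
rewrite (Int_affine z sz0 (measurable_gfun z 1)); last exact: gfun_ge0.
by rewrite /stirling_ratio GammaE ?(ltW z0)//; ring.
Qed.

Lemma JE z u : 0 < z -> 0 < 1 + u / Num.sqrt z ->
  J z u = expR (z * (ln (1 + u / Num.sqrt z) - u / Num.sqrt z)).
Proof.
move=> z0; set s := u / Num.sqrt z => s1.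
have sz0 : 0 < Num.sqrt z by rewrite sqrtr_gt0.
have e : Num.sqrt z * u + z = z * (1 + s).
  have zz : z = Num.sqrt z * Num.sqrt z by rewrite -expr2 sqr_sqrtr// ltW.
  by rewrite {2 3}zz /s; field; rewrite gt_eqF.
have p0 : 0 < z * (1 + s) by rewrite mulr_gt0.
rewrite /J e gfun_pos ?(ltW p0)// /powR gt_eqF// -!expRD; congr expR.
by rewrite lnM ?posrE//; ring.
Qed.

Lemma J0 z u : 0 < z -> 1 + u / Num.sqrt z <= 0 -> J z u = 0.
Proof.
move=> z0 s1; have sz0 : 0 < Num.sqrt z by rewrite sqrtr_gt0.
have e : Num.sqrt z * u + z <= 0.
  have zz : z = Num.sqrt z * Num.sqrt z by rewrite -expr2 sqr_sqrtr// ltW.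
  rewrite (_ : _ + _ = z * (1 + u / Num.sqrt z)); last first.
    by rewrite {2 3}zz; field; rewrite gt_eqF.
  by rewrite mulr_ge0_le0// ltW.
rewrite /J; move: e; rewrite le_eqVlt => /predU1P[->|e]; last by rewrite gfun_neg// mulr0.
by rewrite gfun_pos// powR0 ?mul0r ?mulr0// gt_eqF.
Qed.

(** The first term is e^(-u^2/4) and serves u < 0; the second is e^(1 - u/2) and serves u >= 0,
    where the tail of [J] at z = 1 is not Gaussian. *)
Definition stirling_bound u : R :=
  expR (2^-1 * ln 2) * heat 2 (0 - u) + expR 1 * gfun 0 2^-1 u.

Lemma L1_stirling_bound : L1 mu stirling_bound.
Proof.
have i2 : 0 < (2 : R)^-1 by rewrite invr_gt0.
have [l _] := L1_gfun0 i2.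
by apply: L1D; apply: L1Z; [exact: L1_heat|exact: l].
Qed.

(* With q = sqrt(1 + s), ln(1 + s) - s <= -(q - 1)^2 since ln q <= q - 1. *)
Lemma J_bound z u : 1 <= z -> `|J z u| <= stirling_bound u.
Proof.
move=> z1; have z0 : 0 < z by lra.
have sz0 : 0 < Num.sqrt z by rewrite sqrtr_gt0.
have sz1 : 1 <= Num.sqrt z by have := ler_wsqrtr z1; rewrite sqrtr1.
have h1 : 0 <= expR (2^-1 * ln 2) * heat 2 (0 - u).
  by rewrite mulr_ge0 ?expR_ge0// heat_ge0.
have h2 : 0 <= expR 1 * gfun 0 2^-1 u by rewrite mulr_ge0 ?expR_ge0// gfun_ge0.
have [s1|s1] := leP (1 + u / Num.sqrt z) 0.
  by rewrite J0// normr0 addr_ge0.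
rewrite JE// ger0_norm ?expR_ge0//; set s := u / Num.sqrt z in s1 *.
pose q := Num.sqrt (1 + s).
have q0 : 0 < q by rewrite sqrtr_gt0.
have qq : q ^+ 2 = 1 + s by rewrite sqr_sqrtr// ltW.
have lnq : ln (1 + s) - s <= - (q - 1) ^+ 2.
  have := @le_ln1Dx R (q - 1); rewrite (addrC 1) subrK => h.
  have h3 : ln q <= q - 1 by apply: h; lra.
  have -> : ln (1 + s) = 2 * ln q by rewrite -qq lnXn// mulr_natl.
  have -> : s = q ^+ 2 - 1 by lra.
  have -> : - (q - 1) ^+ 2 = 2 * (q - 1) - (q ^+ 2 - 1) by ring.
  by lra.
have szz : Num.sqrt z ^+ 2 = z by rewrite sqr_sqrtr// ltW.
(* So [J] is at most e^(-v^2) and u = v(q + 1). If u >= 0, then q - 1 <= v as z >= 1, so u <= v(v +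
   2) and v^2 >= u/2 - 1. If u < 0, then q <= 1, so u^2 <= 4 v^2. *)
pose v := Num.sqrt z * (q - 1).
have us : u = v * (q + 1).
  rewrite (_ : v * (q + 1) = Num.sqrt z * (q ^+ 2 - 1)); last by rewrite /v; ring.
  by rewrite qq /s; field; rewrite gt_eqF.
have le1 : expR (z * (ln (1 + s) - s)) <= expR (- v ^+ 2).
  rewrite ler_expR; apply: le_trans (ler_wpM2l (ltW z0) lnq) _.
  by rewrite -szz /v exprMn mulrN.
apply: le_trans le1 _; have [u0|u0] := leP 0 u.
  have q1 : 1 <= q by have s0 : 0 <= s by [rewrite divr_ge0// ltW]; have := @ler_wsqrtr R 1 (1 + s); rewrite sqrtr1; apply; lra.
  apply: ler_wpDl => //; rewrite gfun_pos// powRr0 mul1r -expRD ler_expR.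
  have v0 : 0 <= v by apply: mulr_ge0; [exact: ltW|lra].
  have qv : q - 1 <= v by apply: ler_peMl => //; lra.
  have h : v * (q + 1) <= v * (2 + v) by rewrite ler_wpM2l//; lra.
  have := sqr_ge0 (v - 1); rewrite us; rewrite !expr2; move: h; nra.
apply: ler_wpDr => //; rewrite /heat -expRD ler_expR sub0r sqrrN.
have q1 : q <= 1.
  have s0 : s <= 0 by rewrite /s mulr_le0_ge0 ?invr_ge0 ?(ltW sz0)// (ltW u0).
  by have := @ler_wsqrtr R (1 + s) 1; rewrite sqrtr1; apply; lra.
have h : u ^+ 2 <= 4 * v ^+ 2.
  rewrite us exprMn mulrC ler_wpM2r ?sqr_ge0//.
  have -> : (4 : R) = 2 ^+ 2 by ring.
  by rewrite lerXn2r ?nnegrE//; lra.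
by lra.
Qed.

Lemma cvg_sqrt_inv (z : nat -> R) : (forall n, 0 < z n) -> (z n)^-1 @[n --> \oo] --> 0 ->
  (Num.sqrt (z n))^-1 @[n --> \oo] --> 0.
Proof.
move=> z0 cz; under eq_cvg do rewrite -sqrtrV ?(ltW (z0 _))//.
exact: cvg_sqrt0.
Qed.

(** With s = u / sqrt z, z(ln(1 + s) - s) differs from -u^2/2 by at most 2 z |s|^3 = 2 |u|^3 / sqrt
    z. *)
Lemma J_lim (z : nat -> R) u : (forall n, 1 <= z n) -> (z n)^-1 @[n --> \oo] --> 0 ->
  J (z n) u @[n --> \oo] --> heat 1 (0 - u).
Proof.
move=> z1 cz; have z0 n : 0 < z n by apply: lt_le_trans (z1 n).
have ce := cvg_sqrt_inv z0 cz.
have cs : u / Num.sqrt (z n) @[n --> \oo] --> 0.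
  by rewrite -(mulr0 u); apply: cvgM => //; exact: cvg_cst.
have -> : heat 1 (0 - u) = expR (- (2^-1 * u ^+ 2)).
  by rewrite /heat ln1; congr expR; rewrite sub0r sqrrN; field.
have ns : \forall n \near \oo, `|u / Num.sqrt (z n)| <= 2^-1.
  have i2 : 0 < (2 : R)^-1 by rewrite invr_gt0.
  by apply: filterS (cvg_near_dist i2 cs) => n; rewrite subr0.
apply: cvg_trans (_ : expR (z n * (ln (1 + u / Num.sqrt (z n)) - u / Num.sqrt (z n)))
    @[n --> \oo] --> _).
  apply: near_eq_cvg; apply: filterS ns => n hn; apply/esym/JE => //.
  by move: hn; rewrite ler_norml => /andP[]; lra.
apply: continuous_cvg; first exact: continuous_expR.
have c0 : 2 * `|u| ^+ 3 * (Num.sqrt (z n))^-1 @[n --> \oo] --> 0.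
  by rewrite -(mulr0 (2 * `|u| ^+ 3)); apply: cvgM => //; exact: cvg_cst.
apply/cvgrPdist_le => e e0; have c1 := cvg_near_dist e0 c0.
near=> n.
have hn : `|u / Num.sqrt (z n)| <= 2^-1 by near: n.
have h1 : `|2 * `|u| ^+ 3 * (Num.sqrt (z n))^-1 - 0| <= e by near: n.
have sz0 : 0 < Num.sqrt (z n) by rewrite sqrtr_gt0.
have szz : Num.sqrt (z n) ^+ 2 = z n by rewrite sqr_sqrtr// ltW.
apply: le_trans h1; rewrite subr0; apply: le_trans (ler_norm _).
  have := ln_taylor2 hn; set s := u / _ => h.
  have eq1 : - (2^-1 * u ^+ 2) - z n * (ln (1 + s) - s) =
      - (z n * (ln (1 + s) - s + 2^-1 * s ^+ 2)).
    by rewrite -szz /s; field; rewrite gt_eqF.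
  rewrite eq1 normrN normrM (gtr0_norm (z0 n)).
  have := ler_wpM2l (ltW (z0 n)) h; set w := (X in _ <= X -> _) => h'.
  suff -> : 2 * `|u| ^+ 3 * (Num.sqrt (z n))^-1 = w by exact: h'.
  rewrite /w /s normrM normfV (gtr0_norm sz0).
  move: sz0 szz; move: (Num.sqrt (z n)) => q q0 <-; field.
  by rewrite gt_eqF.
Unshelve. all: by end_near.
Qed.

(** Dominated convergence for [J], whose majorant needs z >= 1; hence [z'], which equals z
    eventually. *)
Lemma cvg_stirling_ratio (z : nat -> R) : (forall n, 0 < z n) ->
  (z n)^-1 @[n --> \oo] --> 0 -> stirling_ratio (z n) @[n --> \oo] --> (gcst : R).
Proof.
move=> z0 cz; pose z' n := Num.max 1 (z n).
have z'1 n : 1 <= z' n by rewrite le_max lexx.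
have z'0 n : 0 < z' n by apply: lt_le_trans (z'1 n).
have cz' : (z' n)^-1 @[n --> \oo] --> 0.
  apply: (squeeze_cvgr _ (cvg_cst 0) cz); apply: nearW => n.
  by rewrite invr_ge0 (ltW (z'0 n)) lef_pV2 ?posrE// le_max lexx orbT.
apply: cvg_trans (_ : stirling_ratio (z' n) @[n --> \oo] --> _).
  apply: near_eq_cvg; apply: filterS (cvg_near_dist ltr01 cz) => n.
  rewrite subr0 gtr0_norm ?invr_gt0// invf_le1// => h.
  by rewrite /z' (max_idPr h).
under eq_cvg do rewrite stirling_ratioE//.
rewrite -(@Int_heat R 1 0)//.
apply: (Int_dct_leb (g := stirling_bound)).
- move=> n; apply: measurable_funM => //.
  apply: (measurableT_comp (measurable_gfun _ _)).
  by apply: measurable_funD => //; exact: measurable_funM.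
- by have := L1_measurable (@L1_heat R 1 0 ltr01); exact.
- by move=> u; exact: J_lim.
- exact: L1_stirling_bound.
- by move=> n u; exact: J_bound.
Qed.

End stirling.

(** * Gamma densities *)

Section kernel.
Context {R : realType}.
Notation mu := (@lebesgue_measure R).
Implicit Types s u x y z p h : R.

Lemma powRE h p : 0 < h -> h `^ p = expR (p * ln h).
Proof. by move=> h0; rewrite /powR gt_eqF. Qed.

Lemma gfunS p s y : 0 <= p -> gfun (p + 1) s y = y * gfun p s y.
Proof.
move=> p0; have [y0|y0] := leP 0 y; last by rewrite !gfun_neg// mulr0.
rewrite !gfun_pos// mulrA; congr (_ * _).
have [->|yn0] := eqVneq y 0; first by rewrite mul0r powR0// gt_eqF//; lra.
by rewrite powRD ?yn0 ?implybT// powRr1// mulrC.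
Qed.

(** The square stays in the family, which makes the integral of a squared gamma density explicit. *)
Lemma gfun_sqr p s y : gfun p s y ^+ 2 = gfun (2 * p) (2 * s) y.
Proof.
have [y0|y0] := leP 0 y; last by rewrite !gfun_neg// expr0n.
rewrite !gfun_pos// exprMn; congr (_ * _); last first.
  by rewrite expr2 -expRD; congr expR; ring.
have [->|yn0] := eqVneq y 0.
  have [->|pn0] := eqVneq p 0; first by rewrite mulr0 powRr0 expr1n.
  by rewrite !powR0// ?expr0n// mulf_neq0.
by rewrite expr2 -powRD ?yn0 ?implybT//; congr (_ `^ _); ring.
Qed.

(** On [1, 2] the integrand is at least e^(-2). *)
Lemma Gamma_gt0 z : 0 <= z -> 0 < Gamma (z + 1) :> R.
Proof.
move=> z0; rewrite GammaE//.
have l12 : L1 mu (\1_(`[1, 2]%classic : set R)).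
  have [l _] := @L1_gfun0 R 1 ltr01.
  apply: (L1_le_leb _ _ (L1Z (expR 2) l)); first exact: measurable_indic.
  move=> y; have h0 : 0 <= expR 2 * gfun 0 1 y by rewrite mulr_ge0 ?expR_ge0 ?gfun_ge0.
  rewrite indicE; case: (boolP (y \in _)) => [|_]; last by rewrite normr0.
  rewrite inE/= in_itv/= => /andP[y1 y2]; rewrite normr1 gfun_pos; last by lra.
  by rewrite powRr0 !mul1r -expRD -[leLHS]expR0 ler_expR; lra.
have e0 : 0 < expR (- 2 : R) by exact: expR_gt0.
apply: (@lt_le_trans _ _ (\int[mu]_y (expR (- 2) * \1_(`[1, 2]%classic : set R) y))).
  rewrite IntZ// mulr_gt0//.
  rewrite /Rintegral integral_indic//= setIT lebesgue_measure_itv/= lte_fin ltr1n -EFinB/=.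
  by lra.
apply: Int_le; [exact: L1Z|exact: L1_gfun1|move=> y].
rewrite indicE; case: (boolP (y \in _)) => [|_]; last by rewrite mulr0 gfun_ge0.
rewrite inE/= in_itv/= => /andP[y1 y2]; rewrite mulr1 gfun_pos; last by lra.
rewrite mul1r; apply: le_trans (_ : expR (- y) <= _); first by rewrite ler_expR lerN2.
by rewrite ler_peMl ?expR_ge0// -(powRr0 y) ler_powR.
Qed.

Lemma Gamma1 : Gamma (0 + 1) = 1 :> R.
Proof. by rewrite GammaE//; have [_ ->] := @L1_gfun0 R 1 ltr01; rewrite invr1. Qed.

Section fixed.
Variables (z h : R) (z0 : 0 <= z) (h0 : 0 < h).
Let K y : R := gamma_density (z + 1) h y.
Let k : R := (Gamma (z + 1) * h `^ (z + 1))^-1.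

Let k_gt0 : 0 < k.
Proof. by rewrite invr_gt0 mulr_gt0 ?Gamma_gt0// powR_gt0. Qed.

Let KE y : K y = k * gfun z h^-1 y.
Proof. by rewrite /K /gamma_density addrK /k /gfun (mulrC y) !mulrA. Qed.

Let ih0 : 0 < h^-1. Proof. by rewrite invr_gt0. Qed.

Lemma gamma_density_ge0 y : 0 <= gamma_density (z + 1) h y.
Proof. by rewrite -/(K y) KE mulr_ge0 ?gfun_ge0// ltW. Qed.

Lemma measurable_gamma_density : measurable_fun setT (gamma_density (z + 1) h).
Proof.
rewrite (_ : gamma_density _ _ = fun y => k * gfun z h^-1 y); last exact/funext/KE.
by apply: measurable_funM => //; exact: measurable_gfun.
Qed.

Lemma L1_gamma_density : L1 mu (gamma_density (z + 1) h).
Proof.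
rewrite (_ : gamma_density _ _ = fun y => k * gfun z h^-1 y); last exact/funext/KE.
exact/L1Z/L1_gfun.
Qed.

Let Int_k p : 0 <= p -> \int[mu]_y (k * gfun p h^-1 y) =
  k * (h `^ (p + 1) * Gamma (p + 1)).
Proof.
move=> p0; rewrite IntZ; last exact: L1_gfun.
rewrite Int_gfun// -GammaE//; congr (_ * (_ * _)).
by rewrite !powRE// lnV ?posrE//; congr expR; ring.
Qed.

Let kE : k * (h `^ (z + 1) * Gamma (z + 1)) = 1.
Proof.
by rewrite /k mulrC [_ `^ _ * _]mulrC mulfV// gt_eqF// mulr_gt0 ?Gamma_gt0// powR_gt0.
Qed.

Lemma Int_gamma_density : \int[mu]_y gamma_density (z + 1) h y = 1.
Proof. by under eq_Rintegral do rewrite -/(K _) KE; rewrite Int_k. Qed.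

Let hS p : h `^ (p + 1) = h `^ p * h.
Proof. by rewrite powRD ?(gt_eqF h0) ?implybT// powRr1// ltW. Qed.

Let z10 : 0 <= z + 1. Proof. by rewrite addr_ge0. Qed.

(** Multiplication by y raises the exponent by one, and [GammaS] evaluates the quotient of the two
    Gamma values. *)
Lemma gamma_density_mean :
  L1 mu (fun y => y * gamma_density (z + 1) h y) /\
  \int[mu]_y (y * gamma_density (z + 1) h y) = h * (z + 1).
Proof.
have e y : y * gamma_density (z + 1) h y = k * gfun (z + 1) h^-1 y.
  by rewrite -/(K y) KE gfunS// mulrCA.
split; first by rewrite (funext e); exact/L1Z/L1_gfun.
under eq_Rintegral do rewrite e; rewrite Int_k// (hS (z + 1)) GammaS//.
transitivity ((k * (h `^ (z + 1) * Gamma (z + 1))) * (h * (z + 1))); first by ring.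
by rewrite kE mul1r.
Qed.

Lemma gamma_density_sqr_mean :
  L1 mu (fun y => y ^+ 2 * gamma_density (z + 1) h y) /\
  \int[mu]_y (y ^+ 2 * gamma_density (z + 1) h y) = h ^+ 2 * ((z + 1) * (z + 2)).
Proof.
have z20 : 0 <= z + 1 + 1 by rewrite addr_ge0.
have e y : y ^+ 2 * gamma_density (z + 1) h y = k * gfun (z + 1 + 1) h^-1 y.
  by rewrite -/(K y) KE !gfunS//; ring.
split; first by rewrite (funext e); exact/L1Z/L1_gfun.
under eq_Rintegral do rewrite e.
rewrite Int_k// (hS (z + 1 + 1)) (hS (z + 1)) !GammaS//.
transitivity ((k * (h `^ (z + 1) * Gamma (z + 1))) * (h ^+ 2 * ((z + 1) * (z + 2)))); first by ring.
by rewrite kE mul1r.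
Qed.

Lemma Int_gamma_density_sqr : \int[mu]_y gamma_density (z + 1) h y ^+ 2 =
  k ^+ 2 * ((2 * h^-1) `^ (- (2 * z + 1)) * Gamma (2 * z + 1)).
Proof.
have e y : gamma_density (z + 1) h y ^+ 2 = k ^+ 2 * gfun (2 * z) (2 * h^-1) y.
  by rewrite -/(K y) KE exprMn gfun_sqr.
under eq_Rintegral do rewrite e.
have z20 : 0 <= 2 * z by rewrite mulr_ge0.
have s0 : 0 < 2 * h^-1 by rewrite mulr_gt0.
rewrite IntZ; last exact: L1_gfun.
by rewrite Int_gfun// -GammaE.
Qed.

End fixed.

Lemma stirling_ratio_gt0 z : 0 < z -> 0 < stirling_ratio z.
Proof.
move=> z0; rewrite /stirling_ratio divr_gt0 ?sqrtr_gt0// mulr_gt0 ?expR_gt0//.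
by rewrite Gamma_gt0// ltW.
Qed.

Lemma Gamma_stirling z : 0 < z ->
  Gamma (z + 1) = stirling_ratio z * Num.sqrt z * expR (z * ln z - z).
Proof.
move=> z0; rewrite /stirling_ratio divfK ?gt_eqF ?sqrtr_gt0//.
rewrite -mulrA -expRD (_ : z - z * ln z + (z * ln z - z) = 0) ?expR0 ?mulr1//.
by ring.
Qed.

(** The maximum is at y = z h: this is ln t <= t - 1 at t = y/(z h). Rewriting Gamma by
    [stirling_ratio] cancels z^z e^(-z) exactly. *)
Lemma gamma_density_sup z h y : 0 < z -> 0 < h ->
  gamma_density (z + 1) h y <= (stirling_ratio z * Num.sqrt z * h)^-1.
Proof.
move=> z0 h0; have S0 := stirling_ratio_gt0 z0.
have sz0 : 0 < Num.sqrt z by rewrite sqrtr_gt0.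
rewrite /gamma_density addrK Gamma_stirling//.
move: (stirling_ratio z) S0 => S S0.
have r0 : 0 <= (S * Num.sqrt z * h)^-1 by rewrite invr_ge0 !mulr_ge0// ltW.
 have [y0|] := ltP 0 y; last first.
  rewrite le_eqVlt => /predU1P[->|y0].
    by rewrite powR0 ?gt_eqF// mulr0 !mul0r.
  by rewrite indicE halflineE (leNgt 0 y) y0 mulr0.
rewrite indicE halflineE (ltW y0) mulr1 !powRE// !invfM -!expRN.
rewrite -!mulrA ler_wpM2l ?invr_ge0 ?(ltW S0)// ler_wpM2l ?invr_ge0 ?(ltW sz0)//.
rewrite -!expRD -[leRHS]lnK ?posrE ?invr_gt0// ler_expR lnV ?posrE//.
have yzh : 0 < y / (z * h) by rewrite divr_gt0// mulr_gt0.
have := @le_ln1Dx R (y / (z * h) - 1); rewrite (addrC 1) subrK.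
rewrite ln_div ?posrE ?mulr_gt0// lnM ?posrE// => H.
have {}H : ln y - (ln z + ln h) <= y / (z * h) - 1 by apply: H; lra.
have := ler_wpM2l (ltW z0) H.
have -> : z * (y / (z * h) - 1) = y / h - z by field; rewrite !gt_eqF.
by lra.
Qed.

Lemma gamma_density_sup0 h y : 0 < h -> gamma_density (0 + 1) h y <= h^-1.
Proof.
move=> h0; have ih : 0 <= h^-1 by rewrite invr_ge0 ltW.
rewrite /gamma_density Gamma1 addrK powRr0 mul1r mulr1 add0r powRr1 ?(ltW h0)//.
rewrite indicE halflineE; have [y0|y0] := leP 0 y; last by rewrite mulr0.
rewrite mulr1 ler_piMr// -?[leRHS]expR0 ?ler_expR ?oppr_le0 ?divr_ge0// ?(ltW h0)//.
Qed.

Lemma Int_gamma_density_sqr_stirling z h : 0 < z -> 0 < h ->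
  \int[mu]_y gamma_density (z + 1) h y ^+ 2 =
  stirling_ratio (2 * z) / stirling_ratio z ^+ 2 * (Num.sqrt (2 * z) / (2 * z * h)).
Proof.
move=> z0 h0; have S0 := stirling_ratio_gt0 z0; have z20 : 0 < 2 * z by rewrite mulr_gt0.
have sz0 : 0 < Num.sqrt z by rewrite sqrtr_gt0.
rewrite Int_gamma_density_sqr ?(ltW z0)// (Gamma_stirling z0) (Gamma_stirling z20).
have ih : 0 < 2 * h^-1 by rewrite mulr_gt0// invr_gt0.
rewrite !powRE// !lnM ?posrE ?invr_gt0// lnV ?posrE//.
move: (stirling_ratio z) (stirling_ratio (2 * z)) S0 => S S2 S0.
rewrite !invfM !exprMn -!expRN.
have szz : (Num.sqrt z)^-1 ^+ 2 = z^-1 by rewrite exprVn sqr_sqrtr// ltW.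
rewrite szz.
have ee e : expR e ^+ 2 = expR (2 * e) :> R by rewrite expr2 -expRD; congr expR; ring.
rewrite !ee.
set e1 := expR _; set e2 := expR _; set e3 := expR _; set e4 := expR _.
(* The factors z^z and e^z and the powers of 2 and h cancel, except for one factor 1/(2h). *)
have ex : e1 * e2 * e3 * e4 = 2^-1 * h^-1.
  rewrite /e1 /e2 /e3 /e4 -!expRD.
  rewrite -[RHS]lnK ?posrE ?mulr_gt0 ?invr_gt0// lnM ?posrE ?invr_gt0// !lnV ?posrE//.
  by congr expR; ring.
transitivity (S2 / S ^+ 2 * (Num.sqrt (2 * z) / z) * (e1 * e2 * e3 * e4)); first by field; rewrite !gt_eqF.
by rewrite ex; field; rewrite !gt_eqF.
Qed.

Lemma Int_gamma_density_sqr0 h : 0 < h ->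
  \int[mu]_y gamma_density (0 + 1) h y ^+ 2 = (2 * h)^-1.
Proof.
move=> h0; rewrite Int_gamma_density_sqr// mulr0 Gamma1 add0r.
rewrite powR_inv1 ?powRr1 ?(ltW h0)// ?mulr_ge0 ?invr_ge0 ?(ltW h0)//.
by field; rewrite gt_eqF.
Qed.

End kernel.

(** * Functions on the half-line *)

Section functions_on_halfline.
Context {R : realType}.
Implicit Types (g : R -> R) (x y z s t : R).

(** Restricted to the half-line so that it survives the extension by zero, which may jump at 0. *)
Definition cts_at g x := forall e, 0 < e ->
  exists2 dl : R, 0 < dl & forall y, 0 <= y -> `|y - x| < dl -> `|g y - g x| <= e.

Lemma halflineP y : halfline y <-> 0 <= y.
Proof. by rewrite /halfline /= in_itv/= andbT. Qed.

Lemma within_cts g x : 0 <= x -> {within halfline, continuous g} -> cts_at g x.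
Proof.
move=> x0 /subspace_continuousP /(_ x ((halflineP x).2 x0)) /cvgrPdist_le cg e e0.
have := cg e e0; rewrite near_withinE => /nbhs_normP[dl dl0 h].
exists dl => // y y0 yx; rewrite distrC; apply: h; last exact/halflineP.
by rewrite /ball_/= distrC.
Qed.

Lemma cts_within g : (forall x, 0 <= x -> cts_at g x) -> {within halfline, continuous g}.
Proof.
move=> cg; apply/subspace_continuousP => x /halflineP x0; apply/cvgrPdist_le => e e0.
have [dl dl0 h] := cg x x0 e e0; rewrite near_withinE; apply/nbhs_normP; exists dl => // y.
by rewrite /ball_/= => yx /halflineP y0; rewrite distrC; apply: h; rewrite // distrC.
Qed.

Lemma derivative_dist g g' x : 0 <= x -> derivative_on_halfline g g' -> forall e, 0 < e ->
  exists2 dl : R, 0 < dl & forall z, 0 <= z -> z != x -> `|z - x| < dl ->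
    `|(g z - g x) / (z - x) - g' x| <= e.
Proof.
move=> x0 /(_ x x0) /cvgrPdist_le dg e e0.
have := dg e e0; rewrite near_withinE /dnbhs near_withinE => /nbhs_normP[dl dl0 h].
exists dl => // z z0 zx zd; rewrite distrC; apply: h => //; last exact/halflineP.
by rewrite /ball_/= distrC.
Qed.

Lemma derivative_cts g g' x : 0 <= x -> derivative_on_halfline g g' -> cts_at g x.
Proof.
move=> x0 dg e e0; have [dl dl0 h] := derivative_dist x0 dg ltr01.
pose L := `|g' x| + 1; have L0 : 0 < L by rewrite ltr_wpDl.
exists (Num.min dl (e / L)); first by rewrite lt_min dl0 divr_gt0.
move=> z z0; rewrite lt_min => /andP[zd ze].
have [->|zx] := eqVneq z x; first by rewrite subrr normr0 ltW.
have zx0 : z - x != 0 by rewrite subr_eq0.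
have -> : g z - g x = (g z - g x) / (z - x) * (z - x) by rewrite divfK.
have := h z z0 zx zd.
move: (_ / _) => u hu; rewrite normrM.
have uL : `|u| <= L.
  rewrite -[u](subrK (g' x)); apply: le_trans (ler_normD _ _) _.
  by rewrite /L addrC lerD2l.
move: ze; rewrite ltr_pdivlMr// => /ltW ze; apply: le_trans ze.
by rewrite mulrC ler_wpM2l.
Qed.

Lemma derivative_is_derive g g' s : 0 < s -> derivative_on_halfline g g' ->
  is_derive s 1 g (g' s).
Proof.
move=> s0 dg; have c : (h^-1 *: ((g \o shift s) (h *: 1) - g s)) @[h --> 0^'] --> g' s.
  apply/cvgrPdist_le => e e0; have [dl dl0 h] := derivative_dist (ltW s0) dg e0.
  rewrite /dnbhs near_withinE; apply/nbhs_normP; exists (Num.min dl s).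
    by rewrite /= lt_min dl0.
  move=> t; rewrite /ball_/= sub0r normrN lt_min => /andP[td ts] /eqP t0.
  have e1 : t *: (1 : R) + s = s + t by rewrite /GRing.scale/= mulr1 addrC.
  have := h (s + t); rewrite (addrC s) addrK addrC => h1.
  rewrite distrC /GRing.scale/= mulr1 mulrC (addrC t); apply: h1 => //.
    by move: ts; rewrite ltr_norml => /andP[]; lra.
  by rewrite -subr_eq0 addrAC subrr add0r; exact/eqP.
by apply: DeriveDef; [exact: cvgP c|exact: cvg_lim c].
Qed.

(** At 0 the derivative is one-sided; it enters through continuity up to the endpoint, while in the
    interior it is an ordinary derivative. *)
Lemma halfline_lip g g' a b (M : R) : 0 <= a -> a <= b -> derivative_on_halfline g g' ->
  (forall s, a < s < b -> `|g' s| <= M) -> `|g b - g a| <= M * (b - a).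
Proof.
move=> a0 ab dg bg; apply: (@mvt_bound_within R g g') => //.
- move=> s /andP[as_ _]; apply: derivative_is_derive dg; exact: le_lt_trans as_.
- have cg x (x0 : 0 <= x) : cts_at g x by exact: derivative_cts dg.
  have := cts_within cg.
  apply: continuous_subspaceW => y /=; rewrite in_itv/= => /andP[ay _].
  by apply/halflineP; exact: le_trans ay.
Qed.

Lemma halfline_lip_sym g g' x y (M : R) : 0 <= x -> 0 <= y -> derivative_on_halfline g g' ->
  (forall s, 0 <= s -> `|s - x| <= `|y - x| -> `|g' s| <= M) -> `|g y - g x| <= M * `|y - x|.
Proof.
move=> x0 y0 dg bg; have [xy|/ltW yx] := leP x y.
  rewrite (@ger0_norm _ (y - x)) ?subr_ge0//; apply: (halfline_lip x0 xy dg) => s /andP[xs sy].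
  by apply: bg; [lra|rewrite !ger0_norm; lra].
rewrite distrC [X in _ * X]distrC (@ger0_norm _ (x - y)) ?subr_ge0//.
apply: (halfline_lip y0 yx dg) => s /andP[xs sy].
by apply: bg; [lra|rewrite !ler0_norm; lra].
Qed.

(** Two Lipschitz bounds: the derivative of [p] is [g' t - g' x], itself Lipschitz with constant M.
    The factor 1/2 is given up. *)
Lemma halfline_taylor g g' g'' x y (M : R) : 0 <= x -> 0 <= y ->
  derivative_on_halfline g g' -> derivative_on_halfline g' g'' ->
  (forall s, 0 <= s -> `|g'' s| <= M) ->
  `|g y - g x - g' x * (y - x)| <= M * (y - x) ^+ 2.
Proof.
move=> x0 y0 dg dg' bg.
pose p t := g t - g' x * t.
have dp : derivative_on_halfline p (fun t => g' t - g' x).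
  move=> t t0; apply/cvgrPdist_le => e e0; have [dl dl0 h] := derivative_dist t0 dg e0.
  rewrite near_withinE /dnbhs near_withinE; apply/nbhs_normP; exists dl => // z.
  rewrite /ball_/= => zd zt /halflineP z0; have := h z z0 zt; rewrite distrC => /(_ zd).
  rewrite distrC; congr (`|_| <= _); rewrite /p; field.
  by rewrite subr_eq0.
have -> : g y - g x - g' x * (y - x) = p y - p x by rewrite /p; ring.
rewrite -(real_normK (num_real (y - x))) expr2 mulrA.
apply: (halfline_lip_sym x0 y0 dp) => s s0 sx.
apply: le_trans (_ : M * `|s - x| <= _).
  by apply: (halfline_lip_sym x0 s0 dg') => v v0 _; exact: bg.
by rewrite ler_wpM2l//; exact: le_trans (bg 0 (lexx _)).
Qed.

End functions_on_halfline.

(** * Approximate identities and the deterministic bias *)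

Section localization.
Context {R : realType}.
Notation mu := (@lebesgue_measure R).

(** An approximate identity of mass kappa: near x continuity of p applies, and at distance at least
    [dl] the difference is bounded by 2 M (y - x)^2 / dl^2, whose integral against [L n] tends to
    0. *)
Lemma localization (L : nat -> R -> R) (p : R -> R) (x kappa M : R) : 0 <= x ->
  (forall n y, 0 <= L n y) -> (forall n y, y < 0 -> L n y = 0) ->
  (forall n, L1 mu (L n)) -> (forall n, L1 mu (fun y => (y - x) ^+ 2 * L n y)) ->
  \int[mu]_y L n y @[n --> \oo] --> kappa ->
  \int[mu]_y ((y - x) ^+ 2 * L n y) @[n --> \oo] --> 0 ->
  measurable_fun setT p -> (forall y, `|p y| <= M) -> cts_at p x ->
  \int[mu]_y (p y * L n y) @[n --> \oo] --> p x * kappa.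
Proof.
move=> x0 L0 Ln lL lL2 cL cL2 mp pM cp.
have lpL n : L1 mu (fun y => p y * L n y) by exact: L1_bndM_leb.
suff h : \int[mu]_y (p y * L n y) - p x * \int[mu]_y L n y @[n --> \oo] --> 0.
  have h2 : p x * \int[mu]_y L n y @[n --> \oo] --> p x * kappa.
    by apply: cvgM => //; exact: cvg_cst.
  exact: cvg_sub0 h h2.
have M0 : 0 <= M by exact: le_trans (pM 0).
apply/cvgr0Pnorm_le => e e0.
pose k1 := `|kappa| + 1; have k10 : 0 < k1 by rewrite ltr_wpDl.
have e1 : 0 < e / 2 / k1 by rewrite !divr_gt0.
have [dl dl0 hd] := cp _ e1; pose C := 2 * M / dl ^+ 2.
have d20 : 0 < dl ^+ 2 by rewrite exprn_gt0.
have C0 : 0 <= C by rewrite divr_ge0 ?mulr_ge0// ltW.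
have e2 : 0 < e / 2 / (C + 1) by rewrite !divr_gt0// ltr_wpDl.
have n1 := cvg_near_dist ltr01 cL; have n2 := cvg_near_dist e2 cL2.
near=> n.
have h1 : `|\int[mu]_y L n y - kappa| <= 1 by near: n.
have h2 : `|\int[mu]_y ((y - x) ^+ 2 * L n y) - 0| <= e / 2 / (C + 1) by near: n.
rewrite -IntZ// -IntB//; last exact: L1Z.
apply: le_trans (_ : \int[mu]_y (e / 2 / k1 * L n y + C * ((y - x) ^+ 2 * L n y)) <= _).
  apply: Int_abs_le.
  - by apply: L1B => //; exact: L1Z.
  - by apply: L1D; exact: L1Z.
  move=> y; have [y0|y0] := leP 0 y; last by rewrite Ln// !mulr0 subrr normr0 addr0.
  rewrite -mulrBl normrM (ger0_norm (L0 n y)) mulrA -mulrDl ler_wpM2r//.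
  have [yd|yd] := ltP `|y - x| dl.
    by apply: le_trans (hd y y0 yd) _; rewrite lerDl mulr_ge0// sqr_ge0.
  apply: ler_wpDl; first exact: ltW.
  apply: le_trans (_ : 2 * M <= _).
    by apply: le_trans (ler_normB _ _) _; have := pM x; have := pM y; lra.
  rewrite /C mulrAC ler_pdivlMr// ler_wpM2l ?mulr_ge0//.
  by rewrite -(real_normK (num_real (y - x))) lerXn2r ?nnegrE// ltW.
rewrite IntD; [|exact: L1Z|exact: L1Z]; rewrite !IntZ//.
have I0 : 0 <= \int[mu]_y ((y - x) ^+ 2 * L n y).
  by apply: Int_ge0 => y; rewrite mulr_ge0// sqr_ge0.
have a1 : e / 2 / k1 * \int[mu]_y L n y <= e / 2.
  apply: le_trans (_ : e / 2 / k1 * k1 <= _); last by rewrite divfK// gt_eqF.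
  rewrite ler_wpM2l ?(ltW e1)//.
  by move: h1; rewrite ler_norml => /andP[_]; have := ler_norm kappa; rewrite /k1; lra.
have a2 : C * \int[mu]_y ((y - x) ^+ 2 * L n y) <= e / 2.
  move: h2; rewrite subr0 ger0_norm// ler_pdivlMr ?ltr_wpDl//; nra.
by lra.
Unshelve. all: by end_near.
Qed.

(** (r y - r x) f y is r1 f(x) (y - x), plus a Taylor remainder times f y, plus r1 (y - x)(f y - f
    x). The linear part sees only the mean of K about x, where signs cancel; the rest is O((y -
    x)^2). *)
Lemma bias_bound (r f : R -> R) (x r1 M A B : R) : 
  measurable_fun setT r -> measurable_fun setT f ->
  (exists N, forall y, `|r y| <= N) -> (forall y, `|f y| <= B) ->
  (forall y, 0 <= y -> `|r y - r x - r1 * (y - x)| <= M * (y - x) ^+ 2) ->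
  (forall y, 0 <= y -> `|f y - f x| <= A * `|y - x|) ->
  forall (K : R -> R) (b : R), (forall y, 0 <= K y) -> (forall y, y < 0 -> K y = 0) ->
  L1 mu K -> L1 mu (fun y => (y - x) * K y) -> L1 mu (fun y => (y - x) ^+ 2 * K y) ->
  `|\int[mu]_y ((y - x) * K y)| <= b -> \int[mu]_y ((y - x) ^+ 2 * K y) <= b ->
  `|\int[mu]_y ((r y - r x) * K y * f y)| <= (`|r1 * f x| + (M * B + `|r1| * A)) * b.
Proof.
move=> mr mf [N rN] fB tr tf K b K0 Kn lK lK1 lK2 b1 b2.
have B0 : 0 <= B by exact: le_trans (fB 0).
(* The signs of M and A are read off [tr] and [tf] at a point of the half-line different from x. *)
have C0 : 0 <= M * B + `|r1| * A.
  have t1 := tr (x + 1); have t2 := tf (x + 1).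
  have [x0|x0] := leP 0 (x + 1).
    move: (t1 x0) (t2 x0); rewrite (addrC x) addrK expr1n normr1 !mulr1 => s1 s2.
    by rewrite addr_ge0// mulr_ge0//; [exact: le_trans s1|exact: le_trans s2].
  have := tr 0 (lexx _); have := tf 0 (lexx _).
  rewrite sub0r normrN => s2 s1.
  have x00 : 0 < - x by lra.
  have xn : 0 < `|x| by rewrite normr_gt0; apply/eqP; lra.
  rewrite addr_ge0// mulr_ge0//.
    by rewrite -(pmulr_lge0 _ (_ : 0 < (- x) ^+ 2)) ?exprn_gt0//; exact: le_trans s1.
  by rewrite -(pmulr_lge0 _ xn); exact: le_trans s2.
have mrx : measurable_fun setT (fun y => (r y - r x) * f y).
  by apply: measurable_funM => //; exact: measurable_funB.
have lI : L1 mu (fun y => (r y - r x) * K y * f y).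
  rewrite (_ : (fun y => _) = fun y => ((r y - r x) * f y) * K y); last first.
    by apply/funext => y; ring.
  apply: (L1_bndM_leb (M := (N + N) * B)) => // y; rewrite normrM ler_pM//.
  by apply: le_trans (ler_normB _ _) _; rewrite lerD.
pose E y := (r y - r x) * K y * f y - r1 * f x * ((y - x) * K y).
have lE : L1 mu E by apply: L1B => //; exact: L1Z.
have -> : \int[mu]_y ((r y - r x) * K y * f y) =
    r1 * f x * \int[mu]_y ((y - x) * K y) + \int[mu]_y E y.
  rewrite /E IntB//; last exact: L1Z.
  by rewrite IntZ//; ring.
apply: le_trans (ler_normD _ _) _; rewrite mulrDl normrM lerD// ?ler_wpM2l//.
apply: le_trans (_ : \int[mu]_y ((M * B + `|r1| * A) * ((y - x) ^+ 2 * K y)) <= _); last first.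
  by rewrite IntZ// ler_wpM2l.
apply: Int_abs_le => //; first exact: L1Z.
move=> y; have [y0|y0] := leP 0 y; last by rewrite /E Kn// !(mul0r, mulr0) subrr normr0.
have -> : E y = ((r y - r x - r1 * (y - x)) * f y + r1 * (y - x) * (f y - f x)) * K y.
  by rewrite /E; ring.
rewrite normrM (ger0_norm (K0 y)) mulrA ler_wpM2r//.
apply: le_trans (ler_normD _ _) _; rewrite !normrM mulrDl lerD//.
  rewrite mulrAC; apply: ler_pM => //; exact: tr.
rewrite -mulrA -[leRHS]mulrA ler_wpM2l//.
by rewrite -(real_normK (num_real (y - x))) expr2 mulrCA ler_wpM2l// tf.
Qed.

End localization.

(** * Localization of the gamma kernel *)

(* c n is the width of the kernel at x: sqrt (h n) if x > 0 and h n if x = 0. *)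
Record localizing_kernel (R : realType) (K : nat -> R -> R) (h c : nat -> R) (x kappa A : R) : Prop := {
  lk_measurable : forall n, measurable_fun setT (K n);
  lk_ge0 : forall n y, 0 <= K n y;
  lk_neg : forall n y, y < 0 -> K n y = 0;
  lk_L1 : forall n, L1 lebesgue_measure (K n);
  lk_Int : forall n, \int[lebesgue_measure]_y K n y = 1;
  lk_c : forall n, 0 < c n;
  lk_sup : forall n y, c n * K n y <= A;
  lk_L1_mean : forall n, L1 lebesgue_measure (fun y => (y - x) * K n y);
  lk_mean : forall n, `|\int[lebesgue_measure]_y ((y - x) * K n y)| <= A * h n;
  lk_L1_var : forall n, L1 lebesgue_measure (fun y => (y - x) ^+ 2 * K n y);
  lk_var : forall n, \int[lebesgue_measure]_y ((y - x) ^+ 2 * K n y) <= A * h n;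
  lk_kappa : c n * \int[lebesgue_measure]_y (K n y ^+ 2) @[n --> \oo] --> kappa }.

Section gamma_kernel_localizes.
Context {R : realType}.
Notation mu := (@lebesgue_measure R).
Variables (h : nat -> R) (x : R).
Hypothesis h0 : forall n, 0 < h n.
Hypothesis ch : h n @[n --> \oo] --> 0.
Hypothesis x0 : 0 <= x.

Lemma cvg_bound (u : nat -> R) (l : R) : u n @[n --> \oo] --> l ->
  exists2 B : R, 0 <= B & forall n, `|u n| <= B.
Proof.
move=> cu; have /cvg_seq_bounded[B [Br hB]] : cvgn u by exact: cvgP cu.
have h1 := hB (Num.max B 0 + 1).
exists (Num.max B 0 + 1); first by rewrite addr_ge0// le_max lexx orbT.
by move=> n; apply: h1 => //; rewrite ltr_pwDr// le_max lexx.
Qed.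

Let z n : R := x / h n.
Let z0 n : 0 <= z n. Proof. by rewrite divr_ge0// ltW. Qed.
Let zh n : h n * z n = x. Proof. by rewrite /z mulrCA mulfV ?mulr1// gt_eqF. Qed.

Let mean n : L1 mu (fun y => (y - x) * gamma_kernel h n x y) /\
  \int[mu]_y ((y - x) * gamma_kernel h n x y) = h n.
Proof.
have [l e] := gamma_density_mean (z0 n) (h0 n).
have l1 := L1_gamma_density (z0 n) (h0 n); have e1 := Int_gamma_density (z0 n) (h0 n).
have E y : (y - x) * gamma_kernel h n x y =
    y * gamma_density (z n + 1) (h n) y - x * gamma_density (z n + 1) (h n) y.
  by rewrite mulrBl.
split; first by rewrite (funext E); apply: L1B => //; exact: L1Z.
under eq_Rintegral do rewrite E.
rewrite IntB//; last exact: L1Z.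
by rewrite IntZ// e e1 mulrDr zh; ring.
Qed.

Let var n : L1 mu (fun y => (y - x) ^+ 2 * gamma_kernel h n x y) /\
  \int[mu]_y ((y - x) ^+ 2 * gamma_kernel h n x y) = (x + 2 * h n) * h n.
Proof.
have [l e] := gamma_density_mean (z0 n) (h0 n).
have [l2 e2] := gamma_density_sqr_mean (z0 n) (h0 n).
have l1 := L1_gamma_density (z0 n) (h0 n); have e1 := Int_gamma_density (z0 n) (h0 n).
set g := gamma_density (z n + 1) (h n) in l e l2 e2 l1 e1.
have E y : (y - x) ^+ 2 * gamma_kernel h n x y =
    (y ^+ 2 * g y - (2 * x) * (y * g y)) + x ^+ 2 * g y.
  by rewrite /g /gamma_kernel -/(z n); ring.
have lx := L1Z (2 * x) l; have lxx := L1Z (x ^+ 2) l1.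
split; first by rewrite (funext E); apply: L1D => //; exact: L1B.
under eq_Rintegral do rewrite E.
rewrite IntD//; last exact: L1B.
rewrite IntB// !IntZ// e e1 e2.
by have := zh n; move: (z n) => t <-; ring.
Qed.

Lemma gamma_kernel_localizing (c : nat -> R) (kappa A : R) : (forall n, 0 < c n) ->
  (forall n y, c n * gamma_kernel h n x y <= A) ->
  c n * \int[mu]_y (gamma_kernel h n x y ^+ 2) @[n --> \oo] --> kappa ->
  exists A', localizing_kernel (fun n => gamma_kernel h n x) h c x kappa A'.
Proof.
move=> c0 cA ck; have [H H0 hH] := cvg_bound ch.
have A0 : 0 <= A.
  apply: le_trans (cA 0%N 0); rewrite mulr_ge0 ?(ltW (c0 _))//.
  exact: gamma_density_ge0 (z0 0%N) (h0 0%N) _.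
(* H bounds the bandwidths: 1 serves the mean h, x + 2 H the second moment (x + 2 h) h, and A the
   supremum. *)
exists (1 + x + 2 * H + A); split => //.
- by move=> n; exact: measurable_gamma_density.
- by move=> n y; exact: gamma_density_ge0 (z0 n) (h0 n) y.
- move=> n y y0; rewrite /gamma_kernel /gamma_density indicE halflineE (leNgt 0 y) y0.
  by rewrite mulr0.
- by move=> n; exact: L1_gamma_density (z0 n) (h0 n).
- by move=> n; exact: Int_gamma_density (z0 n) (h0 n).
- by move=> n y; apply: le_trans (cA n y) _; rewrite lerDr !addr_ge0// mulr_ge0.
- by move=> n; have [] := mean n.
- move=> n; have [_ ->] := mean n; rewrite gtr0_norm// ler_peMl ?(ltW (h0 n))//.
  by rewrite -!addrA lerDl !addr_ge0// mulr_ge0.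
- by move=> n; have [] := var n.
- move=> n; have [_ ->] := var n; rewrite ler_wpM2r ?(ltW (h0 n))//.
  by have := le_trans (ler_norm _) (hH n); lra.
Qed.

(** Stirling's formula at z = x/h and at 2z, both tending to infinity. The supremum is about (2 pi x
    h)^(-1/2), and kappa = (2 pi)^(-1/2) (2 x)^(-1/2). *)
Lemma gamma_kernel_localizing_pos : 0 < x ->
  exists A, localizing_kernel (fun n => gamma_kernel h n x) h (fun n => Num.sqrt (h n)) x
    (2 * Num.sqrt (pi * x))^-1 A.
Proof.
move=> xp; have zp n : 0 < z n by rewrite divr_gt0.
have z2p n : 0 < 2 * z n by rewrite mulr_gt0.
have sh n : 0 < Num.sqrt (h n) by rewrite sqrtr_gt0.
have shh n : Num.sqrt (h n) ^+ 2 = h n by rewrite sqr_sqrtr// ltW.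
have sz n : Num.sqrt (z n) = Num.sqrt x / Num.sqrt (h n).
  by rewrite sqrtrM ?(ltW xp)// sqrtrV// ltW.
have sx : 0 < Num.sqrt x by rewrite sqrtr_gt0.
have cz : (z n)^-1 @[n --> \oo] --> 0.
  rewrite -(mul0r (x^-1)); under eq_cvg do rewrite /z invf_div.
  by apply: cvgM => //; exact: cvg_cst.
have cz2 : (2 * z n)^-1 @[n --> \oo] --> 0.
  rewrite -(mulr0 (2^-1)); under eq_cvg do rewrite invfM.
  by apply: cvgM => //; exact: cvg_cst.
have S1 := cvg_stirling_ratio zp cz; have S2 := cvg_stirling_ratio z2p cz2.
have g0 := @gcst_gt0 R.
have iS : (stirling_ratio (z n))^-1 @[n --> \oo] --> gcst^-1 by apply: cvgV => //; rewrite gt_eqF.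
have [B B0 hB] := cvg_bound iS.
apply: (gamma_kernel_localizing (A := B / Num.sqrt x)) => //.
  move=> n y; have S0 := stirling_ratio_gt0 (zp n).
  have := gamma_density_sup y (zp n) (h0 n); rewrite sz => le1.
  apply: le_trans (ler_wpM2l (ltW (sh n)) le1) _.
  have -> : Num.sqrt (h n) * (stirling_ratio (z n) * (Num.sqrt x / Num.sqrt (h n)) * h n)^-1
      = (stirling_ratio (z n))^-1 / Num.sqrt x.
    by rewrite -{3}shh; field; rewrite !gt_eqF.
  rewrite ler_wpM2r ?invr_ge0 ?(ltW sx)//.
  by apply: le_trans (hB n); exact: ler_norm.
have e n : Num.sqrt (h n) * \int[mu]_y (gamma_kernel h n x y ^+ 2) =
    stirling_ratio (2 * z n) * (stirling_ratio (z n))^-1 ^+ 2 * (Num.sqrt (2 * x))^-1.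
  rewrite /gamma_kernel -/(z n) Int_gamma_density_sqr_stirling//.
  have -> : Num.sqrt (2 * z n) = Num.sqrt (2 * x) / Num.sqrt (h n).
    by rewrite /z mulrA sqrtrM ?mulr_ge0// sqrtrV// ltW.
  have s2x : 0 < Num.sqrt (2 * x) by rewrite sqrtr_gt0 mulr_gt0.
  have -> : 2 * z n * h n = Num.sqrt (2 * x) ^+ 2.
    by rewrite sqr_sqrtr ?mulr_ge0// -mulrA (mulrC (z n)) zh.
  by field; rewrite !gt_eqF// stirling_ratio_gt0.
under eq_cvg do rewrite e.
have -> : (2 * Num.sqrt (pi * x))^-1 = gcst * gcst^-1 ^+ 2 * (Num.sqrt (2 * x))^-1 :> R.
  have -> : gcst * gcst^-1 ^+ 2 = gcst^-1 :> R by field; rewrite gt_eqF.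
  rewrite -invfM; congr (_^-1); rewrite /gcst -sqrtrM; last by rewrite mulrn_wge0// pi_ge0.
  rewrite (_ : (2 : R) = Num.sqrt (2 ^+ 2)); last by rewrite sqrtr_sqr ger0_norm.
  rewrite -sqrtrM ?sqr_ge0// -mulr_natl sqrtr_sqr ger0_norm//; congr Num.sqrt; ring.
apply: cvgM; last exact: cvg_cst.
apply: cvgM; first exact: S2.
by rewrite expr2; under eq_cvg do rewrite expr2; exact: cvgM.
Qed.

(** At x = 0 the kernel is the exponential density of mean h, and h times the integral of its square
    is exactly 1/2 for every n. *)
Lemma gamma_kernel_localizing_0 : x = 0 ->
  exists A, localizing_kernel (fun n => gamma_kernel h n x) h h x 2^-1 A.
Proof.
move=> xe; have e n : gamma_kernel h n x = gamma_density (0 + 1) (h n).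
  by rewrite /gamma_kernel xe mul0r.
apply: (gamma_kernel_localizing (A := 1)) => //.
  move=> n y; rewrite e; apply: le_trans (ler_wpM2l (ltW (h0 n)) (gamma_density_sup0 y (h0 n))) _.
  by rewrite mulfV// gt_eqF.
under eq_cvg do rewrite e Int_gamma_density_sqr0// invfM mulrCA mulfV ?mulr1 ?gt_eqF//.
exact: cvg_cst.
Qed.

End gamma_kernel_localizes.

(** * Kernel averages *)

Lemma cvg0_sqr (R : realType) (u v : nat -> R) : (forall n, 0 <= u n) ->
  (forall n, u n ^+ 2 <= v n) -> v n @[n --> \oo] --> 0 -> u n @[n --> \oo] --> 0.
Proof.
move=> u0 uv cv.
apply: (cvg0_le u0 _ (cvg_sqrt0 cv)); apply: nearW => n.
by rewrite -[leLHS]ger0_norm// -sqrtr_sqr ler_wsqrtr.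
Qed.

Lemma cts_atM (R : realType) (f g : R -> R) (x : R) : cts_at f x -> cts_at g x ->
  cts_at (fun y => f y * g y) x.
Proof.
move=> cf cg e e0.
pose a := `|f x| + 1; pose b := `|g x| + 1.
have a0 : 0 < a by rewrite ltr_wpDl.
have b0 : 0 < b by rewrite ltr_wpDl.
have e1 : 0 < Num.min 1 (e / 2 / b) by rewrite lt_min ltr01 !divr_gt0.
have e2 : 0 < e / 2 / a by rewrite !divr_gt0.
have [d1 d10 h1] := cf _ e1; have [d2 d20 h2] := cg _ e2.
exists (Num.min d1 d2); first by rewrite lt_min d10.
move=> y y0; rewrite lt_min => /andP[yd1 yd2].
have := h1 y y0 yd1; rewrite le_min => /andP[k1 k2]; have k3 := h2 y y0 yd2.
have -> : f y * g y - f x * g x = f y * (g y - g x) + (f y - f x) * g x by ring.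
apply: le_trans (ler_normD _ _) _; rewrite !normrM.
have fa : `|f y| <= a.
  rewrite -[f y](subrK (f x)); apply: le_trans (ler_normD _ _) _.
  by rewrite /a addrC lerD2l.
have -> : e = a * (e / 2 / a) + e / 2 / b * b by field; rewrite !gt_eqF.
by apply: lerD; apply: ler_pM => //; rewrite /b lerDl.
Qed.

Lemma cvg0D (R : realType) (u v : nat -> R) : u n @[n --> \oo] --> 0 ->
  v n @[n --> \oo] --> 0 -> u n + v n @[n --> \oo] --> 0.
Proof. by move=> cu cv; rewrite -[X in _ --> X](addr0 0); exact: cvgD. Qed.

Lemma cvg0Z (R : realType) (a : R) (u : nat -> R) : u n @[n --> \oo] --> 0 ->
  a * u n @[n --> \oo] --> 0.
Proof. by move=> cu; rewrite -(mulr0 a); apply: cvgM => //; exact: cvg_cst. Qed.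

Lemma d0_cst d (T : measurableType d) (R : realType) (P : probability T R) (a : R) :
  d0 P (cst a) <= `|a|.
Proof.
apply: le_trans (d0_le_Int (L1_cst P a)) _.
by rewrite (_ : (fun w => _) = cst `|a|) ?Int_cst.
Qed.

Section weighted_averages.
Context d (T : measurableType d) (R : realType) (P : probability T R).
Notation mu := (@lebesgue_measure R).
Variables (F : nat -> set (set T)) (X : nat -> T -> R) (q : nat -> T -> R -> R).
Variables (f : R -> R) (B : R).
Hypothesis subF : forall k, <<s F k>> `<=` measurable.
Hypothesis monoF : forall j k, (j <= k)%N -> <<s F j>> `<=` <<s F k>>.
Hypothesis X_adapted : forall j k, (j < k)%N -> gmeas (F k) (X j).
Hypothesis mq : forall k, measurable_fun setT
  ((fun z => q k z.1 z.2) : g_sigma_algebraType (F k) * R -> R).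
Hypothesis q0 : forall k w y, 0 <= q k w y.
Hypothesis hq : forall k A B, <<s F k>> A -> measurable B ->
  P (A `&` X k @^-1` B) = (\int[P]_(w in A) \int[mu]_(y in B) (q k w y)%:E)%E.
Hypothesis f0 : forall y, 0 <= f y.
Hypothesis lf : L1 mu f.
Hypothesis hf : forall k B, measurable B ->
  P (X k @^-1` B) = (\int[mu]_(y in B) (f y)%:E)%E.
Hypothesis fB : forall y, `|f y| <= B.

Let mX k : measurable_fun setT (X k).
Proof. by have h := @X_adapted _ _ (ltnSn k); exact: gmeas_measurable (@subF _) h. Qed.

Let avg n (g : R -> R) w := n%:R^-1 * \sum_(k < n) g (X k w).

(** One hypothesis for each error: the variance of the martingale part, the predictable part, the
    deterministic limit. *)
Lemma d0_average (g : nat -> R -> R) (N : nat -> R) (l : R) :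
  (forall n, measurable_fun setT (g n)) -> (forall n y, `|g n y| <= N n) ->
  n%:R^-1 * \int[mu]_y (g n y ^+ 2 * f y) @[n --> \oo] --> 0 ->
  d0 P (fun w => n%:R^-1 * (\sum_(k < n) cmean (q k) (g n) w) - \int[mu]_y (g n y * f y))
    @[n --> \oo] --> 0 ->
  \int[mu]_y (g n y * f y) @[n --> \oo] --> l ->
  d0 P (fun w => avg n (g n) w - l) @[n --> \oo] --> 0.
Proof.
move=> mg gN v0 p0 cl.
have h1 n := d0_mart_average subF monoF X_adapted mq q0 hq f0 lf hf (mg n) (gN n) n.
have c1 := cvg0_sqr (fun n => d0_ge0 P _) h1 v0.
have c3 : `|\int[mu]_y (g n y * f y) - l| @[n --> \oo] --> 0.
  by apply/norm_cvg0P; rewrite -(subrr l); apply: cvgB => //; exact: cvg_cst.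
apply: (cvg0_le (fun n => d0_ge0 P _) _ (cvg0D (cvg0D c1 p0) c3)); apply: nearW => n.
have mgX k : measurable_fun setT (fun w => g n (X k w)) by exact: measurableT_comp.
have mc k : measurable_fun setT (fun w => cmean (q k) (g n) w).
  by have h := gmeas_cmean (@mq k) (mg n); exact: gmeas_measurable (@subF k) h.
have m1 : measurable_fun setT (fun w => n%:R^-1 * \sum_(k < n) (g n (X k w) - cmean (q k) (g n) w)).
  by apply: measurable_funM => //; apply: measurable_sum => k; exact: measurable_funB.
have m2 : measurable_fun setT (fun w => n%:R^-1 * (\sum_(k < n) cmean (q k) (g n) w) - \int[mu]_y (g n y * f y)).
  by apply: measurable_funB => //; apply: measurable_funM => //; exact: measurable_sum.
have e w : avg n (g n) w - l = (n%:R^-1 * \sum_(k < n) (g n (X k w) - cmean (q k) (g n) w) +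
    (n%:R^-1 * (\sum_(k < n) cmean (q k) (g n) w) - \int[mu]_y (g n y * f y))) +
    cst (\int[mu]_y (g n y * f y) - l) w.
  by rewrite /avg sumrB /=; ring.
rewrite (funext e); apply: le_trans (d0D P (measurable_funD m1 m2) (measurable_cst _)) _.
by apply: lerD; [exact: d0D|exact: d0_cst].
Qed.

Variables (K : nat -> R -> R) (h c : nat -> R) (x kappa A : R).
Hypothesis lk : localizing_kernel K h c x kappa A.
Hypothesis x0 : 0 <= x.
Hypothesis ch : h n @[n --> \oo] --> 0.
Hypothesis cnc : (n%:R * c n)^-1 @[n --> \oo] --> 0.
Hypothesis f_cts : cts_at f x.

Let K0 := lk_ge0 lk. Let mK := lk_measurable lk. Let lK := lk_L1 lk.
Let c0 := lk_c lk.

Let cK0 n y : 0 <= c n * K n y. Proof. by rewrite mulr_ge0// ltW. Qed.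

Let A0 : 0 <= A.
Proof. exact: le_trans (cK0 0%N 0) (lk_sup lk 0%N 0). Qed.

Let B0 : 0 <= B. Proof. exact: le_trans (fB 0). Qed.

Let K_bnd n y : `|K n y| <= A / c n.
Proof. by rewrite ger0_norm// ler_pdivlMr// mulrC (lk_sup lk). Qed.

Let mf : measurable_fun setT f. Proof. exact: L1_measurable lf. Qed.

Let cKK n y : c n * K n y ^+ 2 <= A * K n y.
Proof. by rewrite expr2 mulrA ler_wpM2r// (lk_sup lk). Qed.

Let lcKK n : L1 mu (fun y => c n * K n y ^+ 2).
Proof.
apply: (L1_le_leb (g := fun y => A * K n y)); last exact/L1Z/lK.
- by apply: measurable_funM => //; exact: measurable_funX.
- by move=> y; rewrite ger0_norm ?cKK// mulr_ge0 ?sqr_ge0 ?(ltW (c0 n)).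
Qed.

Let lKK n : L1 mu (fun y => K n y ^+ 2).
Proof.
rewrite (_ : (fun y => _) = fun y => (c n)^-1 * (c n * K n y ^+ 2)); first exact: L1Z.
by apply/funext => y; rewrite mulKf// gt_eqF.
Qed.

(** True also at n = 0, where both inverses are 0. *)
Let inv_n n : n%:R^-1 = (n%:R * c n)^-1 * c n.
Proof. by rewrite invfM -mulrA mulVf ?mulr1// gt_eqF. Qed.

Lemma localization_kernel (p : R -> R) (M : R) : measurable_fun setT p ->
  (forall y, `|p y| <= M) -> cts_at p x ->
  \int[mu]_y (p y * K n y) @[n --> \oo] --> p x.
Proof.
move=> mp pM cp; rewrite -[X in _ --> X]mulr1.
apply: (localization x0 K0 (lk_neg lk) lK (lk_L1_var lk) _ _ mp pM cp).
  under eq_cvg do rewrite (lk_Int lk); exact: cvg_cst.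
apply: (cvg0_le (v := fun n => A * h n)).
- by move=> n; apply: Int_ge0 => y; rewrite mulr_ge0// sqr_ge0.
- by apply: nearW => n; exact: (lk_var lk).
- exact: cvg0Z.
Qed.

(** c K^2 is at most A K, so it concentrates at x as well, with mass tending to kappa in place of
    1. *)
Lemma localization_kernel_sqr (p : R -> R) (M : R) : measurable_fun setT p ->
  (forall y, `|p y| <= M) -> cts_at p x ->
  \int[mu]_y (p y * (c n * K n y ^+ 2)) @[n --> \oo] --> p x * kappa.
Proof.
move=> mp pM cp.
have L0 n y : 0 <= c n * K n y ^+ 2 by rewrite mulr_ge0 ?sqr_ge0 ?(ltW (c0 n)).
have d1 n y : (y - x) ^+ 2 * (c n * K n y ^+ 2) <= A * ((y - x) ^+ 2 * K n y).
  by rewrite [leRHS]mulrCA ler_wpM2l ?sqr_ge0.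
have lL n : L1 mu (fun y => (y - x) ^+ 2 * (c n * K n y ^+ 2)).
  apply: (L1_le_leb (g := fun y => A * ((y - x) ^+ 2 * K n y))); last exact/L1Z/(lk_L1_var lk).
  - apply: measurable_funM; last exact: L1_measurable (lcKK n).
    by apply: measurable_funX; exact: measurable_funB.
  - by move=> y; rewrite ger0_norm ?d1// mulr_ge0 ?sqr_ge0.
apply: (localization x0 L0 _ lcKK lL _ _ mp pM cp).
- by move=> n y y0; rewrite (lk_neg lk)// expr0n mulr0.
- by under eq_cvg do rewrite IntZ//; exact: lk_kappa lk.
apply: (cvg0_le (v := fun n => A * (A * h n))).
- by move=> n; apply: Int_ge0 => y; rewrite mulr_ge0// sqr_ge0.
- apply: nearW => n; apply: le_trans (_ : A * \int[mu]_y ((y - x) ^+ 2 * K n y) <= _).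
    rewrite -IntZ; last exact: (lk_L1_var lk).
    by apply: Int_le => //; exact/L1Z/(lk_L1_var lk).
  by rewrite ler_wpM2l// (lk_var lk).
- by do 2!apply: cvg0Z.
Qed.

(** Multiplied by c the integral is at most C, so the average is at most C / (n c). *)
Lemma average_sqr_cvg0 (g : nat -> R -> R) (C : R) :
  (forall n, measurable_fun setT (g n)) ->
  (forall n y, c n * (g n y ^+ 2 * f y) <= C * K n y) ->
  n%:R^-1 * \int[mu]_y (g n y ^+ 2 * f y) @[n --> \oo] --> 0.
Proof.
move=> mg gC; have g0 n y : 0 <= c n * (g n y ^+ 2 * f y).
  by apply: mulr_ge0; [exact: ltW|rewrite mulr_ge0 ?sqr_ge0].
have lg n : L1 mu (fun y => c n * (g n y ^+ 2 * f y)).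
  apply: (L1_le_leb (g := fun y => C * K n y)); last exact/L1Z/lK.
  - by do 2!apply: measurable_funM => //; exact: measurable_funX.
  - by move=> y; rewrite ger0_norm.
have lg' n : L1 mu (fun y => g n y ^+ 2 * f y).
  rewrite (_ : (fun y => _) = fun y => (c n)^-1 * (c n * (g n y ^+ 2 * f y))); first exact: L1Z.
  by apply/funext => y; rewrite mulKf// gt_eqF.
apply: (cvg0_le (v := fun n => C * (n%:R * c n)^-1)); last exact: cvg0Z.
  by move=> n; rewrite mulr_ge0 ?invr_ge0//; apply: Int_ge0 => y; rewrite mulr_ge0 ?sqr_ge0.
apply: nearW => n; rewrite inv_n -mulrA [leRHS]mulrC; apply: ler_wpM2l.
  by rewrite invr_ge0 mulr_ge0// ltW.
rewrite -IntZ//; apply: le_trans (_ : \int[mu]_y (C * K n y) <= _).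
  by apply: Int_le => //; exact: L1Z.
by rewrite IntZ// (lk_Int lk) mulr1.
Qed.

Variable D : nat -> T -> \bar R.
Hypothesis D_bound : forall n w y,
  (`|n%:R^-1 * (\sum_(k < n) q k w y) - f y|%:E <= D n w)%E.
Hypothesis D_cvg : {ae P, forall w, D n w @[n --> \oo] --> 0%E}.

Lemma density_estimator_cvg :
  d0 P (fun w => avg n (K n) w - f x) @[n --> \oo] --> 0.
Proof.
apply: (d0_average (N := fun n => A / c n)) => //.
- apply: (average_sqr_cvg0 (C := A * B)) => // n y.
  rewrite mulrA (_ : A * B * _ = A * K n y * B); last by ring.
  by apply: ler_pM => //; [rewrite mulr_ge0 ?sqr_ge0 ?(ltW (c0 n))|exact: le_trans (ler_norm _) _].
- apply: (d0_predictable_average subF mq q0 hq lf D_bound D_cvg mK K_bnd lK (K := 1)).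
  move=> n; under eq_Rintegral do rewrite (ger0_norm (K0 n _)).
  by rewrite (lk_Int lk).
- have := localization_kernel mf fB f_cts; apply: cvg_trans; apply: near_eq_cvg.
  by apply: nearW => n; apply: eq_Int => y; rewrite mulrC.
Qed.

Lemma squared_kernel_average_cvg (s : R -> R) (M : R) : measurable_fun setT s ->
  (forall y, `|s y| <= M) -> cts_at s x ->
  d0 P (fun w => avg n (fun y => s y * (c n * K n y ^+ 2)) w - s x * f x * kappa) @[n --> \oo] --> 0.
Proof.
move=> ms sM cs; have M0 : 0 <= M by exact: le_trans (sM 0).
have mg n : measurable_fun setT (fun y => s y * (c n * K n y ^+ 2)).
  by apply: measurable_funM => //; exact: L1_measurable (lcKK n).
have L0 n y : 0 <= c n * K n y ^+ 2 by rewrite mulr_ge0 ?sqr_ge0 ?(ltW (c0 n)).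
have Kb n y : K n y <= A / c n by exact: le_trans (ler_norm _) _.
have g1 n y : `|s y * (c n * K n y ^+ 2)| <= M * (A * K n y).
  by rewrite normrM (ger0_norm (L0 n y)) ler_pM.
have g2 n y : `|s y * (c n * K n y ^+ 2)| <= M * (A * (A / c n)).
  by apply: le_trans (g1 n y) _; rewrite ler_wpM2l// ler_wpM2l.
have lg n : L1 mu (fun y => s y * (c n * K n y ^+ 2)) by exact: L1_bndM_leb sM _.
apply: (d0_average (N := fun n => M * (A * (A / c n)))) => //.
(* Three factors c K are bounded by A, and one factor K is kept. *)
- apply: (average_sqr_cvg0 (C := M ^+ 2 * B * A ^+ 3)) => // n y.
  rewrite (_ : c n * _ = s y ^+ 2 * f y * (c n * (c n * K n y ^+ 2) ^+ 2)); last by ring.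
  rewrite (_ : _ * K n y = (M ^+ 2 * B) * (A ^+ 3 * K n y)); last by ring.
  have h1 : c n * (c n * K n y ^+ 2) ^+ 2 <= A ^+ 3 * K n y.
    apply: le_trans (_ : c n * (A * K n y) ^+ 2 <= _).
      by rewrite ler_wpM2l ?(ltW (c0 n))// lerXn2r ?nnegrE// mulr_ge0.
    rewrite (_ : _ * _ = A ^+ 2 * (c n * K n y ^+ 2)); last by ring.
    by rewrite (exprSr A 2) -[leRHS]mulrA ler_wpM2l ?sqr_ge0.
  apply: ler_pM => //; first by rewrite mulr_ge0 ?sqr_ge0.
    by rewrite mulr_ge0 ?sqr_ge0 ?(ltW (c0 n)).
  apply: ler_pM => //; rewrite ?sqr_ge0//; last exact: le_trans (ler_norm _) _.
  by rewrite -(real_normK (num_real (s y))) lerXn2r ?nnegrE.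
- apply: (d0_predictable_average subF mq q0 hq lf D_bound D_cvg mg g2 lg (K := M * A)).
  move=> n; apply: le_trans (_ : \int[mu]_y (M * (A * K n y)) <= _).
    by apply: Int_le => //; [exact: L1_abs|exact/L1Z/L1Z].
  by rewrite IntZ ?IntZ ?(lk_Int lk) ?mulr1//; exact: L1Z.
- have := @localization_kernel_sqr (fun y => s y * f y) (M * B).
  have e n : \int[mu]_y (s y * f y * (c n * K n y ^+ 2)) = \int[mu]_y (s y * (c n * K n y ^+ 2) * f y).
    by apply: eq_Int => y; ring.
  under eq_cvg do rewrite e; apply.
  + exact: measurable_funM.
  + by move=> y; rewrite normrM ler_pM.
  + exact: cts_atM.
Qed.

Variables (C8 Cb : R) (r : R -> R) (Rb : R).
Hypothesis q_L1 : \forall n \near \oo, forall y,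
  (\int[P]_w `|\sum_(k < n) q k w y - n%:R * f y|%:E <= (C8 * Num.sqrt n%:R)%:E)%E.
Hypothesis mr : measurable_fun setT r.
Hypothesis rb : forall y, `|r y| <= Rb.
Hypothesis r_cts : cts_at r x.
Hypothesis bias : forall n, `|\int[mu]_y ((r y - r x) * K n y * f y)| <= Cb * h n.
Hypothesis cc : c n @[n --> \oo] --> 0.
Hypothesis cnch : Num.sqrt (n%:R * c n) * h n @[n --> \oo] --> 0.

(** The weight sqrt(n c) demands rates. The martingale part has variance tending to (r x - r x)^2
    f(x) kappa = 0; the predictable part is sqrt(n c) O(n^(-1/2)) = O(sqrt c) by [q_L1]; the
    deterministic part is sqrt(n c) O(h). *)
Lemma bias_average_cvg :
  d0 P (avg n (fun y => Num.sqrt (n%:R * c n) * ((r y - r x) * K n y)))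
    @[n --> \oo] --> 0.
Proof.
pose g n y := Num.sqrt (n%:R * c n) * ((r y - r x) * K n y).
have mb : measurable_fun setT (fun y => r y - r x) by exact: measurable_funB.
have mg n : measurable_fun setT (g n) by do 2!apply: measurable_funM => //.
have b2 y : `|r y - r x| <= 2 * Rb.
  by rewrite (le_trans (ler_normB _ _))// mulr_natl mulr2n lerD.
have R0 : 0 <= 2 * Rb by exact: le_trans (b2 0).
have sn n : 0 <= Num.sqrt (n%:R * c n) by exact: sqrtr_ge0.
have g1 n y : `|g n y| <= Num.sqrt (n%:R * c n) * (2 * Rb * K n y).
  rewrite !normrM (ger0_norm (sn n)) (ger0_norm (K0 n y)).
  by rewrite ler_wpM2l// ler_wpM2r.
have Kb n y : K n y <= A / c n by exact: le_trans (ler_norm _) _.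
have g2 n y : `|g n y| <= Num.sqrt (n%:R * c n) * (2 * Rb * (A / c n)).
  by apply: le_trans (g1 n y) _; rewrite ler_wpM2l// ler_wpM2l.
have lg n : L1 mu (g n).
  by apply/L1Z; exact: L1_bndM_leb b2 _.
suff h1 : d0 P (fun w => avg n (g n) w - 0) @[n --> \oo] --> 0.
  apply: cvg_trans h1; apply: near_eq_cvg; apply: nearW => n; congr d0.
  by apply/funext => w; rewrite subr0.
apply: (d0_average mg g2).
- have cb : cts_at (fun y => r y - r x) x.
    move=> e e0; have [dl dl0 hd] := r_cts e0; exists dl => // y y0 yd.
    by rewrite subrr subr0; exact: hd.
  have := @localization_kernel_sqr (fun y => (r y - r x) * (r y - r x) * f y) (2 * Rb * (2 * Rb) * B).
  rewrite subrr !mul0r => hl; apply: cvg_trans (hl _ _ _); last 3 first.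
  + by apply: measurable_funM => //; exact: measurable_funM.
  + by move=> y; rewrite !normrM ler_pM// ler_pM.
  + by apply: cts_atM => //; exact: cts_atM.
  apply: near_eq_cvg; near=> n.
  have n0 : (0 < n)%N by near: n; exists 1%N.
  have nn0 : (0 : R) < n%:R by rewrite ltr0n.
  have e y : g n y ^+ 2 * f y = n%:R * ((r y - r x) * (r y - r x) * f y * (c n * K n y ^+ 2)).
    by rewrite /g exprMn sqr_sqrtr ?mulr_ge0 ?(ltW (c0 n))//; ring.
  under [in RHS]eq_Rintegral do rewrite e.
  rewrite IntZ ?mulKf ?gt_eqF//.
  apply: (L1_bndM_leb (M := 2 * Rb * (2 * Rb) * B)) => //.
    by apply: measurable_funM => //; exact: measurable_funM.
  by move=> y; rewrite !normrM ler_pM// ler_pM.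
- have cs := cvg_sqrt0 cc.
  apply: (cvg0_le (v := fun n => C8 * (2 * Rb) * Num.sqrt (c n))).
  + by move=> n; exact: d0_ge0.
  + near=> n.
    have n0 : (0 < n)%N by near: n; exists 1%N.
    have nn0 : (0 : R) < n%:R by rewrite ltr0n.
    have hq8 : forall y, (\int[P]_w `|\sum_(k < n) q k w y - n%:R * f y|%:E <=
      (C8 * Num.sqrt n%:R)%:E)%E by near: n.
    have C80 : 0 <= C8 * Num.sqrt n%:R.
      by rewrite -lee_fin; apply: le_trans (hq8 0); apply: integral_ge0.
    apply: le_trans (d0_predictable_average_L1 subF mq q0 hq lf n0 (mg n) (g2 n) (lg n) hq8) _.
    have Ig : \int[mu]_y `|g n y| <= Num.sqrt (n%:R * c n) * (2 * Rb).
      apply: le_trans (_ : \int[mu]_y (Num.sqrt (n%:R * c n) * (2 * Rb * K n y)) <= _).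
        by apply: Int_le => //; [exact: L1_abs|do 2!apply: L1Z].
      by rewrite IntZ ?IntZ ?(lk_Int lk) ?mulr1//; exact: L1Z.
    apply: le_trans (ler_wpM2l _ Ig) _; first by rewrite mulr_ge0 ?invr_ge0.
    rewrite sqrtrM//; set sn_ := Num.sqrt n%:R.
    have snn : n%:R = sn_ * sn_ by rewrite -expr2 sqr_sqrtr.
    have sn0 : 0 < sn_ by rewrite sqrtr_gt0.
    rewrite le_eqVlt; apply/orP; left; apply/eqP; rewrite snn; field.
    by rewrite gt_eqF.
  + exact: cvg0Z.
- apply: (cvg0_abs_le (v := fun n => Cb * (Num.sqrt (n%:R * c n) * h n))); last exact: cvg0Z.
  apply: nearW => n; rewrite mulrCA.
  have e y : g n y * f y = Num.sqrt (n%:R * c n) * ((r y - r x) * K n y * f y).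
    by rewrite /g; ring.
  under eq_Rintegral do rewrite e.
  rewrite IntZ; last first.
    rewrite (_ : (fun y => _) = fun y => ((r y - r x) * f y) * K n y); last first.
      by apply/funext => y; ring.
    apply: (L1_bndM_leb (M := 2 * Rb * B)) => //; first exact: measurable_funM.
    by move=> y; rewrite normrM ler_pM.
  by rewrite normrM (ger0_norm (sn n)) ler_wpM2l.
Unshelve. all: by end_near.
Qed.

End weighted_averages.

(** * Second moments and ratios *)

Lemma cvg0_powR (R : realType) (u : nat -> R) (p : R) : 0 < p -> (forall n, 0 <= u n) ->
  u n @[n --> \oo] --> 0 -> u n `^ p @[n --> \oo] --> 0.
Proof.
move=> p0 u0 cu; apply/cvgr0Pnorm_le => e e0.
have e1 : 0 < e `^ p^-1 by rewrite powR_gt0.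
have h := cvg_near_dist e1 cu; near=> n.
have hn : `|u n - 0| <= e `^ p^-1 by near: n.
rewrite ger0_norm ?powR_ge0//; rewrite subr0 ger0_norm// in hn.
have := @ge0_ler_powR R p (ltW p0) (u n) (e `^ p^-1).
rewrite !nnegrE => /(_ (u0 n) (ltW e1) hn).
by rewrite -powRrM mulVf ?gt_eqF// powRr1// ltW.
Unshelve. all: by end_near.
Qed.

(** v^(2 + p) lies above v^3 for v <= 1 and above v^2 for v > 1, as 0 < p <= 1. *)
Lemma min_sqr_cube (R : realType) (u p : R) : 0 < p <= 1 ->
  Num.min (u ^+ 2) (`|u| ^+ 3) <= `|u| `^ (2 + p).
Proof.
move=> /andP[p0 p1]; have u0 := normr_ge0 u; rewrite -(real_normK (num_real u)).
move: (`|u|) u0 => v; rewrite le_eqVlt => /predU1P[<-|v0].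
  by rewrite expr0n ge_min powR_ge0.
rewrite ge_min; have [v1|v1] := leP v 1; apply/orP; [right|left].
  by rewrite -powR_mulrn ?(ltW v0)// ger_powR ?v0//; lra.
by rewrite -powR_mulrn ?(ltW v0)// ler_powR ?(ltW v1)//; lra.
Qed.

Section martingale_second_moment.
Context d (T : measurableType d) (R : realType) (P : probability T R).
Variables (G : nat -> set (set T)) (xi : nat -> T -> R).
Hypothesis subG : forall k, <<s G k>> `<=` measurable.
Hypothesis xi_adapted : forall j k, (j < k)%N -> gmeas (G k) (xi j).
Hypothesis xi2 : forall k, L1 P (fun w => xi k w ^+ 2).
Hypothesis xi_mart : forall k U M, gmeas (G k) U -> (forall w, `|U w| <= M) ->
  \int[P]_w (U w * xi k w) = 0.

Let mxi k : measurable_fun setT (xi k).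
Proof. by have h := @xi_adapted _ _ (ltnSn k); exact: gmeas_measurable (@subG _) h. Qed.

Let L1_prod2 (U V : T -> R) : measurable_fun setT U -> measurable_fun setT V ->
  L1 P (fun w => U w ^+ 2) -> L1 P (fun w => V w ^+ 2) -> L1 P (fun w => U w * V w).
Proof.
move=> mU mV lU lV; apply: (L1_le (g := fun w => U w ^+ 2 + V w ^+ 2)).
- exact: measurable_funM.
- move=> w; rewrite normrM -(real_normK (num_real (U w))) -(real_normK (num_real (V w))).
  have := sqr_ge0 (`|U w| - `|V w|); have := normr_ge0 (U w); have := normr_ge0 (V w).
  by rewrite !expr2; nra.
- exact: L1D.
Qed.

(* U is truncated, since xi_mart only tests bounded functions. *)
Lemma mart_L2 k U : gmeas (G k) U -> L1 P (fun w => U w ^+ 2) ->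
  \int[P]_w (U w * xi k w) = 0.
Proof.
move=> gU lU; have mU := gmeas_measurable (@subG k) gU.
pose V (m : nat) w := Num.max (- m%:R) (Num.min m%:R (U w)).
have gV m : gmeas (G k) (V m).
  apply: (@measurable_maxr _ (g_sigma_algebraType (G k))) => //.
  by apply: (@measurable_minr _ (g_sigma_algebraType (G k))).
have VB (m : nat) w : `|V m w| <= m%:R.
  rewrite ler_norml /V le_max lexx/= ge_max ge_min lexx/= andbT.
  by have : (0 : R) <= m%:R by []; lra.
have VU (m : nat) w : `|V m w| <= `|U w|.
  have m0 : (0 : R) <= m%:R by [].
  rewrite /V; have [h|h] := leP m%:R (U w).
    by rewrite (max_idPr _) ?ger0_norm//; [exact: le_trans h|lra].
  have [h2|h2] := leP (- m%:R) (U w); first exact: lexx.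
  by rewrite !ler0_norm; lra.
have c : \int[P]_w (V m w * xi k w) @[m --> \oo] --> \int[P]_w (U w * xi k w).
  apply: (Int_dct (g := fun w => `|U w * xi k w|)).
  - move=> m; have h := gmeas_measurable (@subG k) (gV m); exact: measurable_funM.
  - exact: measurable_funM.
  - apply: aeW => w; apply: cvgM; last exact: cvg_cst.
    apply: cvg_near_cst; exists (Num.bound `|U w|) => // m /= hm.
    have h1 : `|U w| <= m%:R.
      by apply: le_trans (ltW (archi_boundP (normr_ge0 (U w)))) _; rewrite ler_nat.
    by move: h1; rewrite ler_norml => /andP[h1 h2]; rewrite /V (min_idPr h2) (max_idPr h1).
  - exact/L1_abs/L1_prod2.
  - by move=> m w; rewrite !normrM ler_wpM2r.
have z : \int[P]_w (V m w * xi k w) @[m --> \oo] --> (0 : R).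
  by under eq_cvg do rewrite (xi_mart (gV _) (VB _)); exact: cvg_cst.
exact: cvg_unique c z.
Qed.

(** Orthogonality of increments; the partial sums are only square integrable, so the cross term
    needs [mart_L2]. *)
Lemma martingale_second_moment n : L1 P (fun w => (\sum_(k < n) xi k w) ^+ 2) /\
  \int[P]_w ((\sum_(k < n) xi k w) ^+ 2) = \sum_(k < n) \int[P]_w (xi k w ^+ 2).
Proof.
elim: n => [|n [ih1 ih2]].
  rewrite big_ord0 (_ : (fun w => _) = cst 0); last first.
    by apply/funext => w; rewrite big_ord0 expr0n.
  by split; [exact: L1_cst|rewrite Int_cst].
pose S w := \sum_(k < n) xi k w.
have gS : gmeas (G n) S.
  apply: (@measurable_sum _ (g_sigma_algebraType (G n))) => k.
  by exact: xi_adapted.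
have mS := gmeas_measurable (@subG n) gS.
have lSx := L1_prod2 mS (mxi n) ih1 (xi2 n).
have e w : (\sum_(k < n.+1) xi k w) ^+ 2 = (S w ^+ 2 + 2 * (S w * xi n w)) + xi n w ^+ 2.
  by rewrite big_ord_recr /= -/(S w); ring.
have l1 : L1 P (fun w => S w ^+ 2 + 2 * (S w * xi n w)) by apply: L1D => //; exact: L1Z.
rewrite (funext e); split; first exact: L1D.
rewrite IntD// IntD//; last exact: L1Z.
by rewrite IntZ// (mart_L2 gS ih1) mulr0 addr0 ih2 big_ord_recr.
Qed.

End martingale_second_moment.

Section ratio.
Context d (T : measurableType d) (R : realType) (P : probability T R).

Lemma min1D (a b : R) : 0 <= a -> 0 <= b -> Num.min 1 (a + b) <= Num.min 1 a + Num.min 1 b.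
Proof.
move=> a0 b0; have [h1|h1] := leP 1 a; have [h2|h2] := leP 1 b;
  by rewrite ge_min; apply/orP; first [left; lra|right; lra].
Qed.

(* When the denominator is within l / 2 of l, (B + l A) / D - A is
   (B - A (D - l)) / D with D >= l / 2; otherwise 2 (D - l) / l is at least 1. *)
Lemma d0_ratio (A B D : T -> R) (l : R) : 0 < l -> measurable_fun setT A ->
  measurable_fun setT B -> measurable_fun setT D ->
  forall Z, measurable_fun setT Z ->
  (forall w, D w != 0 -> Z w = (l * A w + B w) / D w) ->
  d0 P (fun w => Z w - A w) <= d0 P (fun w => A w * (2 / l * (D w - l))) +
    d0 P (fun w => 2 / l * B w) + d0 P (fun w => 2 / l * (D w - l)).
Proof.
move=> l0 mA mB mD Z mZ ZE.
have md : measurable_fun setT (fun w => 2 / l * (D w - l)).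
  by apply: measurable_funM => //; exact: measurable_funB.
have m1 : measurable_fun setT (fun w => A w * (2 / l * (D w - l))) by exact: measurable_funM.
have m2 : measurable_fun setT (fun w => 2 / l * B w) by exact: measurable_funM.
have l1 := L1_min1 P m1; have l2 := L1_min1 P m2; have l3 := L1_min1 P md.
rewrite /d0 -IntD// -IntD//; last exact: L1D.
apply: Int_le; [by apply: L1_min1; exact: measurable_funB|by apply: L1D => //; exact: L1D|move=> w].
have l2p : 0 < 2 / l by rewrite divr_gt0.
have q1 := min1_ge0 (A w * (2 / l * (D w - l))); have q2 := min1_ge0 (2 / l * B w).
have q3 := min1_ge0 (2 / l * (D w - l)).
have [h|h] := leP 1 `|2 / l * (D w - l)|.
  apply: le_trans (_ : 1 <= _); first by rewrite ge_min lexx.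
  by rewrite lerDr addr_ge0.
have Dl : `|D w - l| < l / 2.
  by move: h; rewrite normrM gtr0_norm// mulrC mulrA ltr_pdivrMr// mul1r ltr_pdivlMr.
have D0 : l / 2 < D w by move: Dl; rewrite ltr_norml => /andP[]; lra.
have Dp : 0 < D w by apply: lt_trans D0; rewrite divr_gt0.
have e : Z w - A w = (B w - A w * (D w - l)) / D w.
  by rewrite ZE ?gt_eqF//; field; rewrite gt_eqF.
have le1 : `|Z w - A w| <= `|A w * (2 / l * (D w - l))| + `|2 / l * B w|.
  rewrite e normrM normfV (gtr0_norm Dp) ler_pdivrMr//.
  apply: le_trans (ler_normB _ _) _.
  have e3 v : `|2 / l * v| = 2 / l * `|v| by rewrite normrM (gtr0_norm l2p).
  rewrite (normrM (A w) (D w - l)) (normrM (A w) (2 / l * _)) !e3.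
  have -> : `|A w| * (2 / l * `|D w - l|) + 2 / l * `|B w| =
     2 / l * (`|B w| + `|A w| * `|D w - l|) by ring.
  rewrite mulrAC ler_peMl ?addr_ge0 ?mulr_ge0//.
  by rewrite mulrAC ler_pdivlMr// mul1r; lra.
apply: le_trans (_ : Num.min 1 (`|A w * (2 / l * (D w - l))| + `|2 / l * B w|) <= _).
  by rewrite le_min !ge_min lexx le1 orbT.
by apply: le_trans (min1D (normr_ge0 _) (normr_ge0 _)) _; rewrite lerDl.
Qed.

End ratio.

(** * Asymptotic normality of a kernel regression estimator *)

Section kernel_regression.
Context d (T : measurableType d) (R : realType) (P : probability T R).
Notation mu := (@lebesgue_measure R).
Variables (F G : nat -> set (set T)) (X U : nat -> T -> R) (q : nat -> T -> R -> R).
Variables (f : R -> R) (B : R).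
Hypothesis subF : forall k, <<s F k>> `<=` measurable.
Hypothesis monoF : forall j k, (j <= k)%N -> <<s F j>> `<=` <<s F k>>.
Hypothesis X_adapted : forall j k, (j < k)%N -> gmeas (F k) (X j).
Hypothesis mq : forall k, measurable_fun setT
  ((fun z => q k z.1 z.2) : g_sigma_algebraType (F k) * R -> R).
Hypothesis q0 : forall k w y, 0 <= q k w y.
Hypothesis hq : forall k A B, <<s F k>> A -> measurable B ->
  P (A `&` X k @^-1` B) = (\int[P]_(w in A) \int[mu]_(y in B) (q k w y)%:E)%E.
Hypothesis f0 : forall y, 0 <= f y.
Hypothesis lf : L1 mu f.
Hypothesis hf : forall k B, measurable B ->
  P (X k @^-1` B) = (\int[mu]_(y in B) (f y)%:E)%E.
Hypothesis fB : forall y, `|f y| <= B.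
Variables (K : nat -> R -> R) (h c : nat -> R) (x kappa A : R).
Hypothesis lk : localizing_kernel K h c x kappa A.
Hypothesis x0 : 0 <= x.
Hypothesis ch : h n @[n --> \oo] --> 0.
Hypothesis cnc : (n%:R * c n)^-1 @[n --> \oo] --> 0.
Hypothesis cc : c n @[n --> \oo] --> 0.
Hypothesis cnch : Num.sqrt (n%:R * c n) * h n @[n --> \oo] --> 0.
Hypothesis f_cts : cts_at f x.
Hypothesis fx0 : 0 < f x.
Variable D : nat -> T -> \bar R.
Hypothesis D_bound : forall n w y,
  (`|n%:R^-1 * (\sum_(k < n) q k w y) - f y|%:E <= D n w)%E.
Hypothesis D_cvg : {ae P, forall w, D n w @[n --> \oo] --> 0%E}.
Variables (C8 Cb : R) (r s : R -> R) (Rb Sb : R).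
Hypothesis q_L1 : \forall n \near \oo, forall y,
  (\int[P]_w `|\sum_(k < n) q k w y - n%:R * f y|%:E <= (C8 * Num.sqrt n%:R)%:E)%E.
Hypothesis mr : measurable_fun setT r.
Hypothesis rb : forall y, `|r y| <= Rb.
Hypothesis r_cts : cts_at r x.
Hypothesis bias : forall n, `|\int[mu]_y ((r y - r x) * K n y * f y)| <= Cb * h n.
Hypothesis ms : measurable_fun setT s.
Hypothesis sb : forall y, 0 <= s y <= Sb.
Hypothesis s_cts : cts_at s x.
Hypothesis subG : forall k, <<s G k>> `<=` measurable.
Hypothesis monoG : forall j k, (j <= k)%N -> <<s G j>> `<=` <<s G k>>.
Hypothesis gX : forall k, gmeas (G k) (X k).
Hypothesis gU : forall j k, (j < k)%N -> gmeas (G k) (U j).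
Hypothesis lU2 : forall k, L1 P (fun w => U k w ^+ 2).
Hypothesis U_mean : forall k V M, gmeas (G k) V -> (forall w, `|V w| <= M) ->
  \int[P]_w (V w * U k w) = \int[P]_w (V w * r (X k w)).
Hypothesis U_var : forall k V M, gmeas (G k) V -> (forall w, `|V w| <= M) ->
  \int[P]_w (V w * (U k w - r (X k w)) ^+ 2) = \int[P]_w (V w * s (X k w)).
Variables (p H : R).
Hypothesis p01 : 0 < p <= 1.
Hypothesis lUp : forall k, L1 P (fun w => `|U k w - r (X k w)| `^ (2 + p)).
Hypothesis U_moment : forall k (g : R -> R) (M : R), measurable_fun setT g -> (forall y, 0 <= g y <= M) ->
  \int[P]_w (g (X k w) * `|U k w - r (X k w)| `^ (2 + p)) <= H * \int[P]_w g (X k w).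

Let K0 := lk_ge0 lk. Let mK := lk_measurable lk. Let lK := lk_L1 lk.
Let c0 := lk_c lk.
Let mX k : measurable_fun setT (X k).
Proof. by have hh := @X_adapted _ _ (ltnSn k); exact: gmeas_measurable (@subF _) hh. Qed.
Let mU k : measurable_fun setT (U k).
Proof. by have hh := @gU _ _ (ltnSn k); exact: gmeas_measurable (@subG _) hh. Qed.
Let mrX k : measurable_fun setT (fun w => r (X k w)).
Proof. exact: measurableT_comp. Qed.
Let cK0 n y : 0 <= c n * K n y. Proof. by rewrite mulr_ge0// ltW. Qed.
Let A0 : 0 <= A. Proof. exact: le_trans (cK0 0%N 0) (lk_sup lk 0%N 0). Qed.
Let B0 : 0 <= B. Proof. exact: le_trans (fB 0). Qed.
Let Sb0 : 0 <= Sb. Proof. by have /andP[] := sb 0; exact: le_trans. Qed.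
Let Kb n y : K n y <= A / c n. Proof. by rewrite ler_pdivlMr// mulrC (lk_sup lk). Qed.
Let K_bnd n y : `|K n y| <= A / c n. Proof. by rewrite ger0_norm. Qed.
Let Ac0 n : 0 <= A / c n. Proof. exact: le_trans (Kb n 0). Qed.
Let nc0 n : 0 <= n%:R * c n. Proof. by rewrite mulr_ge0// ltW. Qed.

(** sqrt(c_n / n) / f(x), in a form that is 0 at n = 0; [xi] gives the summands of A_n and [W] their
    conditional variances. *)
Let a n : R := Num.sqrt (n%:R * c n) / n%:R / f x.
Let xi n k w : R := a n * ((U k w - r (X k w)) * K n (X k w)).
Let W n k w : R := a n ^+ 2 * (s (X k w) * K n (X k w) ^+ 2).

Let a0 n : 0 <= a n.
Proof. by rewrite !mulr_ge0 ?invr_ge0 ?sqrtr_ge0// ltW. Qed.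

Let nz n : n.+1%:R != 0 :> R. Proof. by rewrite pnatr_eq0. Qed.

Let sqM (u v : R) : 0 <= v -> 0 <= u ^+ 2 * v.
Proof. by move=> v0; apply: mulr_ge0 => //; exact: sqr_ge0. Qed.

Let a2 n : a n ^+ 2 = (f x) ^- 2 * (n%:R^-1 * c n).
Proof.
rewrite /a !exprMn sqr_sqrtr//; case: n => [|n]; first by rewrite !(mul0r, invr0, mulr0).
by move: (n.+1%:R) (nz n) => m m0; field; rewrite m0 gt_eqF.
Qed.

Let gKX n k : gmeas (G k) (fun w => K n (X k w)).
Proof. by apply: (@measurableT_comp _ _ _ _ _ _ (K n)) => //; exact: gX. Qed.

Let lUr k : L1 P (fun w => (U k w - r (X k w)) ^+ 2).
Proof.
apply: (L1_le (g := fun w => 2 * U k w ^+ 2 + 2 * Rb ^+ 2)).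
- by apply: measurable_funX; exact: measurable_funB.
- move=> w; rewrite ger0_norm ?sqr_ge0//.
  have h1 : r (X k w) ^+ 2 <= Rb ^+ 2.
    by rewrite -(real_normK (num_real (r _))) lerXn2r ?nnegrE//; exact: le_trans (rb 0).
  by have := sqr_ge0 (U k w + r (X k w)); rewrite !expr2 in h1 *; nra.
- by apply: L1D; [exact: L1Z|exact: L1_cst].
Qed.

Let gxi n j k : (j < k)%N -> gmeas (G k) (xi n j).
Proof.
move=> jk; have mono := @monoG _ _ (ltnW jk).
have gXj := gmeas_mono mono (@gX j).
apply: (@measurable_funM _ (g_sigma_algebraType (G k))) => //.
apply: (@measurable_funM _ (g_sigma_algebraType (G k))) => //; last first.
  exact: gmeas_mono mono (@gKX n j).
apply: (@measurable_funB _ (g_sigma_algebraType (G k))); first exact: gU.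
by apply: (@measurableT_comp _ _ _ _ _ _ r) => //; exact: gXj.
Qed.

Let gW n k : gmeas (G k) (W n k).
Proof.
apply: (@measurable_funM _ (g_sigma_algebraType (G k))) => //.
apply: (@measurable_funM _ (g_sigma_algebraType (G k))) => //.
  by apply: (@measurableT_comp _ _ _ _ _ _ s) => //; exact: gX.
by apply: measurable_funX; exact: gKX.
Qed.

Let mxi n k : measurable_fun setT (xi n k).
Proof. by have hh := @gxi n _ _ (ltnSn k); exact: gmeas_measurable (@subG _) hh. Qed.

Let eta n : R := (n%:R * c n)^-1 * (Sb * A ^+ 2 / f x ^+ 2).

Let W_bnd n k w : 0 <= W n k w <= eta n.
Proof.
have /andP[s1 s2] := sb (X k w).
apply/andP; split; first by rewrite sqM// mulr_ge0 ?sqr_ge0.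
have h1 : (c n * K n (X k w)) ^+ 2 <= A ^+ 2 by rewrite lerXn2r ?nnegrE// (lk_sup lk).
have -> : W n k w = (n%:R * c n)^-1 * ((s (X k w) * (c n * K n (X k w)) ^+ 2) / f x ^+ 2).
  rewrite /W a2; case: (n) => [|m]; first by rewrite !(mul0r,invr0,mulr0).
  by move: (m.+1%:R) (nz m) => m' m0; field; rewrite m0 !gt_eqF.
rewrite ler_wpM2l ?invr_ge0// ler_wpM2r ?invr_ge0 ?sqr_ge0//.
by apply: ler_pM => //; exact: sqr_ge0.
Qed.

Let lxi2 n k : L1 P (fun w => xi n k w ^+ 2).
Proof.
have e w : xi n k w ^+ 2 = (a n ^+ 2 * K n (X k w) ^+ 2) * (U k w - r (X k w)) ^+ 2.
  by rewrite /xi; ring.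
rewrite (funext e); apply: (L1_bndM (M := a n ^+ 2 * (A / c n) ^+ 2)) => //.
- apply: measurable_funM => //; apply: measurable_funX.
  exact: measurableT_comp.
- move=> w; rewrite ger0_norm ?sqM ?sqr_ge0//; apply: ler_wpM2l; rewrite ?sqr_ge0//.
  by rewrite lerXn2r ?nnegrE.
Qed.

(** [X k] is [G k]-measurable, so the bounded kernel factor can be absorbed into the test variable
    V. *)
Let xi_mart n k V M : gmeas (G k) V -> (forall w, `|V w| <= M) ->
  \int[P]_w (V w * xi n k w) = 0.
Proof.
move=> gV VM; pose V' w := V w * K n (X k w).
have gV' : gmeas (G k) V'.
  by apply: (@measurable_funM _ (g_sigma_algebraType (G k))) => //; exact: gKX.
have V'M w : `|V' w| <= M * (A / c n) by rewrite normrM ler_pM.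
have mV' := gmeas_measurable (@subG k) gV'.
have e w : V w * xi n k w = a n * (V' w * U k w - V' w * r (X k w)).
  by rewrite /xi /V'; ring.
have lU : L1 P (U k) by exact: L1_sqr (lU2 k).
have lr : L1 P (fun w => r (X k w)) by have hh := L1_bnd P (mrX k) (fun w => rb (X k w)); exact: hh.
have l1 : L1 P (fun w => V' w * U k w) by exact: L1_bndM mV' V'M lU.
have l2 : L1 P (fun w => V' w * r (X k w)) by exact: L1_bndM mV' V'M lr.
under eq_Rintegral do rewrite e.
rewrite IntZ; last exact: L1B.
by rewrite IntB// (U_mean gV' V'M) subrr mulr0.
Qed.

Let xi_var n k V M : gmeas (G k) V -> (forall w, `|V w| <= M) ->
  \int[P]_w (V w * xi n k w ^+ 2) = \int[P]_w (V w * W n k w).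
Proof.
move=> gV VM; pose V' w := V w * (a n ^+ 2 * K n (X k w) ^+ 2).
have gV' : gmeas (G k) V'.
  apply: (@measurable_funM _ (g_sigma_algebraType (G k))) => //.
  apply: (@measurable_funM _ (g_sigma_algebraType (G k))) => //.
  by apply: measurable_funX; exact: gKX.
have V'M w : `|V' w| <= M * (a n ^+ 2 * (A / c n) ^+ 2).
  rewrite normrM ler_pM// ger0_norm ?sqM ?sqr_ge0//; apply: ler_wpM2l; rewrite ?sqr_ge0//.
  by rewrite lerXn2r ?nnegrE.
have e1 w : V w * xi n k w ^+ 2 = V' w * (U k w - r (X k w)) ^+ 2 by rewrite /xi /V'; ring.
have e2 w : V w * W n k w = V' w * s (X k w) by rewrite /W /V'; ring.
under eq_Rintegral do rewrite e1; rewrite (U_var gV' V'M).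
by apply: eq_Int => w; rewrite e2.
Qed.

Let s2 : R := s x * kappa / f x.

Let s20 : 0 <= s2.
Proof.
have k0 : 0 <= kappa.
  have ck := lk_kappa lk; rewrite -(cvg_lim _ ck)//.
  apply: limr_ge; first exact: cvgP ck.
  apply: nearW => n; rewrite mulr_ge0 ?(ltW (c0 n))//; apply: Int_ge0 => y; exact: sqr_ge0.
by rewrite divr_ge0 ?(ltW fx0)// mulr_ge0//; have /andP[] := sb x.
Qed.

Let variance : d0 P (fun w => \sum_(k < n) W n k w - s2) @[n --> \oo] --> 0.
Proof.
have sb' y : `|s y| <= Sb by have /andP[s1 s1'] := sb y; rewrite ger0_norm.
have h1 := squared_kernel_average_cvg subF monoF X_adapted mq q0 hq f0 lf hf fB lk x0 ch cnc
  f_cts D_bound D_cvg ms sb' s_cts.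
have mS n : measurable_fun setT
   (fun w => n%:R^-1 * \sum_(k < n) (s (X k w) * (c n * K n (X k w) ^+ 2)) - s x * f x * kappa).
  apply: measurable_funB => //; apply: measurable_funM => //; apply: measurable_sum => k.
  have m1 : measurable_fun setT (fun y => s y * (c n * K n y ^+ 2)).
    by do 2!apply: measurable_funM => //; exact: measurable_funX.
  exact: (measurableT_comp m1).
have l1 : L1 P (fun w => (f x ^- 2) ^+ 2) by exact: L1_cst.
have := @cvg_d0_prod _ T R P (fun _ _ => f x ^- 2) _ ((f x ^- 2) ^+ 2) (fun n => measurable_cst _) mS
  (fun n => l1).
have near1 : \forall n \near \oo, \int[P]_w ((f x ^- 2) ^+ 2) <= (f x ^- 2) ^+ 2.
  by apply: nearW => _; rewrite Int_cst.
move=> /(_ near1 h1); apply: cvg_trans; apply: near_eq_cvg; apply: nearW => n; congr d0.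
apply/funext => w; rewrite mulrBr; congr (_ - _); last by rewrite /s2; field; rewrite gt_eqF.
rewrite !mulr_sumr; apply: eq_bigr => k _; rewrite /W a2.
by ring.
Qed.

(** [t n], of order (n c)^(-1/2), bounds a K. By [min_sqr_cube] a summand is at most a moment of
    order 2 + p, in which two powers of a K yield a^2 (A/c) K and the remaining power p yields at
    most t_n^p. Since n a^2 / c = 1/f(x)^2, the whole sum is O(t_n^p). *)
Let lindeberg : \sum_(k < n) \int[P]_w Num.min (xi n k w ^+ 2) (`|xi n k w| ^+ 3)
    @[n --> \oo] --> 0.
Proof.
have /andP[p0 p1] := p01.
pose t n : R := a n * (A / c n).
have t0 n : 0 <= t n by rewrite mulr_ge0.
have tE n : t n = A / f x * Num.sqrt ((n%:R * c n)^-1).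
  rewrite /t /a; case: n => [|n]; first by rewrite !mul0r invr0 sqrtr0 !(mul0r, mulr0).
  have nc : (0 : R) < n.+1%:R * c n.+1 by rewrite mulr_gt0.
  have sq : 0 < Num.sqrt (n.+1%:R * c n.+1) by rewrite sqrtr_gt0.
  have sqq : Num.sqrt (n.+1%:R * c n.+1) ^+ 2 = n.+1%:R * c n.+1 by rewrite sqr_sqrtr// ltW.
  rewrite sqrtrV ?(ltW nc)//.
  have -> : (Num.sqrt (n.+1%:R * c n.+1))^-1 = Num.sqrt (n.+1%:R * c n.+1) / (n.+1%:R * c n.+1).
    by rewrite -{3}sqq; field; rewrite gt_eqF.
  by move: (n.+1%:R) (nz n) => m m0; field; rewrite m0 !gt_eqF.
have ct : t n @[n --> \oo] --> 0.
  under eq_cvg do rewrite tE; apply: cvg0Z.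
  exact: cvg_sqrt0.
have H0 : 0 <= H.
  have := @U_moment 0%N (cst 1) 1 (measurable_cst _); rewrite /cst /= => h1.
  have {}h1 : \int[P]_w (1 * `|U 0%N w - r (X 0%N w)| `^ (2 + p)) <= H * \int[P]_w (cst 1 w).
    by apply: h1 => y; rewrite ler01 lexx.
  rewrite Int_cst mulr1 in h1; apply: le_trans h1; apply: Int_ge0 => w.
  by rewrite mul1r powR_ge0.
have one n k : \int[P]_w Num.min (xi n k w ^+ 2) (`|xi n k w| ^+ 3) <=
    a n ^+ 2 * (A / c n) * t n `^ p * (H * B).
  pose g y := (a n * K n y) `^ (2 + p).
  have mg : measurable_fun setT g.
    have m1 : measurable_fun setT (fun y => a n * K n y) by exact: measurable_funM.
    exact: (measurableT_comp (measurable_powR (2 + p)) m1).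
  have aK0 y : 0 <= a n * K n y by rewrite mulr_ge0.
  have aKt y : a n * K n y <= t n by rewrite ler_wpM2l.
  have gb y : 0 <= g y <= t n `^ (2 + p).
    by rewrite powR_ge0/=; apply: ge0_ler_powR; rewrite ?nnegrE//; lra.
  have gK y : g y <= a n ^+ 2 * (A / c n) * t n `^ p * K n y.
    rewrite /g; have [->|ne] := eqVneq (a n * K n y) 0.
      rewrite powR0; last by rewrite gt_eqF//; lra.
      by apply: mulr_ge0 => //; apply: mulr_ge0; [exact: sqM|exact: powR_ge0].
    rewrite powRD ?ne ?implybT// powR_mulrn// exprMn.
    rewrite [leRHS](_ : _ = (a n ^+ 2 * (A / c n * K n y)) * t n `^ p); last by ring.
    apply: ler_pM; [by rewrite sqM ?sqr_ge0|exact: powR_ge0| |].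
      by apply: ler_wpM2l; rewrite ?sqr_ge0// expr2 ler_wpM2r.
    by apply: ge0_ler_powR; rewrite ?nnegrE// ltW.
  apply: le_trans (_ : \int[P]_w (g (X k w) * `|U k w - r (X k w)| `^ (2 + p)) <= _).
    apply: Int_le.
    - apply: (L1_le (g := fun w => xi n k w ^+ 2)) => //.
      + apply: measurable_minr; first exact: measurable_funX.
        by apply: measurable_funX; exact: measurableT_comp.
      + move=> w; rewrite ger0_norm ?le_min ?sqr_ge0 ?exprn_ge0//.
        by rewrite ge_min lexx.
    - apply: (L1_bndM (M := t n `^ (2 + p))) => //; first exact: measurableT_comp.
      by move=> w; have /andP[g1 g2] := gb (X k w); rewrite ger0_norm.
    - move=> w; apply: le_trans (min_sqr_cube _ p01) _.
      rewrite /xi (normrM (a n)) (normrM (U k w - r (X k w))) (ger0_norm (a0 n)) (ger0_norm (K0 n _)).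
      rewrite (mulrC `|_| (K n _)) mulrA powRM//.
  apply: le_trans (U_moment _ mg gb) _.
  rewrite [leRHS]mulrCA ler_wpM2l//.
  rewrite (expect_X subF X_adapted f0 lf hf k mg (M := t n `^ (2 + p))); last first.
    by move=> y; have /andP[g1 g2] := gb y; rewrite ger0_norm.
  have lgf : L1 mu (fun y => g y * f y).
    apply: (L1_bndM_leb (M := t n `^ (2 + p))) => //.
    by move=> y; have /andP[g1 g2] := gb y; rewrite ger0_norm.
  apply: le_trans (_ : \int[mu]_y (a n ^+ 2 * (A / c n) * t n `^ p * B * K n y) <= _).
    apply: Int_le => //; first exact: L1Z.
    move=> y; rewrite (_ : _ * B * _ = a n ^+ 2 * (A / c n) * t n `^ p * K n y * B); last by ring.
    by apply: ler_pM => //; [exact: powR_ge0|exact: le_trans (ler_norm _) _].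
  by rewrite IntZ// (lk_Int lk) mulr1.
apply: (cvg0_le (v := fun n => (A * H * B / f x ^+ 2) * t n `^ p)).
- move=> n; apply: sumr_ge0 => k _; apply: Int_ge0 => w.
  by rewrite le_min sqr_ge0 exprn_ge0.
- apply: nearW => n.
  apply: (@le_trans _ _ (\sum_(k < n) (a n ^+ 2 * (A / c n) * t n `^ p * (H * B)))).
    by apply: ler_sum => k _; exact: one.
  rewrite sumr_const card_ord -[leLHS]mulr_natl a2; case: n => [|n].
    by rewrite mul0r mulr_ge0 ?powR_ge0// divr_ge0 ?sqr_ge0// !mulr_ge0.
  rewrite le_eqVlt; apply/orP; left; apply/eqP.
  by move: (n.+1%:R) (nz n) => m m0; field; rewrite m0 !gt_eqF.
- by apply: cvg0Z; apply: cvg0_powR.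
Qed.

Let S n w := \sum_(k < n) xi n k w.

Let mS n : measurable_fun setT (S n).
Proof. by apply: measurable_sum => k. Qed.

(** An L^2 bound uniform in n, needed to multiply [S n] by the vanishing error of the density
    estimator. *)
Let S_sqr n : L1 P (fun w => S n w ^+ 2) /\ \int[P]_w (S n w ^+ 2) <= Sb * B * A / f x ^+ 2.
Proof.
have [l e] := @martingale_second_moment _ _ _ _ _ (xi n) subG (@gxi n) (@lxi2 n) (@xi_mart n) n.
split=> //; rewrite e.
have one k : \int[P]_w (xi n k w ^+ 2) <= f x ^- 2 * n%:R^-1 * (Sb * B * A).
  have g1 : gmeas (G k) (cst 1 : T -> R) by exact: (@measurable_cst _ _ (g_sigma_algebraType (G k))).
  have b1 (w : T) : `|cst 1 w : R| <= 1 by rewrite normr1.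
  have := xi_var n g1 b1; rewrite /cst; under eq_Rintegral do rewrite mul1r.
  move=> ->; under eq_Rintegral do rewrite mul1r.
  pose g y := a n ^+ 2 * (s y * K n y ^+ 2).
  have mg : measurable_fun setT g.
    by do 2!apply: measurable_funM => //; exact: measurable_funX.
  have g0 y : 0 <= g y by have /andP[s1 s2'] := sb y; rewrite sqM// mulr_ge0 ?sqr_ge0.
  have gE y : g y <= f x ^- 2 * n%:R^-1 * (Sb * (A * K n y)).
    rewrite /g a2 -!mulrA ler_wpM2l ?invr_ge0 ?sqr_ge0// ler_wpM2l ?invr_ge0//.
    rewrite mulrCA; have /andP[s1 s2'] := sb y; apply: ler_pM => //.
      by rewrite mulr_ge0 ?sqr_ge0// ltW.
    by rewrite expr2 mulrA ler_wpM2r// (lk_sup lk).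
  have gb y : `|g y| <= f x ^- 2 * n%:R^-1 * (Sb * (A * (A / c n))).
    rewrite ger0_norm//; apply: le_trans (gE y) _.
    by rewrite ler_wpM2l ?mulr_ge0 ?invr_ge0 ?sqr_ge0// ler_wpM2l// ler_wpM2l.
  rewrite (expect_X subF X_adapted f0 lf hf k mg gb).
  have lgf : L1 mu (fun y => g y * f y) by exact: L1_bndM_leb mg gb lf.
  apply: le_trans (_ : \int[mu]_y (f x ^- 2 * n%:R^-1 * (Sb * A * B) * K n y) <= _).
    apply: Int_le => //; first exact: L1Z.
    move=> y; rewrite (_ : _ * K n y = f x ^- 2 * n%:R^-1 * (Sb * (A * K n y)) * B); last by ring.
    by apply: ler_pM => //; exact: le_trans (ler_norm _) _.
  by rewrite IntZ// (lk_Int lk) mulr1 (mulrAC Sb).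
apply: (@le_trans _ _ (\sum_(k < n) (f x ^- 2 / n%:R * (Sb * B * A)))).
  by apply: ler_sum => k _; exact: one.
rewrite sumr_const card_ord -[leLHS]mulr_natl; case: (n) => [|m].
  by rewrite mul0r divr_ge0 ?sqr_ge0// !mulr_ge0.
rewrite le_eqVlt; apply/orP; left; apply/eqP.
by move: (m.+1%:R) (nz m) => m' m0; field; rewrite m0 gt_eqF.
Qed.

Let mKX n k : measurable_fun setT (fun w => K n (X k w)).
Proof. exact: measurableT_comp. Qed.

(** Where the denominator D_n is nonzero, Z_n = (f(x) S_n + B_n) / D_n, and [d0_ratio] bounds the
    distance from Z_n to S_n. The event D_n = 0, where the quotient is 0 by convention, falls under
    its last term. The limit law of S_n comes from [martingale_clt]. *)
Theorem kernel_regression_clt : cvg_in_distribution P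
  (fun n w => Num.sqrt (n%:R * c n) *
    ((\sum_(k < n) U k w * K n (X k w)) / (\sum_(k < n) K n (X k w)) - r x))
  (centered_normal s2).
Proof.
set Z := fun n w => _.
pose Dn n w := n%:R^-1 * \sum_(k < n) K n (X k w).
pose Bn n w := n%:R^-1 * \sum_(k < n) (Num.sqrt (n%:R * c n) * ((r (X k w) - r x) * K n (X k w))).
have mD n : measurable_fun setT (Dn n).
  by apply: measurable_funM => //; apply: measurable_sum => k.
have mB n : measurable_fun setT (Bn n).
  apply: measurable_funM => //; apply: measurable_sum => k.
  by do 2!apply: measurable_funM => //; exact: measurable_funB.
have mZ n : measurable_fun setT (Z n).
  apply: measurable_funM => //; apply: measurable_funB => //; apply: measurable_fun_div.
    by apply: measurable_sum => k; exact: measurable_funM.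
  by apply: measurable_sum => k.
have ZE n w : Dn n w != 0 -> Z n w = (f x * S n w + Bn n w) / Dn n w.
  case: n => [|n]; first by rewrite /Dn big_ord0 mulr0 eqxx.
  rewrite mulf_eq0 negb_or => /andP[_ D0].
  have e : f x * S n.+1 w + Bn n.+1 w = Num.sqrt (n.+1%:R * c n.+1) / n.+1%:R *
      (\sum_(k < n.+1) U k w * K n.+1 (X k w) - r x * \sum_(k < n.+1) K n.+1 (X k w)).
    rewrite /S /Bn !mulr_sumr -big_split -sumrB mulr_sumr; apply: eq_bigr => k _ /=.
    rewrite /xi /a; move: (n.+1%:R) (nz n) => m m0; field.
    by rewrite m0 gt_eqF.
  by rewrite e /Z /Dn; move: (n.+1%:R) (nz n) => m m0; field; rewrite m0 D0.
have cD := density_estimator_cvg subF monoF X_adapted mq q0 hq f0 lf hf fB lk x0 ch cnc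
  f_cts D_bound D_cvg.
have cB := bias_average_cvg subF monoF X_adapted mq q0 hq f0 lf hf fB lk x0 ch f_cts
  q_L1 mr rb r_cts bias cc cnch.
have lc (b : R) : L1 P (fun=> b ^+ 2) by exact: L1_cst.
have ncst (b : R) : \forall n \near \oo, \int[P]_w (b ^+ 2) <= b ^+ 2.
  by apply: nearW => _; rewrite Int_cst.
have mDf n : measurable_fun setT (fun w => Dn n w - f x) by exact: measurable_funB.
have cB' := @cvg_d0_prod _ T R P (fun _ _ => 2 / f x) Bn _ (fun n => measurable_cst _) mB
  (fun n => lc _) (ncst _) cB.
have cD' := @cvg_d0_prod _ T R P (fun _ _ => 2 / f x) (fun n w => Dn n w - f x) _
  (fun n => measurable_cst _) mDf (fun n => lc _) (ncst _) cD.
have mD' n : measurable_fun setT (fun w => 2 / f x * (Dn n w - f x)) by exact: measurable_funM.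
have nS : \forall n \near \oo, \int[P]_w (S n w ^+ 2) <= Sb * B * A / f x ^+ 2.
  by apply: nearW => n; have [] := S_sqr n.
have cSD := cvg_d0_prod mS mD' (fun n => proj1 (S_sqr n)) nS cD'.
have cZ : d0 P (fun w => Z n w - S n w) @[n --> \oo] --> 0.
  apply: (cvg0_le (fun n => d0_ge0 P _) _ (cvg0D (cvg0D cSD cB') cD')); apply: nearW => n.
  exact: d0_ratio fx0 (mS n) (mB n) (mD n) _ (mZ n) (ZE n).
apply: cvg_in_distribution_unif_cont => // g M cg gM ug.
have mg : measurable_fun setT g by exact: continuous_measurable_fun.
have h1 := cvg_unif_cont_d0 mZ mS mg gM ug cZ.
apply: cvg_sub0 h1 _.
apply: (martingale_clt subG monoG gxi gW W_bnd lxi2 xi_mart xi_var s20 _ lindeberg variance mg gM ug).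
rewrite -(mul0r (Sb * A ^+ 2 / f x ^+ 2)); apply: cvgM => //; exact: cvg_cst.
Qed.

End kernel_regression.

(** * The gamma kernel regression estimator *)

Section extension_by_zero.
Context {R : realType}.
Notation mu := (@lebesgue_measure R).
Implicit Types (g : R -> R) (x y : R).

(** Densities and regression functions are given on the half-line, while the preceding results
    integrate over the whole line. *)
Definition ext g : R -> R := g \_ halfline.

Lemma extE g y : 0 <= y -> ext g y = g y.
Proof. by move=> y0; rewrite /ext patchE halflineE y0. Qed.

Lemma ext_neg g y : y < 0 -> ext g y = 0.
Proof. by move=> y0; rewrite /ext patchE halflineE (leNgt 0 y) y0. Qed.

Lemma measurable_ext g : measurable_fun halfline g -> measurable_fun setT (ext g).
Proof.
by move=> mg; apply/(measurable_restrictT g (measurable_halfline : measurable (@halfline R))).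
Qed.

Lemma cts_at_ext g x : 0 <= x -> cts_at g x -> cts_at (ext g) x.
Proof.
move=> x0 cg e e0; have [dl dl0 h] := cg e e0; exists dl => // y y0 yd.
by rewrite !extE//; exact: h.
Qed.

Lemma bounded_ext g : bounded_on_halfline g -> exists2 M : R, 0 <= M & forall y, `|ext g y| <= M.
Proof.
move=> [M hM]; exists (Num.max 0 M) => [|y]; first by rewrite le_max lexx.
have [y0|y0] := leP 0 y; last by rewrite ext_neg// normr0 le_max lexx.
by rewrite extE// le_max hM// orbT.
Qed.

Lemma Int_ext g (B : set R) : measurable B ->
  (\int[mu]_(y in B `&` halfline) (g y)%:E = \int[mu]_(y in B) (ext g y)%:E)%E.
Proof.
move=> mB; rewrite integral_mkcondr; apply: eq_integral => y _.
by rewrite /ext !patchE; case: ifP.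
Qed.

(** The extreme value theorem up to b, and f <= 1 beyond. *)
Lemma C0_bounded (f : R -> R) : C0 f -> (forall y, 0 <= y -> 0 <= f y) -> bounded_on_halfline f.
Proof.
move=> [cf fy _] f0.
have := (cvgrPdist_le _ _).1 fy 1 ltr01 => -[a [_ ha]].
pose b := Num.max 0 (a + 1).
have b0 : 0 <= b by rewrite le_max lexx.
have [m _ hm] := @EVT_max R f 0 b b0 (continuous_subspaceT cf).
exists (Num.max 1 (f m)) => y y0; rewrite ger0_norm ?f0//.
have [yb|yb] := leP y b; first by rewrite le_max hm ?orbT// in_itv/= y0.
have := ha y; rewrite sub0r normrN ger0_norm ?f0// => h.
rewrite le_max h//; apply: lt_trans yb; rewrite /b lt_max; apply/orP; right; lra.
Qed.

End extension_by_zero.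

Section generated_sigma_algebras.
Context d (T : measurableType d) (R : realType).
Implicit Types (X Y : int -> T -> R).

Lemma sub_measurable (G : set (set T)) : G `<=` measurable -> <<s G>> `<=` measurable.
Proof. by move=> h; apply: smallest_sub => //; exact: sigma_algebra_measurable. Qed.

Lemma gmeas_gen (G : set (set T)) (Z : T -> R) :
  (forall B, measurable B -> G (Z @^-1` B)) -> gmeas G Z.
Proof.
by move=> h _ B mB; rewrite setTI; apply: sub_sigma_algebra; exact: h.
Qed.

Lemma gen_var_measurable (Z : T -> R) : measurable_fun setT Z -> <<s gen_var Z>> `<=` measurable.
Proof. by move=> mZ; apply: sub_measurable => _ [B mB <-]; exact: mZ. Qed.

Lemma gmeas_gen_var (Z : T -> R) : gmeas (gen_var Z) Z.
Proof. by apply: gmeas_gen => B mB; exists B => //; rewrite setTI. Qed.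

Variables (X Y : int -> T -> R).
Hypothesis mX : forall t, measurable_fun setT (X t).
Hypothesis mY : forall t, measurable_fun setT (Y t).

Lemma gen_F_sub t : gen_F X Y t `<=` measurable.
Proof.
move=> _ [s _ [B mB <-]].
exact: (measurable_fun_pair (@mX s) (@mY s)).
Qed.

Lemma gen_G_sub t : gen_G X Y t `<=` measurable.
Proof. by move=> A [[B mB <-]|]; [exact: mX|exact: gen_F_sub]. Qed.

Lemma gen_F_mono s t : s <= t -> gen_F X Y s `<=` gen_F X Y t.
Proof. by move=> st A [u us hA]; exists u => //; exact: le_trans st. Qed.

Lemma gen_F_X s t : s <= t -> gmeas (gen_F X Y t) (X s).
Proof.
move=> st; apply: gmeas_gen => B mB; exists s => //.
exists (B `*` setT); first exact: measurableX.
by rewrite setTI; apply/seteqP; split => w /=; tauto.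
Qed.

Lemma gen_F_Y s t : s <= t -> gmeas (gen_F X Y t) (Y s).
Proof.
move=> st; apply: gmeas_gen => B mB; exists s => //.
exists (setT `*` B); first exact: measurableX.
by rewrite setTI; apply/seteqP; split => w /=; tauto.
Qed.

Lemma gen_F_gen_G t : gen_F X Y t `<=` gen_G X Y t.
Proof. by move=> A hA; right. Qed.

Lemma gen_G_X t : gmeas (gen_G X Y t) (X (t + 1)).
Proof.
by apply: gmeas_mono (@gmeas_gen_var _); apply: sub_sigma_algebra2 => A hA; left.
Qed.

(** For s < t the extra generator [X (s + 1)] of G_s is already F_t-measurable. *)
Lemma gen_G_mono s t : s <= t -> <<s gen_G X Y s>> `<=` <<s gen_G X Y t>>.
Proof.
rewrite le_eqVlt => /predU1P[->//|st].
apply: smallest_sub; first exact: smallest_sigma_algebra.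
move=> A [[B mB <-]|hA].
  rewrite setTI; have h := @gmeas_mono _ _ R _ _ (X (s + 1)) (sub_sigma_algebra2 (gen_F_gen_G (t := t))).
  have st1 : s + 1 <= t by rewrite addrC lez1D.
  by have := h (gen_F_X st1) measurableT B mB; rewrite setTI.
by apply: sub_sigma_algebra; right; exact: gen_F_mono (ltW st) _ hA.
Qed.

End generated_sigma_algebras.

Section equality_in_law.
Context d (T : measurableType d) (R : realType) (P : probability T R).

Lemma same_law_integral d' (E : measurableType d') (Z Z' : T -> E) (g : E -> \bar R) :
  measurable_fun setT Z -> measurable_fun setT Z' ->
  (forall B, measurable B -> P (Z @^-1` B) = P (Z' @^-1` B)) ->
  measurable_fun setT g -> (forall y, (0 <= g y)%E) ->
  (\int[P]_w g (Z w) = \int[P]_w g (Z' w))%E.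
Proof.
move=> mZ mZ' h mg g0.
have push (V : T -> E) : measurable_fun setT V ->
    exists2 nu : {measure set E -> \bar R}, (forall B, nu B = P (V @^-1` B)) &
     (\int[P]_w g (V w) = \int[nu]_y g y)%E.
  move=> mV; unshelve eexists (pushforward P V : {measure set _ -> \bar R}); first exact: mV.
    by [].
  by rewrite ge0_integral_pushforward// => y _; exact: g0.
have [n1 e1 ->] := push Z mZ; have [n2 e2 ->] := push Z' mZ'.
by apply: eq_measure_integral => B mB _; rewrite e1 e2 h.
Qed.

(** The one-point case of stationarity, shifted by t - 1. *)
Lemma stationary_law (X Y : int -> T -> R) (t : int) (B : set (R * R)) :
  strictly_stationary P X Y -> measurable B ->
  P ((fun w => (X t w, Y t w)) @^-1` B) = P ((fun w => (X 1 w, Y 1 w)) @^-1` B).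
Proof.
move=> st mB.
have mB' : measurable ((fun z : 1.-tuple (R * R) => tnth z ord0) @^-1` B).
  by rewrite -[X in measurable X]setTI; exact: measurable_tnth.
have := st 1%N [tuple 1] (t - 1) _ mB'; rewrite /preimage /=.
have e (k : int) : [set w | B (tnth [tuple (X (tnth [tuple 1%R] i + k) w, Y (tnth [tuple 1%R] i + k) w) | i < 1] ord0)] =
   [set w | B (X (1 + k) w, Y (1 + k) w)].
  by apply/seteqP; split => w /=; rewrite tnth_mktuple.
rewrite e addrC subrK => ->; congr (P _).
by apply/seteqP; split => w /=; rewrite tnth_mktuple.
Qed.

End equality_in_law.

Section moments.
Context d (T : measurableType d) (R : realType) (P : probability T R).

(** Hoelder's inequality against the constant 1, whose norm is 1. The sign of C is unknown, hence
    |C| under the root. *)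
Lemma Lnorm2_L1 (g : T -> R) (C n : R) : measurable_fun setT g -> 0 <= n ->
  ('N[P]_(2%:E)[EFin \o g] ^+ 2 <= (C * n)%:E)%E ->
  (\int[P]_w `|g w|%:E <= (Num.sqrt `|C| * Num.sqrt n)%:E)%E.
Proof.
move=> mg n0; have N0 := Lnorm_ge0 P 2%:E (EFin \o g); move: N0.
have H := @hoelder _ _ _ P g (cst 1) 2 2 mg (measurable_cst _) (ltr0n _ 2) (ltr0n _ 2).
have {}H : (\int[P]_w `|g w|%:E <= 'N[P]_(2%:E)[EFin \o g])%E.
  have := H _; have -> : (2^-1 + 2^-1 = 1 :> R) by lra.
  move=> /(_ erefl); rewrite Lnorm1 (_ : EFin \o cst 1%R = cst 1%E)//.
  have e1 : ('N[P]_(2%:E)[cst 1])%E = 1%E.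
    by rewrite Lnorm_cst1; change ((P setT `^ 2^-1)%E = 1%E); rewrite probability_setT poweR_EFin powR1.
  rewrite e1 mule1.
  by under eq_integral do rewrite /= mulr1.
move: ('N[P]_(2%:E)[EFin \o g])%E H => [s| |]//= H.
rewrite lee_fin => s0; rewrite -EFinM lee_fin -expr2 => h; apply: le_trans H _; rewrite lee_fin.
rewrite -sqrtrM// -[leLHS]ger0_norm// -sqrtr_sqr ler_wsqrtr//.
by apply: le_trans h _; rewrite ler_wpM2r// ler_norm.
Qed.

Lemma powR_le1D (v p q : R) : 0 <= v -> 0 <= p <= q -> v `^ p <= 1 + v `^ q.
Proof.
move=> v0 /andP[p0 pq]; have [v1|v1] := leP v 1.
  apply: le_trans (_ : 1 <= _); last by rewrite lerDl powR_ge0.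
  by have := @ge0_ler_powR R p p0 v 1; rewrite !nnegrE powR1; apply.
by apply: ler_wpDl => //; rewrite ler_powR// ltW.
Qed.

Lemma powR_add_le (u v q : R) : 0 <= u -> 0 <= v -> 0 <= q ->
  (u + v) `^ q <= 2 `^ q * (u `^ q + v `^ q).
Proof.
move=> u0 v0 q0; wlog uv : u v u0 v0 / u <= v => [hw|].
  by have [/hw|/ltW/hw] := leP u v; [apply|rewrite addrC [X in _ * X]addrC; apply].
apply: le_trans (_ : (2 * v) `^ q <= _).
  by apply: ge0_ler_powR; rewrite ?nnegrE ?mulr_ge0 ?addr_ge0//; lra.
by rewrite powRM// ler_wpM2l ?powR_ge0// lerDr powR_ge0.
Qed.

End moments.

Lemma clip_lip (R : realDomainType) (S a b : R) :
  `|Num.max 0 (Num.min S a) - Num.max 0 (Num.min S b)| <= `|a - b|.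
Proof.
have hmin : `|Num.min S a - Num.min S b| <= `|a - b|.
  have h1 := ler_norm (a - b); have h2 := ler_norm (b - a); rewrite distrC in h2.
  by rewrite ler_norml; have [ha|ha] := leP S a; have [hb|hb] := leP S b; apply/andP; split; lra.
apply: le_trans hmin; move: (Num.min S a) (Num.min S b) => u v.
have h1 := ler_norm (u - v); have h2 := ler_norm (v - u); rewrite distrC in h2.
by rewrite ler_norml; have [ha|ha] := leP 0 u; have [hb|hb] := leP 0 v; apply/andP; split; lra.
Qed.

Section pointwise_bound.
Context d (T : measurableType d) (R : realType) (P : probability T R).
Notation mu := (@lebesgue_measure R).

(** If g(x) < 0, then g < 0 and f >= f(x)/2 on a short interval to the right of x: it has positive
    probability and yet lies in a null event. The interval is one-sided so as to stay in the
    half-line when x = 0. *)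
Lemma density_point (X : T -> R) (f g : R -> R) (x : R) :
  measurable_fun setT X ->
  (forall B, measurable B -> P (X @^-1` B) = (\int[mu]_(y in B) (f y)%:E)%E) ->
  measurable_fun setT f -> (forall y, 0 <= f y) -> cts_at f x -> 0 < f x -> 0 <= x ->
  cts_at g x -> {ae P, forall w, 0 <= g (X w)} -> 0 <= g x.
Proof.
move=> mX hf mf f0 cf fx x0 cg [N [mN N0 hN]]; rewrite leNgt; apply/negP => gx.
have e1 : 0 < f x / 2 by rewrite divr_gt0.
have e2 : 0 < - g x / 2 by rewrite divr_gt0// oppr_gt0.
have [d1 d10 h1] := cf _ e1; have [d2 d20 h2] := cg _ e2.
pose dl := Num.min d1 d2 / 2.
have dl0 : 0 < dl by rewrite divr_gt0// lt_min d10.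
have dd : dl < Num.min d1 d2.
  have : 0 < Num.min d1 d2 by [rewrite lt_min d10]; rewrite /dl; lra.
pose B : set R := `[x, x + dl]%classic.
have mB : measurable B by exact: measurable_itv.
have inB y : B y -> 0 <= y /\ `|y - x| < Num.min d1 d2.
  rewrite /B/= in_itv/= => /andP[y1 y2]; split; first by lra.
  by rewrite ger0_norm ?subr_ge0//; apply: le_lt_trans dd; lra.
have PB : P (X @^-1` B) = 0%E.
  apply: (subset_measure0 _ mN _ N0) => [|w hw].
    by rewrite -[X in measurable X]setTI; exact: mX.
  apply: hN => /= hg; have [y0] := inB _ hw; rewrite lt_min => /andP[_ yd].
  by have := h2 _ y0 yd; rewrite ler_norml => /andP[]; lra.
have : ((f x / 2 * dl)%:E <= P (X @^-1` B))%E.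
  rewrite hf//.
  apply: le_trans (_ : (\int[mu]_(y in B) (f x / 2)%:E <= _)%E).
    rewrite integral_cst//= lebesgue_measure_itv/= lte_fin ltrDl dl0.
    by rewrite -EFinB -EFinM lee_fin addrAC subrr add0r.
  apply: ge0_le_integral => //.
  - by move=> y _; rewrite lee_fin ltW.
  - by apply/measurable_EFinP; exact: measurable_funTS.
  move=> y /inB[y0]; rewrite lt_min => /andP[yd _]; rewrite lee_fin.
  by have := h1 y y0 yd; rewrite ler_norml => /andP[]; lra.
by rewrite PB lee_fin leNgt mulr_gt0.
Qed.

End pointwise_bound.

Section conditional_moments.
Context d (T : measurableType d) (R : realType) (P : probability T R).
Implicit Types (Z W V : T -> R).

Lemma gmeas_indic (G : set (set T)) A : <<s G>> A -> gmeas G (\1_A : T -> R).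
Proof. by move=> hA; exact: (@measurable_indic _ (g_sigma_algebraType G)). Qed.

Lemma cond_exp_unique (G : set (set T)) Z W W' : <<s G>> `<=` measurable ->
  is_cond_exp P G Z W -> gmeas G W' -> L1 P W' ->
  (forall A, <<s G>> A -> \int[P]_w (\1_A w * Z w) = \int[P]_w (\1_A w * W' w)) ->
  {ae P, forall w, W w = W' w}.
Proof.
move=> subG ce gW' lW' h; have [_ lW gW _] := ce.
have e A : <<s G>> A -> \int[P]_w (\1_A w * W w) = \int[P]_w (\1_A w * W' w).
  move=> hA; rewrite -h//; symmetry.
  exact: (cond_exp_bounded subG ce (gmeas_indic hA) (indic_bnd A)).
have h1 : {ae P, forall w, W w <= W' w} by apply: (cond_le subG) => // A hA; rewrite e.
have h2 : {ae P, forall w, W' w <= W w} by apply: (cond_le subG) => // A hA; rewrite e.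
by apply: filterS2 h1 h2 => w w1 w2; apply/eqP; rewrite eq_le w1.
Qed.

(** Expand the square; the cross term is tested by [V w * m w], which is bounded because m is. *)
Lemma cond_second_moment (G : set (set T)) Z (m W : T -> R) (N : R) V M : <<s G>> `<=` measurable ->
  is_cond_exp P G Z m -> is_cond_exp P G (fun w => Z w ^+ 2) W ->
  (forall w, `|m w| <= N) -> gmeas G V -> (forall w, `|V w| <= M) ->
  \int[P]_w (V w * (Z w - m w) ^+ 2) = \int[P]_w (V w * (W w - m w ^+ 2)).
Proof.
move=> subG c1 c2 mN gV VM; have [lZ lm gm _] := c1; have [lZ2 lW _ _] := c2.
have mV := gmeas_measurable subG gV; have mm := gmeas_measurable subG gm.
have mm2 : measurable_fun setT (fun w => m w ^+ 2) by exact: measurable_funX.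
pose Vm w := V w * m w.
have gVm : gmeas G Vm by exact: (@measurable_funM _ (g_sigma_algebraType G)).
have VmM w : `|Vm w| <= M * N by rewrite normrM ler_pM.
have mVm := gmeas_measurable subG gVm.
have lm2 : L1 P (fun w => m w ^+ 2).
  by apply: (L1_bnd P (M := N ^+ 2) mm2) => w; rewrite normrX lerXn2r ?nnegrE//; exact: le_trans (mN w).
have l1 : L1 P (fun w => V w * Z w ^+ 2) := L1_bndM mV VM lZ2.
have l2 : L1 P (fun w => V w * m w ^+ 2) := L1_bndM mV VM lm2.
have l3 : L1 P (fun w => Vm w * Z w) := L1_bndM mVm VmM lZ.
have l4 : L1 P (fun w => V w * W w) := L1_bndM mV VM lW.
have l5 : L1 P (fun w => Vm w * m w) := L1_bndM mVm VmM lm.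
have e1 w : V w * (Z w - m w) ^+ 2 = (V w * Z w ^+ 2 - 2 * (Vm w * Z w)) + V w * m w ^+ 2.
  by rewrite /Vm; ring.
have e2 w : V w * (W w - m w ^+ 2) = (V w * W w - 2 * (Vm w * m w)) + V w * m w ^+ 2.
  by rewrite /Vm; ring.
under eq_Rintegral do rewrite e1; under [RHS]eq_Rintegral do rewrite e2.
have l3' := L1Z 2 l3; have l5' := L1Z 2 l5.
rewrite IntD//; last exact: L1B.
rewrite [RHS]IntD//; last exact: L1B.
rewrite IntB// [in RHS]IntB// !IntZ//.
by rewrite (cond_exp_bounded subG c1 gVm VmM) (cond_exp_bounded subG c2 gV VM).
Qed.

(** The set where g differs from 0 has the same probability under both laws. *)
Lemma ae_same_law (Z Z' : T -> R) (g : R -> R) :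
  measurable_fun setT Z -> measurable_fun setT Z' ->
  (forall B, measurable B -> P (Z @^-1` B) = P (Z' @^-1` B)) ->
  measurable_fun setT g -> {ae P, forall w, g (Z w) = 0} -> {ae P, forall w, g (Z' w) = 0}.
Proof.
move=> mZ mZ' h mg [N [mN N0 hN]].
pose B := g @^-1` (~` [set 0]).
have mB : measurable B by rewrite -[B]setTI; apply: mg => //; exact: measurableC.
exists (Z' @^-1` B); split.
- by rewrite -[X in measurable X]setTI; exact: mZ'.
- rewrite -h//; apply: (subset_measure0 _ mN _ N0).
    by rewrite -[X in measurable X]setTI; exact: mZ.
  by move=> w hw; apply: hN.
- by move=> w hw; exact: hw.
Qed.

End conditional_moments.

(** * From the stationary process to the general kernel theorem *)

Section gamma_regression.
Context (d : measure_display) (T : measurableType d) (R : realType).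
Notation mu := (@lebesgue_measure R).
Variables (P : probability T R) (X Y : int -> {RV P >-> R}).
Variables (Phi : R -> R) (h : nat -> R) (f : R -> R) (fc : int -> T -> R -> R).
Variables (r W2 Wz sigma2 : R -> R) (zeta x : R).
Hypothesis X0 : forall t w, 0 <= X t w.
Hypothesis Y0 : forall t w, 0 <= Y t w.
Hypothesis stat : strictly_stationary P (fun t => X t) (fun t => Y t).
Hypothesis densX : forall t, is_density P (X t) f.
Hypothesis mPhi : measurable_fun halfline Phi.
Hypothesis r_cond : is_cond_exp_at P (Phi \o Y 1) (X 1) r.
Hypothesis W2_cond : is_cond_exp_at P (fun w => Phi (Y 1 w) ^+ 2) (X 1) W2.
Hypothesis Wz_cond : is_cond_exp_at P (fun w => `|Phi (Y 1 w)| `^ (zeta + 2)) (X 1) Wz.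
Hypothesis s_cond : is_cond_var_at P (Phi \o Y 1) (X 1) sigma2.
Hypothesis ch : h n @[n --> \oo] --> 0.
Hypothesis x0 : 0 <= x.
Hypothesis fx0 : 0 < f x.
Hypothesis fc_cond : forall t,
  is_cond_density P (gen_F (fun s => X s) (fun s => Y s) (t - 1)) (X t) (fc t).
Hypothesis f_C0 : C0 f.
Hypothesis hyp2 : {ae P, forall w,
  supnorm (fun y => n%:R^-1 * (\sum_(1 <= t < n.+1) fc t w y) - f y)
    @[n --> \oo] --> 0%E}.
Hypothesis r_cont : {within halfline, continuous r}.
Hypothesis r_bnd : bounded_on_halfline r.
Hypothesis hyp4 : forall t : int,
  is_cond_exp P (gen_G (fun s => X s) (fun s => Y s) (t - 1)) (Phi \o Y t) (r \o X t).
Hypothesis zeta0 : 0 < zeta.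
Hypothesis hyp6 : forall t : int,
  is_cond_exp P (gen_G (fun s => X s) (fun s => Y s) (t - 1))
    (fun w => Phi (Y t w) ^+ 2) (W2 \o X t).
Hypothesis Wz_bnd : bounded_on_halfline Wz.
Hypothesis s_cont : {within halfline, continuous sigma2}.
Hypothesis f_C2 : bounded_C2 f.
Hypothesis r_C2 : bounded_C2 r.
Hypothesis hyp8 : exists C : R, \forall n \near \oo,
  (ereal_sup [set 'N[P]_(2%:E)[(fun w =>
       (\sum_(1 <= t < n.+1) fc t w y - n%:R * f y)%:E)] ^+ 2
     | y in halfline] <= (C * n%:R)%:E)%E.

Let mX t : measurable_fun setT (X t). Proof. exact: measurable_funPT. Qed.
Let mY t : measurable_fun setT (Y t). Proof. exact: measurable_funPT. Qed.

(* Index k stands for time t = k + 1, so that gF k and gG k generate F_(t-1) and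
   G_(t-1); functions on [0, +oo[ are extended to the line by zero. *)
Let gF (k : nat) := gen_F (fun s => X s) (fun s => Y s) (k.+1%:Z - 1).
Let gG (k : nat) := gen_G (fun s => X s) (fun s => Y s) (k.+1%:Z - 1).
Let X' (k : nat) : T -> R := X k.+1%:Z.
Let U (k : nat) w : R := Phi (Y k.+1%:Z w).
Let q (k : nat) w : R -> R := ext (fc k.+1%:Z w).
Let F := ext f. Let r' := ext r.

Let kE (k : nat) : k.+1%:Z - 1 = k%:Z :> int.
Proof. by rewrite -addn1 PoszD addrK. Qed.

Let subF k : <<s gF k>> `<=` measurable.
Proof. exact/sub_measurable/gen_F_sub. Qed.

Let subG k : <<s gG k>> `<=` measurable.
Proof. exact/sub_measurable/gen_G_sub. Qed.

Let monoF j k : (j <= k)%N -> <<s gF j>> `<=` <<s gF k>>.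
Proof. by move=> jk; apply: sub_sigma_algebra2; apply: gen_F_mono; rewrite !kE lez_nat. Qed.

Let monoG j k : (j <= k)%N -> <<s gG j>> `<=` <<s gG k>>.
Proof. by move=> jk; apply: gen_G_mono; rewrite !kE lez_nat. Qed.

Let X_adapted j k : (j < k)%N -> gmeas (gF k) (X' j).
Proof. by move=> jk; apply: gen_F_X; rewrite kE lez_nat. Qed.

Let gX k : gmeas (gG k) (X' k).
Proof.
have := @gen_G_X _ T R (fun s => X s) (fun s => Y s) (k.+1%:Z - 1).
by rewrite subrK.
Qed.

Let UE k w : U k w = ext Phi (Y k.+1%:Z w). Proof. by rewrite extE. Qed.

Let gU j k : (j < k)%N -> gmeas (gG k) (U j).
Proof.
move=> jk; have -> : U j = fun w => ext Phi (Y j.+1%:Z w) by exact/funext/UE.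
apply: (@measurableT_comp _ _ _ _ _ _ (ext Phi)); first exact: measurable_ext.
apply: (@gmeas_mono _ _ R (gF k)); first by apply: sub_sigma_algebra2; exact: gen_F_gen_G.
by apply: gen_F_Y; rewrite kE lez_nat.
Qed.

Let mU k : measurable_fun setT (U k).
Proof. by have hh := @gU _ _ (ltnSn k); exact: gmeas_measurable (@subG _) hh. Qed.

Let mr : measurable_fun setT r'. Proof. by apply: measurable_ext; case: r_cond. Qed.

Let mf : measurable_fun setT F.
Proof. by apply: measurable_ext; have [] := densX 0. Qed.

Let f0 y : 0 <= F y.
Proof.
have [_ f0 _] := densX 0; have [y0|y0] := leP 0 y; last by rewrite /F ext_neg.
by rewrite /F extE// f0.
Qed.

Let hf k B : measurable B -> P (X' k @^-1` B) = (\int[mu]_(y in B) (F y)%:E)%E.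
Proof.
move=> mB; have [_ _ ->//] := densX k.+1%:Z; rewrite Int_ext//.
Qed.

Let lf : L1 mu F.
Proof.
apply/integrableP; split; first exact/measurable_EFinP.
under eq_integral do rewrite gee0_abs ?lee_fin//.
by rewrite -(@hf 0%N setT)// preimage_setT probability_setT ltry.
Qed.

Let fB : exists2 B : R, 0 <= B & forall y, `|F y| <= B.
Proof.
by apply: bounded_ext; apply: C0_bounded => //; have [] := densX 0.
Qed.

Let q0 k w y : 0 <= q k w y.
Proof.
have [_ fc0 _] := fc_cond k.+1%:Z; have [y0|y0] := leP 0 y; last by rewrite /q ext_neg.
by rewrite /q extE// fc0.
Qed.

Let mq k : measurable_fun setT ((fun z => q k z.1 z.2) : g_sigma_algebraType (gF k) * R -> R).
Proof.
have [mfc _ _] := fc_cond k.+1%:Z.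
have mD : measurable (setT `*` (halfline : set R) : set (g_sigma_algebraType (gF k) * R)).
  by apply: measurableX => //; exact: measurable_halfline.
have := (measurable_restrictT _ mD).1 mfc; congr measurable_fun.
apply/funext => -[w y]; rewrite /q /ext !patchE/=.
by rewrite in_setX in_setT.
Qed.

Let hq k A B : <<s gF k>> A -> measurable B ->
  P (A `&` X' k @^-1` B) = (\int[P]_(w in A) \int[mu]_(y in B) (q k w y)%:E)%E.
Proof.
move=> hA mB; have [_ _ hh] := fc_cond k.+1%:Z; rewrite (hh A B hA mB).
by apply: eq_integral => w _; rewrite Int_ext.
Qed.

Let D n w := supnorm (fun y => n%:R^-1 * (\sum_(1 <= t < n.+1) fc t w y) - f y).

Let sumE (n : nat) (g : int -> R) : \sum_(1 <= t < n.+1) g t%:Z = \sum_(k < n) g k.+1%:Z.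
Proof. by rewrite big_add1/= big_mkord. Qed.

Let D_bound n w y : (`|n%:R^-1 * (\sum_(k < n) q k w y) - F y|%:E <= D n w)%E.
Proof.
have ub z : (`|n%:R^-1 * (\sum_(1 <= t < n.+1) fc t w z) - f z|%:E <= D n w)%E.
  by apply: ereal_sup_ubound; exists z.
have [y0|y0] := leP 0 y.
  rewrite /F extE//; under eq_bigr do rewrite /q extE//.
  by rewrite -(sumE n (fun t => fc t w y)).
rewrite /F ext_neg// big1 => [|k _]; last by rewrite /q ext_neg.
rewrite mulr0 subrr normr0; apply: le_trans (ub 0); by rewrite lee_fin.
Qed.

Let q_L1 : exists C, \forall n \near \oo, forall y,
  (\int[P]_w `|\sum_(k < n) q k w y - n%:R * F y|%:E <= (C * Num.sqrt n%:R)%:E)%E.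
Proof.
have [C hC] := hyp8; exists (Num.sqrt `|C|).
near=> n => y.
have hn : (ereal_sup [set 'N[P]_(2%:E)[(fun w =>
       (\sum_(1 <= t < n.+1) fc t w y - n%:R * f y)%:E)] ^+ 2
     | y in halfline] <= (C * n%:R)%:E)%E by near: n.
have [y0|y0] := leP 0 y; last first.
  have -> : (fun w => `|\sum_(k < n) q k w y - n%:R * F y|%:E) = cst 0%E.
    apply/funext => w; rewrite /F ext_neg// mulr0 subr0 big1 ?normr0// => k _.
    by rewrite /q ext_neg.
  by rewrite integral0 lee_fin mulr_ge0.
have mg : measurable_fun setT (fun w => \sum_(k < n) q k w y - n%:R * F y).
  apply: measurable_funB => //; apply: measurable_sum => k.
  have mq' := cd_measurable (@subF k) (@mq k).
  have mp : measurable_fun setT (fun w : T => (w, y)) by exact: measurable_fun_pair.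
  exact: (measurableT_comp mq' mp).
apply: (Lnorm2_L1 mg) => //; apply: le_trans hn; apply: ereal_sup_ubound.
exists y; first exact/halflineP.
congr ((_ : \bar R) ^+ 2)%E; apply: eq_Lnorm => w /=; congr EFin.
rewrite /F extE//; under [in RHS]eq_bigr do rewrite /q extE//.
by rewrite -(sumE n (fun t => fc t w y)).
Unshelve. all: by end_near.
Qed.

Let rB : exists2 M : R, 0 <= M & forall y, `|r' y| <= M.
Proof. exact: bounded_ext. Qed.

Let sX1 : <<s gen_var (X 1)>> `<=` measurable.
Proof. exact: gen_var_measurable. Qed.

Let Wz_bound : exists2 Mz : R, 0 <= Mz & forall y, 0 <= y -> Wz y <= Mz.
Proof.
have [M M0 hM] := bounded_ext Wz_bnd; exists M => // y y0.
by rewrite -(extE Wz y0); apply: le_trans (hM y); exact: ler_norm.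
Qed.

(** Z^2 <= 1 + |Z|^(zeta + 2), and conditional expectation preserves the inequality. *)
Let W2_bound : exists2 Sb : R, 0 <= Sb & {ae P, forall w, W2 (X 1 w) <= Sb}.
Proof.
have [Mz M0 hM] := Wz_bound; exists (1 + Mz); first by rewrite addr_ge0.
have [_ c2] := W2_cond; have [_ cz] := Wz_cond.
have [lZ2 lW2 gW2 _] := c2; have [lZz lWz gWz _] := cz.
apply: (cond_le sX1 gW2 _ lW2 (L1_cst P (1 + Mz))) => [|A hA].
  exact: (@measurable_cst _ _ (g_sigma_algebraType (gen_var (X 1)))).
have gA : gmeas (gen_var (X 1)) (\1_A : T -> R) by exact: gmeas_indic.
have mA := gmeas_measurable sX1 gA.
have bA w := @indic_bnd T R A w.
rewrite -(cond_exp_bounded sX1 c2 gA bA).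
have lA : L1 P (\1_A : T -> R) by have hh := L1_bnd P mA bA; exact: hh.
have lAz : L1 P (fun w => \1_A w * `|Phi (Y 1 w)| `^ (zeta + 2)) := L1_bndM mA bA lZz.
have lAwz : L1 P (fun w => \1_A w * Wz (X 1 w)) := L1_bndM mA bA lWz.
have lA2 : L1 P (fun w => \1_A w * Phi (Y 1 w) ^+ 2) := L1_bndM mA bA lZ2.
have A0 w : 0 <= \1_A w :> R by rewrite indicE.
apply: le_trans (_ : \int[P]_w (\1_A w + \1_A w * `|Phi (Y 1 w)| `^ (zeta + 2)) <= _).
  apply: Int_le => //; first exact: L1D.
  move=> w; rewrite -{2}(mulr1 (\1_A w)) -mulrDr ler_wpM2l//.
  rewrite -(real_normK (num_real (Phi _))) -powR_mulrn//.
  by have z0 := zeta0; apply: powR_le1D => //; apply/andP; split; lra.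
rewrite IntD// (cond_exp_bounded sX1 cz gA bA) -IntD//.
apply: Int_le; [exact: L1D|exact: (L1_bndM mA bA (L1_cst P _))|move=> w].
by rewrite -{1}(mulr1 (\1_A w)) -mulrDr ler_wpM2l// lerD2l hM.
Qed.

(** The conditional variance comes with its own version m of the regression function; m(X_1) =
    r(X_1) almost surely, and the first claim follows by [cond_second_moment], the second by
    [cond_le]. *)
Let sigma2_ae : {ae P, forall w, W2 (X 1 w) - r (X 1 w) ^+ 2 = sigma2 (X 1 w)} /\
  {ae P, forall w, 0 <= sigma2 (X 1 w)}.
Proof.
have [_ cr] := r_cond; have [_ c2] := W2_cond.
have [m [[_ cm] [_ cs]]] := s_cond.
have [lZ lr gr _] := cr; have [_ lm gm _] := cm.
have [lZ2 lW2 gW2 _] := c2; have [lZs ls gs _] := cs.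
have [Rb R0 hR] := rB.
have rb w : `|(r \o X 1) w| <= Rb by have := hR (X 1 w); rewrite /r' extE.
have mr1 : {ae P, forall w, m (X 1 w) = r (X 1 w)}.
  apply: (cond_exp_unique sX1 cm gr lr) => A hA.
  exact: (cond_exp_bounded sX1 cr (gmeas_indic hA) (@indic_bnd T R A)).
have mr_ := gmeas_measurable sX1 gr.
have gW' : gmeas (gen_var (X 1)) (fun w => W2 (X 1 w) - r (X 1 w) ^+ 2).
  apply: (@measurable_funB _ (g_sigma_algebraType (gen_var (X 1)))) => //.
  by apply: measurable_funX.
have lr2 : L1 P (fun w => r (X 1 w) ^+ 2).
  apply: (L1_bnd P (M := Rb ^+ 2)); first exact: measurable_funX.
  by move=> w; rewrite normrX lerXn2r ?nnegrE//; exact: rb.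
split.
  have := @cond_exp_unique _ T R P _ _ _ (fun w => W2 (X 1 w) - r (X 1 w) ^+ 2) sX1 cs gW'.
  move=> /(_ (L1B lW2 lr2)) hu.
  have {}hu : {ae P, forall w, sigma2 (X 1 w) = W2 (X 1 w) - r (X 1 w) ^+ 2}.
    apply: hu => A hA; rewrite -(cond_second_moment sX1 cr c2 rb (gmeas_indic hA) (@indic_bnd T R A)).
    have mA := gmeas_measurable sX1 (gmeas_indic hA).
    have mZ := L1_measurable lZ; have mm := L1_measurable lm.
    apply: Int_ae_eq.
    - by apply: measurable_funM => //; apply: measurable_funX; exact: measurable_funB.
    - by apply: measurable_funM => //; apply: measurable_funX; exact: measurable_funB.
    by apply: filterS mr1 => w /= ->.
  by apply: filterS hu => w ->.
apply: (cond_le sX1 _ gs (L1_cst P 0) ls) => [|A hA].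
  exact: (@measurable_cst _ _ (g_sigma_algebraType (gen_var (X 1)))).
rewrite -(cond_exp_bounded sX1 cs (gmeas_indic hA) (@indic_bnd T R A)).
rewrite (_ : (fun w => \1_A w * cst 0 w) = cst 0); last by apply/funext => w; rewrite /= mulr0.
rewrite Int_cst; apply: Int_ge0 => w; rewrite mulr_ge0 ?sqr_ge0//.
Qed.

Let F_cts : cts_at F x.
Proof.
apply: cts_at_ext => //; have [f1 [f2 [df _ _ _]]] := f_C2; exact: derivative_cts df.
Qed.

Let Fx0 : 0 < F x. Proof. by rewrite /F extE. Qed.

(* sigma2 may be unbounded, but almost surely sigma2 (X_1) <= W2 (X_1) <= 1 + sup Wz.
   Clipping sigma2 at this level changes it neither almost surely along the
   process nor at x, where f > 0 and sigma2 is continuous. *)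
Let variance_function : exists s : R -> R, exists Sb : R,
  [/\ measurable_fun setT s, forall y, 0 <= s y <= Sb, cts_at s x, s x = sigma2 x &
      forall k V (M : R), gmeas (gG k) V -> (forall w, `|V w| <= M) ->
      \int[P]_w (V w * (U k w - r' (X' k w)) ^+ 2) = \int[P]_w (V w * s (X' k w))].
Proof.
have [Sb S0 hS] := W2_bound; have [e1 e0] := sigma2_ae.
have [m [_ [ms _]]] := s_cond; have [mW2 _] := W2_cond.
have cs := within_cts x0 s_cont.
pose s := ext (fun y => Num.max 0 (Num.min Sb (ext sigma2 y))).
have mes := measurable_ext ms.
have mes' : measurable_fun setT (fun y => Num.max 0 (Num.min Sb (ext sigma2 y))).
  by apply: measurable_maxr => //; exact: measurable_minr.
have hs_le : {ae P, forall w, sigma2 (X 1 w) <= Sb}.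
  by apply: filterS2 e1 hS => w <- h2; have := sqr_ge0 (r (X 1 w)); lra.
(* Almost sure bounds on [sigma2 (X 1)] hold at x itself by [density_point]. *)
have sx : 0 <= sigma2 x <= Sb.
  apply/andP; split.
    exact: (density_point (@mX 1) (@hf 0%N) mf f0 F_cts Fx0 x0 cs e0).
  rewrite -subr_ge0.
  apply: (density_point (g := fun y => Sb - sigma2 y) (@mX 1) (@hf 0%N) mf f0 F_cts Fx0 x0).
    move=> e ep; have [dl dl0 hd] := cs e ep; exists dl => // y y0 yd.
    by rewrite distrC opprB addrC -addrA addKr; apply: hd.
  by apply: filterS hs_le => w; rewrite subr_ge0.
have s_ae : {ae P, forall w, ext W2 (X 1 w) - r' (X 1 w) ^+ 2 - s (X 1 w) = 0}.
  apply: filterS3 e1 e0 hs_le => w h1 h2 h3; rewrite /s /r' !extE// h1.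
  by rewrite (min_idPr h3) (max_idPr h2) subrr.
exists s, Sb; split.
- by apply: measurable_ext; exact: measurable_funTS.
- move=> y; have [y0|y0] := leP 0 y; last by rewrite /s ext_neg// lexx.
  by rewrite /s extE// le_max lexx/= ge_max S0 ge_min lexx.
- apply: cts_at_ext => // e ep; have [dl dl0 hd] := cs e ep; exists dl => // y y0 yd.
  apply: le_trans (hd y y0 yd); rewrite !extE//.
  exact: clip_lip.
- by rewrite /s !extE//; case/andP: sx => s1 s2; rewrite (min_idPr s2) (max_idPr s1).
- move=> k V M gV VM.
  have [Rb R0 hR] := rB.
  have rb w : `|(r \o X k.+1%:Z) w| <= Rb by have := hR (X k.+1%:Z w); rewrite /r' extE.
  have e w : V w * (U k w - r' (X' k w)) ^+ 2 = V w * (U k w - (r \o X k.+1%:Z) w) ^+ 2.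
    by rewrite /r' /X' extE; last exact: X0.
  under eq_Rintegral do rewrite e.
  rewrite (cond_second_moment (@subG k) (@hyp4 k.+1%:Z) (@hyp6 k.+1%:Z) rb gV VM).
  have mV := gmeas_measurable (@subG k) gV.
  have [_ lW2 _ _] := @hyp6 k.+1%:Z; have [_ lr _ _] := @hyp4 k.+1%:Z.
  have mW := L1_measurable lW2; have mr_ := L1_measurable lr.
  apply: Int_ae_eq.
  + by apply: measurable_funM => //; apply: measurable_funB => //; exact: measurable_funX.
  + apply: measurable_funM => //; apply: measurableT_comp => //.
    by apply: measurable_ext; exact: measurable_funTS.
  have mgg : measurable_fun setT (fun y => ext W2 y - r' y ^+ 2 - s y).
    apply: measurable_funB; last by apply: measurable_ext; exact: measurable_funTS.
    by apply: measurable_funB; [exact: measurable_ext|exact: measurable_funX].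
  have sl B : measurable B -> P (X 1 @^-1` B) = P (X' k @^-1` B).
    by move=> mB; rewrite (@hf k)// -(@hf 0%N).
  (* The relation known at time 1 is carried to time k + 1 by equality of laws. *)
  have := ae_same_law (@mX 1) (@mX k.+1%:Z) sl mgg s_ae.
  apply: filterS => w; rewrite /r' !extE// => /eqP; rewrite subr_eq0 => /eqP <-.
  by [].
Qed.

Let measurable_moment (p : R) : measurable_fun setT (fun y => `|ext Phi y| `^ p).
Proof.
have m1 : measurable_fun setT (fun y => `|ext Phi y|).
  by apply: measurableT_comp => //; exact: measurable_ext.
exact: (measurableT_comp (measurable_powR p) m1).
Qed.

(** Stationarity of the pairs reduces every time to time 1, the one at which [Wz] is given. *)
Let moment_law k (g : R -> R) : measurable_fun setT g -> (forall y, 0 <= g y) ->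
  (\int[P]_w (g (X' k w) * `|U k w| `^ (zeta + 2))%:E =
   \int[P]_w (g (X 1 w) * `|Phi (Y 1 w)| `^ (zeta + 2))%:E)%E.
Proof.
move=> mg g0; pose G (z : R * R) := (g z.1 * `|ext Phi z.2| `^ (zeta + 2))%:E.
have mG : measurable_fun setT G.
  apply/measurable_EFinP; apply: measurable_funM.
    by apply: measurableT_comp => //.
  by have := measurableT_comp (measurable_moment (zeta + 2)) measurable_snd; exact.
have := @same_law_integral _ T R P _ _ (fun w => (X k.+1%:Z w, Y k.+1%:Z w)) (fun w => (X 1 w, Y 1 w)) G.
rewrite /G/= => hl.
transitivity (\int[P]_w (g (X k.+1%:Z w) * `|ext Phi (Y k.+1%:Z w)| `^ (zeta + 2))%:E)%E.
  by apply: eq_integral => w _; rewrite UE.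
have h1 : measurable_fun setT (fun w => (X k.+1%:Z w, Y k.+1%:Z w)) by exact: measurable_fun_pair.
have h2 : measurable_fun setT (fun w => (X 1 w, Y 1 w)) by exact: measurable_fun_pair.
have h3 (B : set (R * R)) : measurable B -> P ((fun w => (X k.+1%:Z w, Y k.+1%:Z w)) @^-1` B) =
    P ((fun w => (X 1 w, Y 1 w)) @^-1` B) by move=> mB; exact: (stationary_law k.+1%:Z stat mB).
have h5 z : (0 <= (g z.1 * `|ext Phi z.2| `^ (zeta + 2))%:E)%E.
  by rewrite lee_fin mulr_ge0// powR_ge0.
rewrite (hl h1 h2 h3 mG h5).
by apply: eq_integral => w _; rewrite extE.
Qed.

Let L1_moment k : L1 P (fun w => `|U k w| `^ (zeta + 2)).
Proof.
have [_ [lZ _ _ _]] := Wz_cond.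
have mm : measurable_fun setT (fun w => `|U k w| `^ (zeta + 2)).
  have m1 : measurable_fun setT (fun w => `|U k w|) by exact: measurableT_comp.
  exact: (measurableT_comp (measurable_powR _) m1).
apply/integrableP; split; first exact/measurable_EFinP.
under eq_integral do rewrite gee0_abs ?lee_fin ?powR_ge0//.
have := moment_law k (measurable_cst (1 : R)) (fun=> ler01).
have e (u v : T -> R) : (\int[P]_w (cst (1 : R) (u w) * v w)%:E = \int[P]_w (v w)%:E)%E.
  by apply: eq_integral => w _; rewrite /= mul1r.
rewrite !e => ->.
have /integrableP[_] := lZ.
by under eq_integral do rewrite gee0_abs ?lee_fin ?powR_ge0//.
Qed.

Let moment_bound : exists2 Mz : R, 0 <= Mz & forall k (g : R -> R) (M : R), measurable_fun setT g ->
  (forall y, 0 <= g y <= M) ->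
  \int[P]_w (g (X' k w) * `|U k w| `^ (zeta + 2)) <= Mz * \int[P]_w g (X' k w).
Proof.
have [Mz M0 hM] := Wz_bound; exists Mz => // k g M mg gM.
have g0 y : 0 <= g y by have /andP[] := gM y.
have gb y : `|g y| <= M by rewrite ger0_norm//; have /andP[] := gM y.
have [_ cz] := Wz_cond; have [lZ lW _ _] := cz.
have -> : \int[P]_w (g (X' k w) * `|U k w| `^ (zeta + 2)) =
    \int[P]_w (g (X 1 w) * `|Phi (Y 1 w)| `^ (zeta + 2)).
  by rewrite /Rintegral moment_law.
have gg : gmeas (gen_var (X 1)) (fun w => g (X 1 w)).
  apply: (@measurableT_comp _ _ _ _ _ _ g) => //; exact: gmeas_gen_var.
rewrite (cond_exp_bounded sX1 cz gg (fun w => gb (X 1 w))).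
rewrite (expect_X subF X_adapted f0 lf hf k mg gb) -(expect_X subF X_adapted f0 lf hf 0%N mg gb).
have mg1 := gmeas_measurable sX1 gg.
have lg : L1 P (fun w => g (X 1 w)) by have hh := L1_bnd P mg1 (fun w => gb (X 1 w)); exact: hh.
rewrite -IntZ//; apply: Int_le; [exact: (L1_bndM mg1 (fun w => gb (X 1 w)) lW)|exact: L1Z|move=> w].
by rewrite mulrC ler_wpM2r//=; exact: hM.
Qed.

(** [min_sqr_cube] requires an exponent at most 1, while zeta may be larger. *)
Let p : R := Num.min zeta 1.

Let p01 : 0 < p <= 1.
Proof. by rewrite /p lt_min zeta0 ltr01 ge_min lexx orbT. Qed.

(** |U - r|^(2 + p) <= 1 + |U - r|^(zeta + 2); then [powR_add_le] splits the power of the sum, and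
    the bounded function r is absorbed into the constant. *)
Let centered_moment : exists2 H : R, 0 <= H &
  (forall k, L1 P (fun w => `|U k w - r' (X' k w)| `^ (2 + p))) /\
  (forall k (g : R -> R) (M : R), measurable_fun setT g -> (forall y, 0 <= g y <= M) ->
  \int[P]_w (g (X' k w) * `|U k w - r' (X' k w)| `^ (2 + p)) <= H * \int[P]_w g (X' k w)).
Proof.
have [Mz M0 hM] := moment_bound; have [Rb R0 hR] := rB; have /andP[p0 p1] := p01.
pose a : R := 2 `^ (zeta + 2); have a0 : 0 <= a by exact: powR_ge0.
pose b : R := 1 + a * Rb `^ (zeta + 2); have b0 : 0 <= b.
  by rewrite addr_ge0// mulr_ge0// powR_ge0.
have pz : p <= zeta by rewrite /p ge_min lexx.
have le k w : `|U k w - r' (X' k w)| `^ (2 + p) <= b + a * `|U k w| `^ (zeta + 2).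
  have q1 : 0 <= 2 + p <= zeta + 2 by apply/andP; split; lra.
  apply: le_trans (powR_le1D (normr_ge0 _) q1) _; rewrite /b -addrA lerD2l.
  apply: le_trans (_ : (`|U k w| + Rb) `^ (zeta + 2) <= _).
    apply: ge0_ler_powR; rewrite ?nnegrE ?addr_ge0//; first by lra.
    by apply: le_trans (ler_normB _ _) _; rewrite lerD2l.
  apply: le_trans (powR_add_le (normr_ge0 _) R0 _) _; first by lra.
  by rewrite mulrDr addrC.
have mUr k : measurable_fun setT (fun w => `|U k w - r' (X' k w)| `^ (2 + p)).
  have m1 : measurable_fun setT (fun w => `|U k w - r' (X' k w)|).
    apply: measurableT_comp => //; apply: measurable_funB => //.
    by apply: measurableT_comp => //; exact: mX.
  exact: (measurableT_comp (measurable_powR _) m1).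
have lb k : L1 P (fun w => b + a * `|U k w| `^ (zeta + 2)).
  exact: (L1D (L1_cst P b) (L1Z a (L1_moment k))).
have lU k : L1 P (fun w => `|U k w - r' (X' k w)| `^ (2 + p)).
  by apply: (L1_le (mUr k) _ (lb k)) => w; rewrite ger0_norm ?powR_ge0.
exists (b + a * Mz); first by rewrite addr_ge0// mulr_ge0.
split=> // k g M mg gM.
have g0 y : 0 <= g y by have /andP[] := gM y.
have gb y : `|g y| <= M by rewrite ger0_norm//; have /andP[] := gM y.
have mg1 : measurable_fun setT (fun w => g (X' k w)).
  by apply: measurableT_comp => //; exact: mX.
have lg : L1 P (fun w => g (X' k w)) by have hh := L1_bnd P mg1 (fun w => gb (X' k w)); exact: hh.
have l2 : L1 P (fun w => g (X' k w) * `|U k w| `^ (zeta + 2)).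
  exact: (L1_bndM mg1 (fun w => gb (X' k w)) (L1_moment k)).
apply: le_trans (_ : \int[P]_w (b * g (X' k w) + a * (g (X' k w) * `|U k w| `^ (zeta + 2))) <= _).
  apply: Int_le; [exact: (L1_bndM mg1 (fun w => gb (X' k w)) (lU k))| |move=> w].
    by apply: L1D; exact: L1Z.
  rewrite (_ : _ + _ = g (X' k w) * (b + a * `|U k w| `^ (zeta + 2))); last by ring.
  by rewrite ler_wpM2l.
rewrite IntD; [|exact: L1Z|exact: L1Z]; rewrite !IntZ// (mulrDl b (a * Mz)) lerD2l -[leRHS]mulrA ler_wpM2l//.
exact: hM gM.
Qed.

(** [bias_bound] asks for a bound on f(y) - f(x) linear in |y - x| on the whole half-line. Within
    distance 1 of x it follows from Taylor's formula, further away from the boundedness of f. *)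
Let bias_bound_C : exists Cb : R, forall (K : R -> R) (b : R),
  (forall y, 0 <= K y) -> (forall y, y < 0 -> K y = 0) ->
  L1 mu K -> L1 mu (fun y => (y - x) * K y) -> L1 mu (fun y => (y - x) ^+ 2 * K y) ->
  `|\int[mu]_y ((y - x) * K y)| <= b -> \int[mu]_y ((y - x) ^+ 2 * K y) <= b ->
  `|\int[mu]_y ((r' y - r' x) * K y * F y)| <= Cb * b.
Proof.
have [B B0 hB] := fB; have [Rb R0 hR] := rB.
have [f1 [f2 [df df' _ [Mf hMf]]]] := f_C2; have [r1 [r2 [dr dr' _ [Mr hMr]]]] := r_C2.
have Mf0 : 0 <= Mf by exact: le_trans (hMf 0 (lexx _)).
exists (`|r1 x * F x| + (Mr * B + `|r1 x| * (`|f1 x| + Mf + 2 * B))).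
apply: (bias_bound mr mf _ hB); first by exists Rb.
  by move=> y y0; rewrite /r' !extE//; exact: halfline_taylor dr dr' hMr.
move=> y y0; have tf := halfline_taylor x0 y0 df df' hMf; rewrite /F !extE//.
have [y1|y1] := leP `|y - x| 1.
  rewrite -[f y - f x](subrK (f1 x * (y - x))); apply: le_trans (ler_normD _ _) _.
  apply: le_trans (_ : Mf * `|y - x| + `|f1 x| * `|y - x| <= _).
    rewrite lerD ?normrM//; apply: le_trans tf _; rewrite ler_wpM2l//.
    by rewrite -(real_normK (num_real (y - x))) expr2 ler_piMl.
  by rewrite -mulrDl ler_wpM2r//; have := B0; lra.
have hf2 z : 0 <= z -> `|f z| <= B by move=> z0; have := hB z; rewrite /F extE.
apply: le_trans (_ : 2 * B <= _).
  by apply: le_trans (ler_normB _ _) _; have := hf2 _ y0; have := hf2 _ x0; lra.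
apply: le_trans (_ : 2 * B * `|y - x| <= _).
  by rewrite ler_peMr ?mulr_ge0// ltW.
by rewrite ler_wpM2r// lerDr addr_ge0.
Qed.

Lemma gamma_regression_clt (c : nat -> R) (kappa A : R) :
  localizing_kernel (fun n => gamma_kernel h n x) h c x kappa A ->
  (n%:R * c n)^-1 @[n --> \oo] --> 0 -> c n @[n --> \oo] --> 0 ->
  Num.sqrt (n%:R * c n) * h n @[n --> \oo] --> 0 ->
  cvg_in_distribution P (fun n w => Num.sqrt (n%:R * c n) *
      (gamma_estimator Phi h (fun t => X t) (fun t => Y t) n x w - r x))
    (centered_normal (sigma2 x * kappa / f x)).
Proof.
move=> lk cnc cc cnch.
have [B B0 hB] := fB; have [Rb R0 hR] := rB; have [C8 hC8] := q_L1.
have [Cb hCb] := bias_bound_C; have [s [Sb [ms sb cs sx hs]]] := variance_function.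
have [H H0 [lUp hH]] := centered_moment.
have r_cts : cts_at r' x by apply: cts_at_ext => //; exact: within_cts.
have bias n : `|\int[mu]_y ((r' y - r' x) * gamma_kernel h n x y * F y)| <= Cb * A * h n.
  rewrite -mulrA; apply: hCb.
  - exact: lk_ge0 lk n.
  - exact: lk_neg lk n.
  - exact: lk_L1 lk n.
  - exact: lk_L1_mean lk n.
  - exact: lk_L1_var lk n.
  - exact: lk_mean lk n.
  - exact: lk_var lk n.
have lU2 k : L1 P (fun w => U k w ^+ 2) by have [] := hyp6 k.+1%:Z.
have U_mean k V (M : R) : gmeas (gG k) V -> (forall w, `|V w| <= M) ->
    \int[P]_w (V w * U k w) = \int[P]_w (V w * r' (X' k w)).
  move=> gV VM; rewrite (cond_exp_bounded (@subG k) (hyp4 k.+1%:Z) gV VM).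
  by apply: eq_Int => w; rewrite /r' /X' /= extE.
have := kernel_regression_clt subF monoF X_adapted mq q0 hq f0 lf hf hB lk x0 ch cnc cc cnch
  F_cts Fx0 D_bound hyp2 hC8 mr hR r_cts bias ms sb cs subG monoG gX gU lU2 U_mean hs p01 lUp hH.
rewrite sx /F /r' !extE//; congr (cvg_in_distribution P _ _).
apply/funext => n; apply/funext => w; rewrite /gamma_estimator.
rewrite (sumE n (fun t => Phi (Y t w) * gamma_kernel h n x (X t w))).
by rewrite (sumE n (fun t => gamma_kernel h n x (X t w))).
Qed.

End gamma_regression.

(** Identifies the square of sqrt(n sqrt h) h with n sqrt(h^5), the quantity assumed to vanish for x
    > 0. *)
Lemma sqrt_sqr_half (R : realType) (a : R) : 0 <= a -> Num.sqrt (a ^+ 5) = Num.sqrt a * a ^+ 2.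
Proof.
move=> a0; rewrite (_ : a ^+ 5 = a * (a ^+ 2) ^+ 2); last by ring.
by rewrite sqrtrM// sqrtr_sqr ger0_norm// sqr_ge0.
Qed.

Lemma cvg_pinfty_inv (R : realType) (u : nat -> R) : u n @[n --> \oo] --> +oo ->
  (u n)^-1 @[n --> \oo] --> 0.
Proof.
move=> cu; apply/gtr0_cvgV0 => //; near=> n; near: n; exact: cvgry_gt.
Unshelve. all: by end_near.
Qed.

Theorem theorem3p4 (d : measure_display) (T : measurableType d) (R : realType)
  (P : probability T R) (X Y : int -> {RV P >-> R})
  (Phi : R -> R) (h : nat -> R)
  (f : R -> R) (fc : int -> T -> R -> R) (* fc t w is the density of X_t given F_(t-1) *)
  (r W2 Wz sigma2 : R -> R) (zeta x : R) :
  (* the process *)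
  (forall t w, 0 <= X t w) -> (forall t w, 0 <= Y t w) ->
  strictly_stationary P (fun t => X t) (fun t => Y t) ->
  ergodic P (fun t => X t) (fun t => Y t) ->
  (forall t, distribution P (X t) `<< lebesgue_measure) ->
  (forall t, distribution P (Y t) `<< lebesgue_measure) ->
  (forall t, is_density P (X t) f) ->
  measurable_fun halfline Phi ->
  P.-integrable setT (EFin \o (Phi \o Y 1)) ->
  is_cond_exp_at P (Phi \o Y 1) (X 1) r ->
  is_cond_exp_at P (fun w => Phi (Y 1 w) ^+ 2) (X 1) W2 ->
  is_cond_exp_at P (fun w => `|Phi (Y 1 w)| `^ (zeta + 2)) (X 1) Wz ->
  is_cond_var_at P (Phi \o Y 1) (X 1) sigma2 ->
  (* the bandwidths *)
  (forall n, 0 < h n) -> h n @[n --> \oo] --> 0 ->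
  (* the point *)
  0 <= x -> 0 < f x ->
  (* (1) *)
  (forall t, is_cond_density P (gen_F (fun s => X s) (fun s => Y s) (t - 1))
               (X t) (fc t)) ->
  (forall t, {ae P, forall w, C0 (fc t w)}) ->
  C0 f ->
  (* (2) *)
  {ae P, forall w,
    supnorm (fun y => n%:R^-1 * (\sum_(1 <= t < n.+1) fc t w y) - f y)
      @[n --> \oo] --> 0%E} ->
  (* (3) *)
  {within halfline, continuous r} -> bounded_on_halfline r ->
  (* (4) *)
  (forall t : int,
     is_cond_exp P (gen_G (fun s => X s) (fun s => Y s) (t - 1))
       (Phi \o Y t) (r \o X t) /\
     is_cond_exp P (gen_var (X t)) (Phi \o Y t) (r \o X t)) ->
  (* (5) *)
  0 < zeta ->
  P.-integrable setT (fun w => (`|Phi (Y 1 w)| `^ (zeta + 2))%:E) ->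
  (* (6) *)
  (forall t : int,
     is_cond_exp P (gen_G (fun s => X s) (fun s => Y s) (t - 1))
       (fun w => Phi (Y t w) ^+ 2) (W2 \o X t) /\
     is_cond_exp P (gen_var (X t)) (fun w => Phi (Y t w) ^+ 2) (W2 \o X t)) ->
  bounded_on_halfline Wz ->
  {within halfline, continuous sigma2} ->
  (* (7) *)
  bounded_C2 f -> bounded_C2 r ->
  (* (8) *)
  (exists C : R, \forall n \near \oo,
     (ereal_sup [set 'N[P]_(2%:E)[(fun w =>
          (\sum_(1 <= t < n.+1) fc t w y - n%:R * f y)%:E)] ^+ 2
        | y in halfline] <= (C * n%:R)%:E)%E) ->
  (* a) *)
  (0 < x ->
   n%:R * Num.sqrt (h n) @[n --> \oo] --> +oo ->
   n%:R * Num.sqrt (h n ^+ 5) @[n --> \oo] --> 0 ->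
   cvg_in_distribution P
     (fun n w => Num.sqrt (n%:R * Num.sqrt (h n)) *
        (gamma_estimator Phi h (fun t => X t) (fun t => Y t) n x w - r x))
     (centered_normal (sigma2 x / (2 * Num.sqrt (pi * x) * f x)))) /\
  (* b) *)
  (x = 0 ->
   n%:R * h n @[n --> \oo] --> +oo ->
   n%:R * h n ^+ 3 @[n --> \oo] --> 0 ->
   cvg_in_distribution P
     (fun n w => Num.sqrt (n%:R * h n) *
        (gamma_estimator Phi h (fun t => X t) (fun t => Y t) n 0 w - r 0))
     (centered_normal (sigma2 0 / (2 * f 0)))).
Proof.
move=> X0 Y0 stat _ _ _ densX mPhi _ r_cond W2_cond Wz_cond s_cond h0 ch x0 fx0 fc_cond _ f_C0
  hyp2 r_cont r_bnd hyp4 zeta0 _ hyp6 Wz_bnd s_cont f_C2 r_C2 hyp8.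
have main := @gamma_regression_clt d T R P X Y Phi h f fc r W2 Wz sigma2 zeta x X0 Y0 stat densX
  mPhi r_cond W2_cond Wz_cond s_cond ch x0 fx0 fc_cond f_C0 hyp2 r_cont r_bnd
  (fun t => proj1 (hyp4 t)) zeta0 (fun t => proj1 (hyp6 t)) Wz_bnd s_cont f_C2 r_C2 hyp8.
split=> [xp c1 c2|xe c1 c2].
- have [A lk] := gamma_kernel_localizing_pos h0 ch x0 xp.
  have cs := cvg_sqrt0 ch.
  have -> : sigma2 x / (2 * Num.sqrt (pi * x) * f x) = sigma2 x * (2 * Num.sqrt (pi * x))^-1 / f x.
    by rewrite invfM mulrA.
  apply: (main _ _ _ lk) => //; first exact: cvg_pinfty_inv.
  apply: (cvg0_sqr _ _ c2) => n; first by rewrite mulr_ge0 ?sqrtr_ge0// ltW.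
  rewrite exprMn sqr_sqrtr ?mulr_ge0 ?sqrtr_ge0// (sqrt_sqr_half (ltW (h0 n))).
  by rewrite -mulrA.
- have [A lk] := gamma_kernel_localizing_0 h0 ch x0 xe.
  have -> : sigma2 0 / (2 * f 0) = sigma2 x * 2^-1 / f x by rewrite xe invfM mulrA.
  rewrite xe in main lk *; apply: (main _ _ _ lk) => //; first exact: cvg_pinfty_inv.
  (* Here the square of sqrt(n h) h is n h^3. *)
  apply: (cvg0_sqr _ _ c2) => n; first by rewrite mulr_ge0 ?sqrtr_ge0// ltW.
  rewrite exprMn sqr_sqrtr ?mulr_ge0 ?(ltW (h0 n))//.
  by rewrite -mulrA -exprS.
Qed.
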